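(* $\mathcal{R}_{U_1}(W_2)\subseteq\mathrm{Aux2NC}$, and $\mathrm{Aux2NC}$ is contained in $\mathrm{P}$.
   Context: The 2-way tape $W_2$ is the memory model with cells $0,1,2,\dots$, initial cell $0$, and from each cell $n$ an edge $n\to n+1$ marked $+$ and an edge $n\to n-1$ marked $-$ (at cell $0$ the $-$ edge is taken to be a loop). An $h$-head automaton with auxiliary memory of model $W_2$ has a finite state set, input alphabet with endmarkers, a finite memory alphabet $\Delta$, a transition function mapping (state, the $h$ symbols under its 2-way read-only input heads, the current memory symbol) to (new state, a move in $\{-1,0,+1\}$ per head, and $+$, $-$ or ''stay'' for the memory position), an initial state and accepting states; it starts with heads at the leftmost input symbol and memory at cell $0$ and runs deterministically for a fixed memory content. It accepts $w$ with a $U_1$-restricted guess iff it reaches an accepting state on some memory content in which at most one cell contains a symbol other than the distinguished symbol $0\in\Delta$; $\mathcal{R}_{U_1}(W_2)$ is the class of languages recognized in this sense. $\mathrm{Aux2NC}$ is the class of languages recognized by nondeterministic 2-way counter automata with a logarithmic auxiliary memory, i.e. nondeterministic machines with a 2-way read-only input, a read/write work tape of size $O(\log n)$, and one counter (a nonnegative integer that can be incremented, decremented and tested for zero). *)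

(* Defs.v *)
From HB Require Import structures.
From mathcomp Require Import all_boot.

Set Implicit Arguments.
Unset Strict Implicit.
Unset Printing Implicit Defensive.

Definition language (Sigma : finType) := seq Sigma -> Prop.

Inductive dir := Minus | Stay | Plus.

Definition dir_code (d : dir) : option bool :=
  match d with Minus => Some false | Stay => None | Plus => Some true end.
Definition dir_decode (o : option bool) : dir :=
  match o with Some false => Minus | None => Stay | Some true => Plus end.
Lemma dir_codeK : cancel dir_code dir_decode.
Proof. by case. Qed.
HB.instance Definition _ := Finite.copy dir (can_type dir_codeK).

(* The graph W_2, whose [Minus] edge at cell 0 is a loop; one-way infinite
   read/write tapes have the same cells and moves. *)
Definition shift (d : dir) (n : nat) : nat :=
  match d with Minus => n.-1 | Stay => n | Plus => n.+1 end.

Notation marked Sigma := (Sigma + bool)%type.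
Notation lmark := (inr false).
Notation rmark := (inr true).

Section Input.
Variable Sigma : finType.
Implicit Type w : seq Sigma.

(* The word w between endmarkers, at positions 0, ..., (size w).+1. *)
Definition input_sym w (i : nat) : marked Sigma :=
  nth rmark (lmark :: rcons [seq inl a | a <- w] rmark) i.

(* A head does not leave the endmarkers. *)
Definition move_head w (d : dir) (i : nat) : nat :=
  minn (shift d i) (size w).+1.

End Input.

Section HeadAutomata.
Variables (Sigma : finType) (h : nat).

Record head_automaton := HeadAutomaton {
  ha_state : finType;
  ha_mem : finType;
  ha_zero : ha_mem;
  ha_trans : ha_state -> {ffun 'I_h -> marked Sigma} -> ha_mem ->
             ha_state * {ffun 'I_h -> dir} * dir;
  ha_init : ha_state;
  ha_acc : pred ha_state
}.

Variable A : head_automaton.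

Record ha_conf := HaConf {
  ha_q : ha_state A;
  ha_heads : {ffun 'I_h -> nat};
  ha_cell : nat
}.

Definition ha_start : ha_conf := HaConf (ha_init A) [ffun=> 0] 0.

Definition ha_step (m : nat -> ha_mem A) (w : seq Sigma) (c : ha_conf) :
    ha_conf :=
  let: (q, mv, d) :=
    ha_trans (ha_q c) [ffun i => input_sym w (ha_heads c i)] (m (ha_cell c)) in
  HaConf q [ffun i => move_head w (mv i) (ha_heads c i)] (shift d (ha_cell c)).

Definition ha_accepts_with (m : nat -> ha_mem A) (w : seq Sigma) : Prop :=
  exists t : nat, ha_acc (ha_q (iter t (ha_step m w) ha_start)).

Definition U1 (m : nat -> ha_mem A) : Prop :=
  forall i j, m i <> ha_zero A -> m j <> ha_zero A -> i = j.

Definition ha_accepts_U1 (w : seq Sigma) : Prop :=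
  exists2 m : nat -> ha_mem A, U1 m & ha_accepts_with m w.

End HeadAutomata.

Definition R_U1_W2 (Sigma : finType) (L : language Sigma) : Prop :=
  exists (h : nat) (A : head_automaton Sigma h),
    0 < h /\ forall w, L w <-> ha_accepts_U1 A w.

Section CounterAutomata.
Variable Sigma : finType.

(* [nc_trans q a g z] is the set of moves available in state q when the input
   head reads a, the work head reads g, and z tells whether the counter is 0.
   A move consists of the new state, the symbol written on the work tape, and
   the shifts of the input head, of the work head and of the counter. *)
Record counter_automaton := CounterAutomaton {
  nc_state : finType;
  nc_work : finType;
  nc_blank : nc_work;
  nc_trans : nc_state -> marked Sigma -> nc_work -> bool ->
             {set nc_state * nc_work * dir * dir * dir};
  nc_init : nc_state;
  nc_acc : pred nc_state
}.

Variable N : counter_automaton.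

Record nc_conf := NcConf {
  nc_q : nc_state N;
  nc_head : nat;
  nc_tape : nat -> nc_work N;
  nc_pos : nat;
  nc_ctr : nat
}.

Definition nc_start : nc_conf :=
  NcConf (nc_init N) 0 (fun _ => nc_blank N) 0 0.

(* Decrementing is not possible when the counter is 0. *)
Inductive nc_step (w : seq Sigma) (c : nc_conf) : nc_conf -> Prop :=
  NcStep q g di dw dc of
    (q, g, di, dw, dc) \in nc_trans (nc_q c) (input_sym w (nc_head c))
                                    (nc_tape c (nc_pos c)) (nc_ctr c == 0)
    & (dc = Minus -> 0 < nc_ctr c) :
  nc_step w c (NcConf q (move_head w di (nc_head c))
                 (fun i => if i == nc_pos c then g else nc_tape c i)
                 (shift dw (nc_pos c)) (shift dc (nc_ctr c))).

Inductive nc_reach (w : seq Sigma) : nc_conf -> Prop :=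
| NcReach0 : nc_reach w nc_start
| NcReachS c c' of nc_reach w c & nc_step w c c' : nc_reach w c'.

Definition nc_accepts (w : seq Sigma) : Prop :=
  exists2 c, nc_reach w c & nc_acc (nc_q c).

(* On every input, no computation leaves the first O(log n) work cells. *)
Definition nc_logspace : Prop :=
  exists k : nat, forall w c,
    nc_reach w c -> nc_pos c < k * (trunc_log 2 (size w)).+1.

End CounterAutomata.

Definition Aux2NC (Sigma : finType) (L : language Sigma) : Prop :=
  exists N : counter_automaton Sigma,
    nc_logspace N /\ forall w, L w <-> nc_accepts N w.

Section TuringMachines.
Variable Sigma : finType.

(* Deterministic Turing machines with [tm_aux_tapes].+1 one-way infinite
   tapes. Tape symbols are the blank None, the letters of Sigma and the
   machine's own symbols; [tm_halt q] is the verdict if q is halting. *)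
Record turing_machine := TuringMachine {
  tm_aux_tapes : nat;
  tm_state : finType;
  tm_aux_sym : finType;
  tm_trans : tm_state -> {ffun 'I_tm_aux_tapes.+1 -> option (Sigma + tm_aux_sym)} ->
             tm_state *
             {ffun 'I_tm_aux_tapes.+1 -> option (Sigma + tm_aux_sym) * dir};
  tm_init : tm_state;
  tm_halt : tm_state -> option bool
}.

Variable M : turing_machine.

Notation tape_sym := (option (Sigma + tm_aux_sym M)).
Notation tape_index := 'I_(tm_aux_tapes M).+1.

Record tm_conf := TmConf {
  tm_q : tm_state M;
  tm_tape : tape_index -> nat -> tape_sym;
  tm_pos : tape_index -> nat
}.

Definition tm_start (w : seq Sigma) : tm_conf :=
  TmConf (tm_init M)
    (fun k i => if k == ord0 then nth None [seq Some (inl a) | a <- w] i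
                else None)
    (fun _ => 0).

Definition tm_step (c : tm_conf) : tm_conf :=
  if tm_halt (tm_q c) is Some _ then c else
  let: (q, act) := tm_trans (tm_q c) [ffun k => tm_tape c k (tm_pos c k)] in
  TmConf q
    (fun k i => if i == tm_pos c k then (act k).1 else tm_tape c k i)
    (fun k => shift (act k).2 (tm_pos c k)).

Definition tm_verdict (w : seq Sigma) (t : nat) : option bool :=
  tm_halt (tm_q (iter t tm_step (tm_start w))).

End TuringMachines.

Definition PTIME (Sigma : finType) (L : language Sigma) : Prop :=
  exists (M : turing_machine Sigma) (k : nat), forall w,
    exists2 b : bool, tm_verdict M w (size w ^ k + k) = Some b & L w <-> b.

(* Main.v *)
Require Import Defs.
From mathcomp Require Import all_boot zify.
From Stdlib Require Import FunctionalExtensionality Relations.Relation_Operators Classical.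

(** All the classes involved are nondeterministic logarithmic space in disguise,
    and the proof goes through automata with finitely many heads that may run
    past the right end of the input ("rovers"), so that a head is also a
    counter; only runs that keep every head below a fixed power of the length of
    the input matter.

    - A [U1]-restricted guess is a cell [p] and a symbol. Away from [p] the state
      and the input heads evolve autonomously, so if they repeat at a cell not
      nearer to [p] the automaton never comes back to [p]. Hence a shortest
      accepting run never falls far below [p] again, nor climbs far beyond it,
      and pumping the first climb makes [p] polynomial. A rover then follows the
      run, with one head for the cell and one for its distance to [p].
    - A counter automaton follows a rover by writing the positions of the heads
      in a fixed base on a logarithmic number of work cells. These are laid out
      by halving the input length, with the counter and the input head.
    - Conversely, a rover follows a logspace counter automaton by keeping the
      work tape as two stacks, coded by numbers. The counter may be assumed
      polynomial: the runs between two equal positive values of the counter that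
      do not go below it are generated by a monotone operator on pairs of
      configurations, whose iteration stops after polynomially many rounds, and
      the number of rounds bounds the height of the runs.
    - A Turing machine decides acceptance by a rover by filling a table of
      reachable configurations, indexed by the positions of the heads. It is
      compiled from programs whose only loop construct repeats its body
      [(size w).+2] times, so its running time is visibly polynomial. *)

Set Implicit Arguments.
Unset Strict Implicit.
Unset Printing Implicit Defensive.

(** * Regular programs over a device *)

(** The simulations are simple in principle, but each simulated step takes a whole program, so the
    main burden is to verify programs. The nondeterministic simulators are therefore written as
    regular expressions over atomic moves, whose input-output relation is determined exactly, and
    are compiled once and for all. Nondeterminism replaces control: a loop is a bare [Star], left at
    a guessed moment, and a later test blocks if the guess was wrong. Blocked computations are
    harmless for acceptance but not for the space bound, which speaks of all computations; hence a
    second semantics, [visits], which also follows runs that never end. Pumping has to lower the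
    marked cell, and not only the run, because the distance to it is itself kept in a head. *)

Notation star := (@clos_refl_trans_n1 _).

Lemma star_trans (T : Type) (R : T -> T -> Prop) x y z :
  star R x y -> star R y z -> star R x z.
Proof. by move=> xy; elim=> // u v uv _ xu; exact: rtn1_trans uv xu. Qed.

Lemma star_step (T : Type) (R : T -> T -> Prop) x y : R x y -> star R x y.
Proof. by move=> xy; apply: rtn1_trans xy _; exact: rtn1_refl. Qed.

Lemma star_cons (T : Type) (R : T -> T -> Prop) x y z :
  R x y -> star R y z -> star R x z.
Proof. by move=> xy; apply: star_trans; exact: star_step. Qed.

Lemma star_inv (T : Type) (R : T -> T -> Prop) (I : T -> Prop) x y :
  (forall u v, I u -> R u v -> I v) -> I x -> star R x y -> I y.
Proof. by move=> HI Ix; elim=> // u v uv _ Iu; exact: HI uv. Qed.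

Lemma star_map (T U : Type) (f : T -> U) (R : T -> T -> Prop)
    (S : U -> U -> Prop) x y :
  (forall u v, R u v -> S (f u) (f v)) -> star R x y -> star S (f x) (f y).
Proof.
move=> RS; elim=> [|u v uv _ IH]; first exact: rtn1_refl.
by apply: rtn1_trans IH; exact: RS.
Qed.

Section Automata.
Variables O Cmd : finType.

(** The device enters only through its observations and the commands it admits, so one type of
    finite control serves rovers and counter machines alike. A bound on the device belongs to [app]
    and may vary for the same automaton. *)
Record automaton := Automaton {
  aut_state : finType;
  aut_trans : aut_state -> O -> {set aut_state * Cmd};
  aut_init : aut_state;
  aut_acc : pred aut_state
}.

Section Run.
Variables (D : Type) (obs : D -> O) (app : Cmd -> D -> D -> Prop).
Variable M : automaton.

Definition aut_step (s s' : aut_state M * D) : Prop :=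
  exists2 c, (s'.1, c) \in aut_trans s.1 (obs s.2) & app c s.2 s'.2.

Definition aut_accepts (d : D) : Prop :=
  exists2 s, star aut_step (aut_init M, d) s & aut_acc s.1.

End Run.

Variable F : finType.

Inductive prog :=
| Atom of F -> O -> F -> Cmd -> bool
| Seq of prog & prog
| Alt of prog & prog
| Star of prog.

(** Thompson's construction: a single entry and a single exit, linked by idle moves. [Alt] has
    endpoints of its own, since a [Star] returns to its entry and could otherwise leave through the
    other branch. *)
Fixpoint pst (p : prog) : finType :=
  match p with
  | Atom _ => bool
  | Seq p q => (pst p + pst q)%type
  | Alt p q => ((pst p + pst q) + bool)%type
  | Star p => option (pst p)
  end.

Fixpoint pentry (p : prog) : pst p :=
  match p with
  | Atom _ => false
  | Seq p q => inl (pentry p)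
  | Alt _ _ => inr false
  | Star _ => None
  end.

Fixpoint pexit (p : prog) : pst p :=
  match p with
  | Atom _ => true
  | Seq p q => inr (pexit q)
  | Alt _ _ => inr true
  | Star _ => None
  end.

Variable idle : O -> Cmd.

Definition skip (f : F) (o : O) (f' : F) (c : Cmd) :=
  (f' == f) && (c == idle o).

Fixpoint pstep (p : prog) :
    pst p -> F -> O -> pst p -> F -> Cmd -> bool :=
  match p with
  | Atom a => fun x f o y f' c => [&& ~~ x, y & a f o f' c]
  | Seq p q => fun x f o y f' c =>
      match x, y with
      | inl x, inl y => pstep x f o y f' c
      | inr x, inr y => pstep x f o y f' c
      | inl x, inr y =>
          [&& x == pexit p, y == pentry q & skip f o f' c]
      | inr _, inl _ => false
      end
  | Alt p q => fun x f o y f' c =>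
      match x, y with
      | inl (inl x), inl (inl y) => pstep x f o y f' c
      | inl (inr x), inl (inr y) => pstep x f o y f' c
      | inr false, inl (inl y) => (y == pentry p) && skip f o f' c
      | inr false, inl (inr y) => (y == pentry q) && skip f o f' c
      | inl (inl x), inr true => (x == pexit p) && skip f o f' c
      | inl (inr x), inr true => (x == pexit q) && skip f o f' c
      | _, _ => false
      end
  | Star p => fun x f o y f' c =>
      match x, y with
      | Some x, Some y => pstep x f o y f' c
      | None, Some y => (y == pentry p) && skip f o f' c
      | Some x, None => (x == pexit p) && skip f o f' c
      | None, None => false
      end
  end.

Definition compile (f0 : F) (acc : pred F) (p : prog) : automaton :=
  @Automaton (pst p * F)%type
    (fun x o => [set z | pstep x.1 x.2 o z.1.1 z.1.2 z.2])
    (pentry p, f0) (fun x => (x.1 == pexit p) && acc x.2).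

Section Semantics.
Variables (D : Type) (obs : D -> O) (app : Cmd -> D -> D -> Prop).
Hypothesis app_idle : forall d d', app (idle (obs d)) d d' <-> d' = d.
Implicit Type s : (F * D)%type.

Definition atom_rel (a : F -> O -> F -> Cmd -> bool) s s' : Prop :=
  exists2 c, a s.1 (obs s.2) s'.1 c & app c s.2 s'.2.

Fixpoint prel (p : prog) (s s' : F * D) : Prop :=
  match p with
  | Atom a => atom_rel a s s'
  | Seq p q => exists2 s1, prel p s s1 & prel q s1 s'
  | Alt p q => prel p s s' \/ prel q s s'
  | Star p => star (prel p) s s'
  end.

Lemma prel_seq p q s s' :
  prel (Seq p q) s s' <-> exists2 s1, prel p s s1 & prel q s1 s'.
Proof. by []. Qed.

Lemma prel_alt p q s s' : prel (Alt p q) s s' <-> prel p s s' \/ prel q s s'.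
Proof. by []. Qed.

Lemma prel_star p s s' : prel (Star p) s s' <-> star (prel p) s s'.
Proof. by []. Qed.

(* The stores met while running [p], whether or not [p] terminates. *)
Fixpoint visits (p : prog) (s s' : F * D) : Prop :=
  match p with
  | Atom a => s' = s \/ atom_rel a s s'
  | Seq p q => visits p s s' \/ (exists2 s1, prel p s s1 & visits q s1 s')
  | Alt p q => visits p s s' \/ visits q s s'
  | Star p => exists2 s1, star (prel p) s s1 & visits p s1 s'
  end.

(** An invariant is checked on the atoms only; it then holds at the end of a run ([preserves_prel])
    and all along it ([preserves_visits]). *)
Fixpoint preserves (I : F * D -> Prop) (p : prog) : Prop :=
  match p with
  | Atom a => forall s s', I s -> atom_rel a s s' -> I s'
  | Seq p q | Alt p q => preserves I p /\ preserves I q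
  | Star p => preserves I p
  end.

Lemma preserves_prel I p s s' : preserves I p -> I s -> prel p s s' -> I s'.
Proof.
elim: p s s' => [a|p IHp q IHq|p IHp q IHq|p IHp] s s' /=.
- by move=> H; exact: H.
- by move=> [Hp Hq] Is [s1 /(IHp _ _ Hp Is)]; exact: IHq.
- by move=> [Hp Hq] Is []; [exact: IHp | exact: IHq].
- by move=> Hp; apply: star_inv => u v Iu; exact: IHp.
Qed.

Lemma preserves_visits I p s s' :
  preserves I p -> I s -> visits p s s' -> I s'.
Proof.
elim: p s s' => [a|p IHp q IHq|p IHp q IHq|p IHp] s s' /=.
- by move=> H Is [->//|]; exact: H.
- move=> [Hp Hq] Is []; first exact: IHp.
  by move=> [s1 /(preserves_prel Hp Is)]; exact: IHq.
- by move=> [Hp Hq] Is []; [exact: IHp | exact: IHq].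
- move=> Hp Is [s1 ss1]; apply: IHp => //.
  by apply: star_inv ss1 => // u v Iu; exact: preserves_prel.
Qed.

Lemma visits_refl p s : visits p s s.
Proof.
elim: p s => [a|p IHp q IHq|p IHp q IHq|p IHp] s /=; [by left..|].
by exists s => //; exact: rtn1_refl.
Qed.

Definition pconf p : Type := (pst p * (F * D))%type.

Definition pconf_step p (u v : pconf p) : Prop :=
  exists2 c, pstep u.1 u.2.1 (obs u.2.2) v.1 v.2.1 c & app c u.2.2 v.2.2.

Lemma skip_step s s' :
  (exists2 c, skip s.1 (obs s.2) s'.1 c & app c s.2 s'.2) <-> s' = s.
Proof.
case: s s' => [f d] [f' d']; split=> /=.
  by move=> [c /andP[/eqP -> /eqP ->] /app_idle ->].
move=> [-> ->]; exists (idle (obs d)); first by rewrite /skip !eqxx.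
exact/app_idle.
Qed.

Lemma skip_refl s : exists2 c, skip s.1 (obs s.2) s.1 c & app c s.2 s.2.
Proof. exact/skip_step. Qed.

Lemma path_embed p q (g : pst p -> pst q) x y s s' :
  (forall x y f o f' c, pstep x f o y f' c -> pstep (g x) f o (g y) f' c) ->
  star (@pconf_step p) (x, s) (y, s') ->
  star (@pconf_step q) (g x, s) (g y, s').
Proof.
move=> Hg; pose h (u : pconf p) : pconf q := (g u.1, u.2).
apply: (star_map (f := h)) => u v [c uc cs].
by exists c => //; exact: Hg.
Qed.

Lemma path_skip p (x y : pst p) s :
  (forall f o f' c, skip f o f' c -> pstep x f o y f' c) ->
  star (@pconf_step p) (x, s) (y, s).
Proof.
move=> H; apply: star_step; have [c sc cs] := skip_refl s.
by exists c => //; exact: H.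
Qed.

Lemma prel_path p s s' :
  prel p s s' -> star (@pconf_step p) (pentry p, s) (pexit p, s').
Proof.
elim: p s s' => [a|p IHp q IHq|p IHp q IHq|p IHp] s s' /=.
- by move=> [c ac cs]; apply: star_step; exists c.
- move=> [s1 /IHp ps /IHq qs].
  apply: star_trans (path_embed (q := Seq p q) (g := inl) _ ps) _ => //.
  apply: star_trans (path_embed (q := Seq p q) (g := inr) _ qs) => //.
  by apply: (@path_skip (Seq p q)) => * /=; rewrite !eqxx.
- move=> [/IHp ps|/IHq qs].
  + apply: star_trans (@path_skip (Alt p q) _ (inl (inl (pentry p))) _ _) _.
      by move=> * /=; rewrite eqxx.
    apply: star_trans (path_embed (q := Alt p q) (g := inl \o inl) _ ps) _ => //.
    by apply: (@path_skip (Alt p q)) => * /=; rewrite eqxx.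
  + apply: star_trans (@path_skip (Alt p q) _ (inl (inr (pentry q))) _ _) _.
      by move=> * /=; rewrite eqxx.
    apply: star_trans (path_embed (q := Alt p q) (g := inl \o inr) _ qs) _ => //.
    by apply: (@path_skip (Alt p q)) => * /=; rewrite eqxx.
- elim=> [|u v /IHp ps _ IH]; first exact: rtn1_refl.
  apply: star_trans IH _.
  apply: star_trans (@path_skip (Star p) _ (Some (pentry p)) _ _) _.
    by move=> * /=; rewrite eqxx.
  apply: star_trans (path_embed (q := Star p) (g := Some) _ ps) _ => //.
  by apply: (@path_skip (Star p)) => * /=; rewrite eqxx.
Qed.

(** In a composite program the invariant [I] attaches to each control state the finished runs of
    subprograms and the partial path inside the current one. Both conclusions are proved at once, as
    a path in a later subprogram presupposes a complete run of the earlier one. *)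
Lemma path_prel p s (u : pconf p) :
  star (@pconf_step p) (pentry p, s) u ->
  visits p s u.2 /\ (u.1 = pexit p -> prel p s u.2).
Proof.
have skipE u1 u2 c : skip u1.1 (obs u1.2) u2.1 c -> app c u1.2 u2.2 -> u2 = u1.
  by move=> *; apply/skip_step; exists c.
elim: p s u => [a|p IHp q IHq|p IHp q IHq|p IHp] s u su.
- have: if u.1 then atom_rel a s u.2 else u.2 = s.
    move: su; pose I (v : pconf (Atom a)) := if v.1 then atom_rel a s v.2 else v.2 = s.
    apply: (star_inv (I := I)) => // -[x v] [y v'].
    rewrite /I /= => H [c /= /and3P[/negPf xF -> ac] cs].
    by rewrite xF in H; rewrite -H; exists c.
  by case: u {su} => -[] v /= H; split=> //; [right | left].
- pose I (v : pconf (Seq p q)) := match v.1 with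
    | inl x => star (@pconf_step p) (pentry p, s) (x, v.2)
    | inr y => exists2 s1, prel p s s1 & star (@pconf_step q) (pentry q, s1) (y, v.2)
    end.
  have: I u.
    move: su; apply: star_inv; last exact: rtn1_refl.
    move=> [[x|x] v] [[y|y] v'] //=; rewrite /I /=.
    + by move=> H [c /= xy cs]; apply: rtn1_trans H; exists c.
    + move=> /IHp[_ /= H] [c /and3P[/eqP/= /H ? /eqP->]].
      by move=> /skipE H1 /H1 ->; exists v => //; exact: rtn1_refl.
    + by move=> _ [].
    + by move=> [s1 ? H] [c /= xy cs]; exists s1 => //; apply: rtn1_trans H; exists c.
  case: u {su} => -[x|x] v; rewrite /I /=.
    by move=> /IHp[? _]; split=> //; left.
  move=> [s1 ss1 /IHq/= [vis H]]; split; first by right; exists s1.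
  by move=> [/H]; exists s1.
- pose I (v : pconf (Alt p q)) := match v.1 with
    | inl (inl x) => star (@pconf_step p) (pentry p, s) (x, v.2)
    | inl (inr x) => star (@pconf_step q) (pentry q, s) (x, v.2)
    | inr false => v.2 = s
    | inr true => prel p s v.2 \/ prel q s v.2
    end.
  have: I u.
    move: su; apply: star_inv => // -[x v] [y v'].
    case: x => [[x|x]|[]]; case: y => [[y|y]|[]]; rewrite /I /= => H [c] //=.
    + by move=> xy cs; apply: rtn1_trans H; exists c.
    + by move=> /andP[/eqP/= xE /skipE K] /K ->; left; apply: (IHp _ _ H).2.
    + by move=> xy cs; apply: rtn1_trans H; exists c.
    + by move=> /andP[/eqP/= xE /skipE K] /K ->; right; apply: (IHq _ _ H).2.
    + by move=> /andP[/eqP -> /skipE K] /K ->; rewrite H; exact: rtn1_refl.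
    + by move=> /andP[/eqP -> /skipE K] /K ->; rewrite H; exact: rtn1_refl.
  case: u {su} => -[[x|x]|[]] v; rewrite /I /=.
  + by move=> /IHp[? _]; split=> //; left.
  + by move=> /IHq[? _]; split=> //; right.
  (* At the exit only [prel] is known; turning it back into a path makes the [visits] half of the
     induction hypothesis available. *)
  + move=> H; split=> //; case: H => /prel_path.
      by move/IHp=> [? _]; left.
    by move/IHq=> [? _]; right.
  + by move=> ->; split=> //; left; exact: visits_refl.
- pose I (v : pconf (Star p)) := match v.1 with
    | Some x => exists2 s1, star (prel p) s s1
                          & star (@pconf_step p) (pentry p, s1) (x, v.2)
    | None => star (prel p) s v.2
    end.
  have: I u.
    move: su; apply: star_inv; last exact: rtn1_refl.
    move=> [[x|] v] [[y|] v'] //=; rewrite /I /=.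
    + by move=> [s1 ? H] [c /= xy cs]; exists s1 => //; apply: rtn1_trans H; exists c.
    + move=> [s1 H /IHp/= [_ K]] [c /andP[/eqP/= /K K1 /skipE/[apply] ->]].
      exact: rtn1_trans H.
    + move=> H [c /andP[/eqP/= -> /skipE/[apply] ->]].
      by exists v => //; exact: rtn1_refl.
    + by move=> _ [].
  case: u {su} => -[x|] v; rewrite /I /=.
    by move=> [s1 ? /IHp[? _]]; split=> //; exists s1.
  by move=> H; split=> //; exists v => //; exact: visits_refl.
Qed.

Lemma compile_step f0 acc p (u v : pst p * F * D) :
  aut_step obs app (M := compile f0 acc p) u v <->
  @pconf_step p (u.1.1, (u.1.2, u.2)) (v.1.1, (v.1.2, v.2)).
Proof.
by split=> -[c uv cs]; exists c => //; move: uv; rewrite inE.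
Qed.

Lemma compile_visits f0 acc p d u :
  star (aut_step obs app (M := compile f0 acc p)) ((pentry p, f0), d) u ->
  visits p (f0, d) (u.1.2, u.2).
Proof.
pose g (u : pst p * F * D) : pconf p := (u.1.1, (u.1.2, u.2)).
move=> H; have /= := star_map (f := g) (S := @pconf_step p) _ H.
by move/(_ (fun x y => (@compile_step f0 acc p x y).1))/path_prel => [].
Qed.

Lemma compile_accepts f0 acc p d :
  aut_accepts obs app (compile f0 acc p) d <->
  exists2 s, prel p (f0, d) s & acc s.1.
Proof.
split=> [[u H /andP[/eqP uE accu]]|[s /prel_path H accs]].
  pose g (u : pst p * F * D) : pconf p := (u.1.1, (u.1.2, u.2)).
  have /= := star_map (f := g) (S := @pconf_step p) _ H.
  move/(_ (fun x y => (@compile_step f0 acc p x y).1))/path_prel => [_ /(_ uE)].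
  by exists (u.1.2, u.2).
exists ((pexit p, s.1), s.2); last by rewrite /= eqxx.
pose g (u : pconf p) : pst p * F * D := ((u.1, u.2.1), u.2.2).
have /= := star_map (f := g) (S := aut_step obs app (M := compile f0 acc p)) _ H.
by apply=> -[x [f e]] [y [f' e']] xy; apply/compile_step.
Qed.

End Semantics.
End Automata.

Arguments prel : simpl never.

(** * Rovers *)

Definition flip (d : dir) : dir :=
  match d with Minus => Plus | Stay => Stay | Plus => Minus end.

Section Update.
Variable m : nat.
Implicit Types (x : {ffun 'I_m -> nat}) (j k : 'I_m).

Definition upd x j (v : nat) : {ffun 'I_m -> nat} :=
  [ffun k => if k == j then v else x k].

Lemma upd_at x j v : upd x j v j = v.
Proof. by rewrite ffunE eqxx. Qed.

Lemma upd_neq x j k v : k != j -> upd x j v k = x k.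
Proof. by move=> /negPf kj; rewrite ffunE kj. Qed.

Lemma upd_upd x j u v : upd (upd x j u) j v = upd x j v.
Proof. by apply/ffunP => k; rewrite !ffunE; case: eqP. Qed.

Lemma upd_id x j : upd x j (x j) = x.
Proof. by apply/ffunP => k; rewrite ffunE; case: eqP => // ->. Qed.

Section UpdateTwo.
Variables (j t : 'I_m) (x : {ffun 'I_m -> nat}).
Hypothesis jt : j != t.

(** The registers while a number is being moved between [j] and a scratch register [t]: the loop
    invariants of the transfers have this form. *)
Definition upd2 (u v : nat) : {ffun 'I_m -> nat} := upd (upd x j u) t v.

Lemma upd2_fst u v : upd2 u v j = u.
Proof. by rewrite upd_neq ?upd_at. Qed.

Lemma upd2_snd u v : upd2 u v t = v.
Proof. exact: upd_at. Qed.

Lemma upd_upd2_fst u v u' : upd (upd2 u v) j u' = upd2 u' v.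
Proof. by apply/ffunP => k; rewrite !ffunE; case: eqVneq => // ->; rewrite (negPf jt). Qed.

Lemma upd_upd2_snd u v v' : upd (upd2 u v) t v' = upd2 u v'.
Proof. exact: upd_upd. Qed.

Lemma upd2_zero u : x t = 0 -> upd2 u 0 = upd x j u.
Proof.
move=> x0; apply/ffunP => k; rewrite !ffunE; case: eqVneq => // ->.
by rewrite x0 eq_sym (negPf jt).
Qed.

End UpdateTwo.
End Update.

Section InputSymbols.
Variable Sigma : finType.
Implicit Type w : seq Sigma.

Lemma input_sym0 w : input_sym w 0 = lmark.
Proof. by []. Qed.

Lemma input_sym_eq_lmark w i : (input_sym w i == lmark) = (i == 0).
Proof.
case: i => [|i]; first by rewrite input_sym0 !eqxx.
rewrite /input_sym /= nth_rcons size_map.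
by case: ltngtP => // lt_i; case: w lt_i => [|a w] // lt_i; rewrite (nth_map a).
Qed.

Lemma input_sym_rmark w i : size w < i -> input_sym w i = rmark.
Proof.
case: i => // i lt_i; rewrite /input_sym /= nth_rcons size_map.
by case: ltngtP => //; lia.
Qed.

Lemma input_sym_letter w a i : i < size w -> input_sym w i.+1 = inl (nth a w i).
Proof. by move=> lt_i; rewrite /input_sym /= nth_rcons size_map lt_i (nth_map a). Qed.

Lemma input_sym_eq_rmark w i : (input_sym w i == rmark) = (size w < i).
Proof.
apply/eqP/idP => [|/input_sym_rmark//].
case: i => // i; apply: contraPltn => lt_i.
by case: w lt_i => // a w lt_i; rewrite (input_sym_letter a).
Qed.

(** Beyond the input every position shows [rmark], so a head that stops at the right endmarker reads
    the same as one that walks on. *)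
Lemma input_sym_minn w i : input_sym w (minn i (size w).+1) = input_sym w i.
Proof.
by case: leqP => // lt_i; rewrite !input_sym_rmark //; lia.
Qed.

End InputSymbols.

Section Rovers.
Variables (Sigma : finType) (m : nat).

(* A rover automaton has [m] heads, which see [rmark] at every position past
   the input and may go there; such a head is also a counter, being 0 exactly
   when it sees [lmark]. *)
Notation rover := (automaton {ffun 'I_m -> marked Sigma} {ffun 'I_m -> dir}).

Definition rover_obs (w : seq Sigma) (x : {ffun 'I_m -> nat}) :
    {ffun 'I_m -> marked Sigma} := [ffun j => input_sym w (x j)].

Definition rover_app (B : nat) (mv : {ffun 'I_m -> dir})
    (x x' : {ffun 'I_m -> nat}) : Prop :=
  x' = [ffun j => shift (mv j) (x j)] /\
  forall j, mv j = Plus -> (x j).+1 < B.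

Definition rover_accepts (M : rover) (B : nat) (w : seq Sigma) : Prop :=
  aut_accepts (rover_obs w) (rover_app B) M [ffun=> 0].

Definition rover_idle (o : {ffun 'I_m -> marked Sigma}) : {ffun 'I_m -> dir} :=
  [ffun=> Stay].

Lemma rover_app_idle w B x x' :
  rover_app B (rover_idle (rover_obs w x)) x x' <-> x' = x.
Proof.
have -> : rover_app B (rover_idle (rover_obs w x)) x x' <->
    x' = [ffun j => x j].
  split=> [[-> _]|->]; first by apply/ffunP => j; rewrite !ffunE.
  by split=> [|j]; first apply/ffunP => j; rewrite !ffunE.
by rewrite (_ : [ffun j => x j] = x) //; apply/ffunP => j; rewrite ffunE.
Qed.

Lemma rover_accepts_leq M B B' w :
  B <= B' -> rover_accepts M B w -> rover_accepts M B' w.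
Proof.
move=> leB [s s0 sacc]; exists s => //.
apply: (star_map (f := id)) s0 => u v [c Hc [vE Hb]].
exists c => //; split=> // j /Hb; lia.
Qed.

End Rovers.

Notation rover Sigma m :=
  (automaton {ffun 'I_m -> marked Sigma} {ffun 'I_m -> dir}).

(** The two directions speak of different bounds: no bound produces a wrong acceptance, and one
    power suffices for the right ones. A simulator may then work under whatever larger bound is
    convenient for it. *)
Definition rover_class (Sigma : finType) (L : language Sigma) : Prop :=
  exists (m : nat) (M : rover Sigma m) (K : nat), forall w,
    (forall B, rover_accepts M B w -> L w) /\
    (L w -> rover_accepts M ((size w).+2 ^ K) w).

(** * Loop programs on Turing machines *)

Section IndexedMachine.
Variables (Sigma I0 St Aux : finType).
Notation sym := (option (Sigma + Aux)).
Variable trans :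
  St -> {ffun option I0 -> sym} -> St * {ffun option I0 -> sym * dir}.
Variables (init : St) (halt : St -> option bool).

Record iconf := IConf {
  iq : St;
  itape : option I0 -> nat -> sym;
  ipos : option I0 -> nat
}.

Definition istart (w : seq Sigma) : iconf :=
  IConf init
    (fun k i => if k is None then nth None [seq Some (inl a) | a <- w] i else None)
    (fun _ => 0).

Definition istep (c : iconf) : iconf :=
  if halt (iq c) is Some _ then c else
  let: (q, act) := trans (iq c) [ffun k => itape c k (ipos c k)] in
  IConf q
    (fun k i => if i == ipos c k then (act k).1 else itape c k i)
    (fun k => shift (act k).2 (ipos c k)).

Definition tape_index (k : 'I_(#|I0|).+1) : option I0 :=
  omap enum_val (unlift ord0 k).

Definition tape_rank (k : option I0) : 'I_(#|I0|).+1 :=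
  oapp (fun i => lift ord0 (enum_rank i)) ord0 k.

Lemma tape_rankK : cancel tape_rank tape_index.
Proof.
case=> [i|]; rewrite /tape_index /tape_rank /=; last by rewrite unlift_none.
by rewrite liftK /= enum_rankK.
Qed.

Lemma tape_index_None k : (k == ord0) = (tape_index k == None).
Proof.
rewrite /tape_index; case: unliftP => [j ->|->] /=; last by rewrite !eqxx.
by apply/negbTE; rewrite eq_sym neq_lift.
Qed.

Definition tm_of_indexed : turing_machine Sigma :=
  @TuringMachine Sigma #|I0| St Aux
    (fun q syms =>
       let: (q', act) := trans q [ffun k => syms (tape_rank k)] in
       (q', [ffun k => act (tape_index k)]))
    init halt.

Definition tm_of_iconf (c : iconf) : tm_conf tm_of_indexed :=
  @TmConf Sigma tm_of_indexed (iq c) (fun k => itape c (tape_index k))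
    (fun k => ipos c (tape_index k)).

Lemma tm_of_istep c : tm_step (tm_of_iconf c) = tm_of_iconf (istep c).
Proof.
rewrite /tm_step /istep /=; case: (halt _) => //=.
have -> : [ffun k => [ffun k0 : 'I_(#|I0|).+1 =>
    itape c (tape_index k0) (ipos c (tape_index k0))] (tape_rank k)]
  = [ffun k => itape c k (ipos c k)].
  by apply/ffunP => k; rewrite !ffunE tape_rankK.
case: trans => q act; rewrite /tm_of_iconf /=.
by congr TmConf; apply: functional_extensionality => k;
  [apply: functional_extensionality => i|]; rewrite !ffunE.
Qed.

Lemma tm_of_istart w : tm_start tm_of_indexed w = tm_of_iconf (istart w).
Proof.
rewrite /tm_start /tm_of_iconf /=; congr TmConf.
apply: functional_extensionality => k; apply: functional_extensionality => i.
by rewrite tape_index_None; case: (tape_index k).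
Qed.

Lemma indexed_verdict w t :
  tm_verdict tm_of_indexed w t = halt (iq (iter t istep (istart w))).
Proof.
rewrite /tm_verdict tm_of_istart.
suff -> : iter t (@tm_step _ tm_of_indexed) (tm_of_iconf (istart w))
  = tm_of_iconf (iter t istep (istart w)) by [].
by elim: t => //= t ->; rewrite tm_of_istep.
Qed.

Lemma istep_halted c t b : halt (iq c) = Some b -> iter t istep c = c.
Proof. by move=> cb; elim: t => //= t ->; rewrite /istep cb. Qed.

End IndexedMachine.

(** * Programs with bounded loops, their meaning and their cost *)

Section LoopPrograms.
Variables (Sigma : finType) (r : nat) (F S : finType).

Notation regs := {ffun 'I_r -> nat}.
Notation rsyms := {ffun 'I_r -> marked Sigma}.

Record store := Store {
  mf : F;
  mr : regs;
  mt : nat -> option S;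
  mp : nat
}.

(** Unlike [prog], these programs are deterministic and total, so that [den] is a function and
    [cost] a closed formula in the length of the input. *)
Inductive lprog :=
| LAct of F -> rsyms -> option S -> F * {ffun 'I_r -> dir} * option S * dir
| LSeq of lprog & lprog
| LIf of (F -> rsyms -> option S -> bool) & lprog & lprog
| LLoop of lprog.

Definition mem_apply (m : store) (f : F) (mv : {ffun 'I_r -> dir})
    (s : option S) (d : dir) : store :=
  Store f [ffun j => shift (mv j) (mr m j)]
    (fun i => if i == mp m then s else mt m i) (shift d (mp m)).

Definition rsyms_of (w : seq Sigma) (m : store) : rsyms :=
  [ffun j => input_sym w (mr m j)].

Fixpoint den (w : seq Sigma) (p : lprog) (m : store) : store :=
  match p with
  | LAct a =>
      let: (f, mv, s, d) := a (mf m) (rsyms_of w m) (mt m (mp m)) in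
      mem_apply m f mv s d
  | LSeq p q => den w q (den w p m)
  | LIf b p q =>
      if b (mf m) (rsyms_of w m) (mt m (mp m)) then den w p m else den w q m
  | LLoop p => iter (size w).+2 (den w p) m
  end.

Fixpoint depth (p : lprog) : nat :=
  match p with
  | LAct _ => 0
  | LSeq p q | LIf _ p q => maxn (depth p) (depth q)
  | LLoop p => (depth p).+1
  end.

(** Besides its body, a pass of a loop pays one step for testing and advancing the counter and one
    step as its share of the final rewinding. For a conditional the sum bounds either branch. *)
Fixpoint cost (n : nat) (p : lprog) : nat :=
  match p with
  | LAct _ => 1
  | LSeq p q => cost n p + cost n q
  | LIf _ p q => (cost n p + cost n q).+1
  | LLoop p => n.+2 * (cost n p).+2
  end.

Lemma cost_poly p : exists C d, forall n, cost n p <= C * n.+2 ^ d.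
Proof.
elim: p => [a|p [C1 [d1 H1]] q [C2 [d2 H2]]|b p [C1 [d1 H1]] q [C2 [d2 H2]]|
            p [C [d H]]] /=.
- by exists 1, 0 => n; rewrite expn0.
- exists (C1 + C2), (d1 + d2) => n; rewrite mulnDl; apply: leq_add.
    apply: leq_trans (H1 n) _; rewrite leq_mul2l leq_exp2l //; lia.
  apply: leq_trans (H2 n) _; rewrite leq_mul2l leq_exp2l //; lia.
- exists (C1 + C2).+1, (d1 + d2) => n; rewrite mulSn mulnDl.
  have ? : 0 < n.+2 ^ (d1 + d2) by rewrite expn_gt0.
  have ? : cost n p <= C1 * n.+2 ^ (d1 + d2).
    apply: leq_trans (H1 n) _; rewrite leq_mul2l leq_exp2l //; lia.
  have ? : cost n q <= C2 * n.+2 ^ (d1 + d2).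
    apply: leq_trans (H2 n) _; rewrite leq_mul2l leq_exp2l //; lia.
  lia.
- exists C.+2, d.+1 => n; rewrite expnS mulnCA leq_mul2l /= !mulSn.
  have ? : 0 < n.+2 ^ d by rewrite expn_gt0.
  have := H n; lia.
Qed.

(** * Compilation with one loop counter per nesting depth *)

Section Compile.
(* Loops of nesting depth [k] count on the hidden tape [k]. *)
Variable D : nat.

Notation hheads := {ffun 'I_D.+1 -> nat}.
Notation hsyms := {ffun 'I_D.+1 -> marked Sigma}.
Notation action :=
  (F * {ffun 'I_r -> dir} * option S * dir * {ffun 'I_D.+1 -> dir})%type.

Fixpoint cst (p : lprog) : finType :=
  match p with
  | LAct _ => unit
  | LSeq p q => (cst p + cst q)%type
  | LIf _ p q => option (cst p + cst q)
  | LLoop p => (cst p + bool)%type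
  end.

Fixpoint centry (p : lprog) : cst p :=
  match p with
  | LAct _ => tt
  | LSeq p q => inl (centry p)
  | LIf _ p q => None
  | LLoop p => inl (centry p)
  end.

Definition hidden_move (f : F) (s : option S) (k : nat) (d : dir) : action :=
  (f, [ffun=> Stay], s, Stay,
   [ffun j : 'I_D.+1 => if j == k :> nat then d else Stay]).

(** [None] as the next state means that [p] is finished. A loop has two control states of its own:
    [inr false], after each pass, advances the counter or finds it on [rmark]; [inr true] then takes
    it back to [lmark], ready for the next loop of the same depth. *)
Fixpoint ctr (p : lprog) (x : cst p) (f : F) (o : rsyms) (s : option S)
    (h : hsyms) : option (cst p) * action :=
  match p return cst p -> option (cst p) * action with
  | LAct a => fun _ => (None, (a f o s, [ffun=> Stay]))
  | LSeq p q => fun x =>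
      match x with
      | inl x => let: (y, act) := ctr x f o s h in
                 (Some (if y is Some y then inl y else inr (centry q)), act)
      | inr x => let: (y, act) := ctr x f o s h in (omap inr y, act)
      end
  | LIf b p q => fun x =>
      match x with
      | None => (Some (Some (if b f o s then inl (centry p) else inr (centry q))),
                 hidden_move f s 0 Stay)
      | Some (inl x) =>
          let: (y, act) := ctr x f o s h in (omap (Some \o inl) y, act)
      | Some (inr x) =>
          let: (y, act) := ctr x f o s h in (omap (Some \o inr) y, act)
      end
  | LLoop p => fun x =>
      match x with
      | inl x => let: (y, act) := ctr x f o s h in
                 (Some (if y is Some y then inl y else inr false), act)
      | inr false =>
          if h (inord (depth p)) == rmark
          then (Some (inr true), hidden_move f s 0 Stay)
          else (Some (inl (centry p)), hidden_move f s (depth p) Plus)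
      | inr true =>
          if h (inord (depth p)) == lmark
          then (None, hidden_move f s 0 Stay)
          else (Some (inr true), hidden_move f s (depth p) Minus)
      end
  end x.

Variable w : seq Sigma.

Definition hsyms_of (H : hheads) : hsyms := [ffun j => input_sym w (H j)].

Definition cstep p (x : cst p) (m : store) (H : hheads) :
    option (cst p) * (store * hheads) :=
  let: (y, (f, mv, s, d, hd)) :=
    ctr x (mf m) (rsyms_of w m) (mt m (mp m)) (hsyms_of H) in
  (y, (mem_apply m f mv s d, [ffun j => shift (hd j) (H j)])).

Inductive runs p : cst p -> store -> hheads -> nat -> store -> hheads -> Prop :=
| RunExit x m H m' H' of cstep x m H = (None, (m', H')) : runs x m H 1 m' H'
| RunStep x m H y m1 H1 t m' H' of cstep x m H = (Some y, (m1, H1))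
    & runs y m1 H1 t m' H' : runs x m H t.+1 m' H'.

Lemma mem_apply_noop m : mem_apply m (mf m) [ffun=> Stay] (mt m (mp m)) Stay = m.
Proof.
case: m => f R T p; rewrite /mem_apply /=; congr Store.
  by apply/ffunP => j; rewrite !ffunE.
by apply: functional_extensionality => i; case: eqP => // ->.
Qed.

Lemma hidden_stay k (H : hheads) :
  [ffun j : 'I_D.+1 => shift ([ffun j : 'I_D.+1 =>
    if j == k :> nat then Stay else Stay] j) (H j)] = H.
Proof. by apply/ffunP => j; rewrite !ffunE if_same. Qed.

Section Embedding.
Variables (p p' : lprog) (g : cst p -> cst p') (after : option (cst p')).
Hypothesis ctr_embed : forall x f o s h,
  ctr (g x) f o s h =
  (if (ctr x f o s h).1 is Some y then Some (g y) else after, (ctr x f o s h).2).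

Lemma cstep_embed x m H :
  cstep (g x) m H =
  (if (cstep x m H).1 is Some y then Some (g y) else after, (cstep x m H).2).
Proof. by rewrite /cstep ctr_embed; case: ctr => y [[[[f mv] s] d] hd]. Qed.

Lemma runs_embed x m H t m1 H1 : after = None ->
  runs x m H t m1 H1 -> runs (g x) m H t m1 H1.
Proof.
move=> aN; elim=> {x m H t m1 H1} [x m H m' H' E|x m H y m1 H1 t m' H' E _].
  by apply: RunExit; rewrite cstep_embed E aN.
by apply: RunStep; rewrite cstep_embed E.
Qed.

Lemma runs_embed_then y x m H t m1 H1 t' m2 H2 : after = Some y ->
  runs x m H t m1 H1 -> runs y m1 H1 t' m2 H2 -> runs (g x) m H (t + t') m2 H2.
Proof.
move=> aS R1 R2; elim: R1 R2 => {x m H t m1 H1} [x m H m' H' E|x m H z m1 H1 t m' H' E _ IH] R2.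
  by apply: RunStep R2; rewrite cstep_embed E aS.
by apply: RunStep (IH R2); rewrite cstep_embed E.
Qed.

End Embedding.

Lemma runs_seq p q x m H t m1 H1 t' m2 H2 :
  @runs p x m H t m1 H1 -> @runs q (centry q) m1 H1 t' m2 H2 ->
  @runs (LSeq p q) (inl x) m H (t + t') m2 H2.
Proof.
move=> R1 R2; apply: (runs_embed_then (p' := LSeq p q) (g := inl) _ erefl R1).
  by move=> *; rewrite /=; case: ctr => -[].
by apply: (runs_embed (p' := LSeq p q) (g := inr) _ erefl R2) => *;
  rewrite /=; case: ctr => -[].
Qed.

Lemma runs_ifl b p q x m H t m1 H1 :
  @runs p x m H t m1 H1 -> @runs (LIf b p q) (Some (inl x)) m H t m1 H1.
Proof.
by apply: (runs_embed (p' := LIf b p q) (g := Some \o inl) _ erefl) => *;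
  rewrite /=; case: ctr => -[].
Qed.

Lemma runs_ifr b p q x m H t m1 H1 :
  @runs q x m H t m1 H1 -> @runs (LIf b p q) (Some (inr x)) m H t m1 H1.
Proof.
by apply: (runs_embed (p' := LIf b p q) (g := Some \o inr) _ erefl) => *;
  rewrite /=; case: ctr => -[].
Qed.

Lemma runs_loop_body p x m H t m1 H1 t' m2 H2 :
  @runs p x m H t m1 H1 -> @runs (LLoop p) (inr false) m1 H1 t' m2 H2 ->
  @runs (LLoop p) (inl x) m H (t + t') m2 H2.
Proof.
by apply: (runs_embed_then (p' := LLoop p) (g := inl) _ erefl) => *;
  rewrite /=; case: ctr => -[].
Qed.

Definition hset (H : hheads) (k i : nat) : hheads :=
  [ffun j : 'I_D.+1 => if j == k :> nat then i else H j].

Lemma hset_shift H k i d :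
  [ffun j : 'I_D.+1 => shift ([ffun j : 'I_D.+1 =>
    if j == k :> nat then d else Stay] j) (hset H k i j)] = hset H k (shift d i).
Proof. by apply/ffunP => j; rewrite !ffunE; case: eqP. Qed.

Lemma hsyms_hset H k i : k <= D ->
  hsyms_of (hset H k i) (inord k) = input_sym w i.
Proof. by move=> kD; rewrite !ffunE inordK // eqxx. Qed.

Lemma runs_rewind p m H i : depth p <= D ->
  @runs (LLoop p) (inr true) m (hset H (depth p) i) i.+1 m
        (hset H (depth p) 0).
Proof.
move=> pD; elim: i => [|i IH].
  apply: RunExit; rewrite /cstep /= hsyms_hset // input_sym_eq_lmark eqxx /=.
  by rewrite mem_apply_noop hidden_stay.
apply: RunStep IH; rewrite /cstep /= hsyms_hset // input_sym_eq_lmark /=.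
by rewrite mem_apply_noop hset_shift.
Qed.

(** Stated for a loop met with its counter at [i], so that induction on the distance from the
    counter to the right endmarker applies. *)
Lemma runs_loop p m H i c : depth p <= D -> i <= (size w).+1 ->
  (forall m i, exists2 t, t <= c &
     @runs p (centry p) m (hset H (depth p) i) t (den w p m)
           (hset H (depth p) i)) ->
  exists2 t, t <= ((size w).+2 - i) * c.+1 + (size w).+2 &
  @runs (LLoop p) (inl (centry p)) m (hset H (depth p) i) t
        (iter ((size w).+2 - i) (den w p) m) (hset H (depth p) 0).
Proof.
move=> pD + Hp; move Ej: ((size w).+1 - i) => j.
elim: j i m Ej => [|j IH] i m Ej lei; have [t ltc Rt] := Hp m i.
  have -> : i = (size w).+1 by lia.
  (* After the last body: one step to see [rmark], then [(size w).+2] steps to rewind from position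
     [(size w).+1]. *)
  exists (t + (size w).+3); first by lia.
  have -> : (size w).+2 - (size w).+1 = 1 by lia.
  have -> : (size w).+1 = i by lia.
  apply: runs_loop_body Rt _ => /=; apply: RunStep (@runs_rewind p _ _ _ pD).
  rewrite /cstep /= hsyms_hset // input_sym_eq_rmark.
  have -> : size w < i by lia.
  by rewrite /= mem_apply_noop hidden_stay.
have [||t' lt' Rt'] := IH i.+1 (den w p m); [lia..|].
exists (t + t'.+1); first by lia.
have -> : (size w).+2 - i = ((size w).+2 - i.+1).+1 by lia.
rewrite iterSr; apply: runs_loop_body Rt _; apply: RunStep Rt'.
rewrite /cstep /= hsyms_hset // input_sym_eq_rmark.
have -> : (size w < i) = false by lia.
by rewrite /= mem_apply_noop hset_shift.
Qed.

(** Only the counters below [depth p] belong to loops inside [p]; the others may be those of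
    enclosing loops in mid-course. All counters are returned unchanged, so the statement applies
    again at the next pass. *)
Lemma runs_den p m (H : hheads) : depth p <= D.+1 ->
  (forall j : 'I_D.+1, j < depth p -> H j = 0) ->
  exists2 t, t <= cost (size w) p & runs (centry p) m H t (den w p m) H.
Proof.
elim: p m H => [a|p IHp q IHq|b p IHp q IHq|p IHp] m H /= pD H0.
- exists 1 => //; apply: RunExit; rewrite /cstep /=.
  case: (a _ _ _) => [[[f mv] s] d]; congr (_, (_, _)).
  by apply/ffunP => j; rewrite !ffunE.
- have [||t1 ? R1] := IHp m H; [lia|by move=> *; apply: H0; lia|].
  have [||t2 ? R2] := IHq (den w p m) H; [lia|by move=> *; apply: H0; lia|].
  by exists (t1 + t2); [lia | exact: runs_seq R2].
- have [||t1 ? R1] := IHp m H; [lia|by move=> *; apply: H0; lia|].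
  have [||t2 ? R2] := IHq m H; [lia|by move=> *; apply: H0; lia|].
  case E: (b _ _ _).
    exists t1.+1; first by lia.
    apply: RunStep (runs_ifl b q R1).
    by rewrite /cstep /= E mem_apply_noop hidden_stay.
  exists t2.+1; first by lia.
  apply: RunStep (runs_ifr b p R2).
  by rewrite /cstep /= E mem_apply_noop hidden_stay.
- have HE : hset H (depth p) 0 = H.
    apply/ffunP => j; rewrite ffunE; case: eqP => // jE.
    by rewrite H0 // jE.
  have [//|//|m1 i|t lt Rt] := @runs_loop p m H 0 (cost (size w) p).
    apply: IHp => [|j ltj]; first lia.
    by rewrite ffunE; case: eqP => [jE|_]; [lia | apply: H0; lia].
  rewrite subn0 HE in lt Rt; exists t => //; lia.
Qed.

End Compile.

(** * The Turing machine: setup of the tapes, then the compiled program *)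

Section Machine.
Variables (p : lprog) (f0 : F) (verdict : pred F).

Notation D := (depth p).
(** The loops count on hidden tapes below [D]; with [D.+1] of them tape 0, which detects the end of
    the setup, is there even for a program without loops. *)
Notation copy := ('I_r + 'I_D.+1)%type.
Notation Aux := (marked Sigma + S)%type.
Notation sym := (option (Sigma + Aux)).
Notation St := (option bool + option (cst p) * F)%type.
Notation I0 := (option copy).

Definition copy_sym (a : marked Sigma) : sym := Some (inr (inl a)).
(** A blank reads as [rmark], so the finite copy shows a register the same symbols as [input_sym],
    however far to the right it goes. *)
Definition copy_read (s : sym) : marked Sigma :=
  if s is Some (inr (inl a)) then a else rmark.
Definition table_sym (s : option S) : sym := omap (inr \o inr) s.
Definition table_read (s : sym) : option S :=
  if s is Some (inr (inr x)) then Some x else None.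

Lemma table_symK : cancel table_sym table_read.
Proof. by case. Qed.

Definition tape_actions (input table : sym * dir) (copies : copy -> sym * dir) :
    {ffun option I0 -> sym * dir} :=
  [ffun k => match k with
             | None => input
             | Some None => table
             | Some (Some z) => copies z
             end].

(* Setup copies the marked input to the register tapes and the hidden tapes;
   it is over when the hidden tape 0 is back on its left endmarker. *)
Definition loop_trans (q : St) (syms : {ffun option I0 -> sym}) :
    St * {ffun option I0 -> sym * dir} :=
  let stay k := (syms k, Stay) in
  match q with
  | inl None =>
      (inl (Some false),
       tape_actions (stay None) (stay (Some None)) (fun _ => (copy_sym lmark, Plus)))
  | inl (Some false) =>
      if syms None is Some (inl a) then
        (inl (Some false),
         tape_actions (syms None, Plus) (stay (Some None))
           (fun _ => (copy_sym (inl a), Plus)))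
      else
        (inl (Some true),
         tape_actions (stay None) (stay (Some None))
           (fun _ => (copy_sym rmark, Stay)))
  | inl (Some true) =>
      if copy_read (syms (Some (Some (inr ord0)))) == lmark then
        (inr (Some (centry p), f0), [ffun k => stay k])
      else
        (inl (Some true),
         tape_actions (stay None) (stay (Some None))
           (fun z => (syms (Some (Some z)), Minus)))
  | inr (Some x, f) =>
      let: (y, (f', mv, s, d, hd)) :=
        ctr x f [ffun j => copy_read (syms (Some (Some (inl j))))]
          (table_read (syms (Some None)))
          [ffun j => copy_read (syms (Some (Some (inr j))))] in
      (inr (y, f'),
       tape_actions (stay None) (table_sym s, d)
         (fun z => (syms (Some (Some z)),
                    match z with inl j => mv j | inr j => hd j end)))
  | inr (None, _) => (q, [ffun k => stay k])
  end.

Definition loop_halt (q : St) : option bool :=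
  if q is inr (None, f) then Some (verdict f) else None.

Notation lstep := (istep loop_trans loop_halt).

Variable w : seq Sigma.

Definition mk_iconf (q : St) (input : nat) (T : nat -> sym) (tpos : nat)
    (C : nat -> sym) (cpos : copy -> nat) : @iconf Sigma I0 St Aux :=
  IConf q
    (fun k => match k with
              | None => nth None [seq Some (inl a) | a <- w]
              | Some None => T
              | Some (Some _) => C
              end)
    (fun k => match k with
              | None => input
              | Some None => tpos
              | Some (Some z) => cpos z
              end).

Definition copied (i j : nat) : sym :=
  if j < i then copy_sym (input_sym w j) else None.

Definition setup_conf (b : bool) (input i cpos : nat) :=
  mk_iconf (inl (Some b)) input (fun _ => None) 0 (copied i) (fun _ => cpos).

Lemma copied_step i a : input_sym w i = a ->
  (fun j => if j == i then copy_sym a else copied i j) = copied i.+1.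
Proof.
move=> <-; apply: functional_extensionality => j; rewrite /copied ltnS.
by case: ltngtP => // ->.
Qed.

Lemma same_tape (T : nat -> sym) i :
  (fun j => if j == i then T i else T j) = T.
Proof. by apply: functional_extensionality => j; case: eqP => // ->. Qed.

Lemma setup_start :
  lstep (istart I0 Aux (inl None : St) w) = setup_conf false 0 1 1.
Proof.
rewrite /istep /= /setup_conf /mk_iconf; congr IConf.
  apply: functional_extensionality => -[[z|]|]; rewrite !ffunE /=.
  - rewrite -(copied_step (a := lmark)) //.
  - exact: (same_tape (fun _ => None)).
  - exact: same_tape.
by apply: functional_extensionality => -[[z|]|]; rewrite !ffunE.
Qed.

Lemma setup_letter i : i < size w ->
  lstep (setup_conf false i i.+1 i.+1) = setup_conf false i.+1 i.+2 i.+2.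
Proof.
move=> lti; have [a0 _] : {a : Sigma | true} by case: w lti => // a; exists a.
have read : nth None [seq Some (inl a) : sym | a <- w] i = Some (inl (nth a0 w i)).
  by rewrite (nth_map a0).
rewrite /istep /= ffunE read /= /setup_conf /mk_iconf; congr IConf.
  apply: functional_extensionality => -[[z|]|]; rewrite !ffunE /=.
  - by rewrite -(@copied_step i.+1 (inl (nth a0 w i))) //; exact: input_sym_letter.
  - exact: (same_tape (fun _ => None)).
  - by apply: functional_extensionality => j; case: eqP => // ->; rewrite read.
by apply: functional_extensionality => -[[z|]|]; rewrite !ffunE.
Qed.

Lemma setup_end :
  lstep (setup_conf false (size w) (size w).+1 (size w).+1) =
  setup_conf true (size w) (size w).+2 (size w).+1.
Proof.
have read : nth None [seq Some (inl a) : sym | a <- w] (size w) = None.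
  by rewrite nth_default // size_map.
rewrite /istep /= ffunE read /= /setup_conf /mk_iconf; congr IConf.
  apply: functional_extensionality => -[[z|]|]; rewrite !ffunE /=.
  - by rewrite -(@copied_step (size w).+1 rmark) //; exact: input_sym_rmark.
  - exact: (same_tape (fun _ => None)).
  - by apply: functional_extensionality => j; case: eqP => // ->; rewrite read.
by apply: functional_extensionality => -[[z|]|]; rewrite !ffunE.
Qed.

Lemma copy_readE i : copy_read (copied (size w).+2 i) = input_sym w i.
Proof.
by rewrite /copied; case: leqP => //= lti; rewrite input_sym_rmark //; lia.
Qed.

Definition main_conf (x : option (cst p)) (m : store) (H : {ffun 'I_D.+1 -> nat}) :=
  mk_iconf (inr (x, mf m)) (size w) (table_sym \o mt m) (mp m)
    (copied (size w).+2)
    (fun z => match z with inl j => mr m j | inr j => H j end).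

Definition init_store : store := Store f0 [ffun=> 0] (fun _ => None) 0.

Lemma setup_rewind i :
  lstep (setup_conf true (size w) (size w).+2 i.+1) =
  setup_conf true (size w) (size w).+2 i.
Proof.
rewrite /istep /= ffunE copy_readE input_sym_eq_lmark /= /setup_conf /mk_iconf.
congr IConf.
  apply: functional_extensionality => -[[z|]|]; rewrite !ffunE /=;
    exact: same_tape.
by apply: functional_extensionality => -[[z|]|]; rewrite !ffunE.
Qed.

Lemma setup_done :
  lstep (setup_conf true (size w) (size w).+2 0) =
  main_conf (Some (centry p)) init_store [ffun=> 0].
Proof.
rewrite /istep /= ffunE copy_readE /= /main_conf /mk_iconf.
congr IConf.
  apply: functional_extensionality => -[[z|]|]; rewrite !ffunE /=;
    exact: same_tape.
by apply: functional_extensionality => -[[[j|j]|]|]; rewrite !ffunE.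
Qed.

Lemma setup_iter :
  iter ((size w).*2 + 4) lstep (istart I0 Aux (inl None : St) w) =
  main_conf (Some (centry p)) init_store [ffun=> 0].
Proof.
have letters i : i <= size w -> iter i lstep (setup_conf false 0 1 1)
    = setup_conf false i i.+1 i.+1.
  by elim: i => //= i IH lti; rewrite IH ?setup_letter // ltnW.
have rewind i : iter i lstep (setup_conf true (size w) (size w).+2 i)
    = setup_conf true (size w) (size w).+2 0.
  by elim: i => // i IH; rewrite iterSr setup_rewind.
(* Read from right to left: the left endmarker, the letters, the right endmarker, the rewinding, the
   last test. *)
have -> : (size w).*2 + 4 = (1 + ((size w).+1 + (1 + (size w + 1))))%N by lia.
rewrite !iterD /= setup_start letters // setup_end -iterS rewind.
exact: setup_done.
Qed.

Lemma main_step x m H y m' H' : cstep w x m H = (y, (m', H')) ->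
  lstep (main_conf (Some x) m H) = main_conf y m' H'.
Proof.
rewrite /cstep /istep /= ffunE /= table_symK.
have -> : [ffun j : 'I_r => copy_read ([ffun k => itape (main_conf (Some x) m H) k
    (ipos (main_conf (Some x) m H) k)] (Some (Some (inl j))))] = rsyms_of w m.
  by apply/ffunP => j; rewrite !ffunE /= copy_readE.
have -> : [ffun j : 'I_D.+1 => copy_read ([ffun k => itape (main_conf (Some x) m H) k
    (ipos (main_conf (Some x) m H) k)] (Some (Some (inr j))))] = hsyms_of w H.
  by apply/ffunP => j; rewrite !ffunE /= copy_readE.
case: ctr => x1 [[[[f mv] s] d] hd] [-> <- <-].
rewrite /main_conf /mk_iconf /=; congr IConf.
  apply: functional_extensionality => -[[z|]|]; rewrite !ffunE /=;
    try exact: same_tape.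
  by apply: functional_extensionality => i /=; case: eqP.
by apply: functional_extensionality => -[[[j|j]|]|]; rewrite !ffunE.
Qed.

Lemma main_iter x m H t m' H' : runs w x m H t m' H' ->
  iter t lstep (main_conf (Some x) m H) = main_conf None m' H'.
Proof.
elim=> {x m H t m' H'} [x m H m' H' E|x m H y m1 H1 t m' H' E _ IH].
  by rewrite /= (main_step E).
by rewrite iterSr (main_step E).
Qed.

Lemma loop_verdict t : (size w).*2 + 4 + cost (size w) p <= t ->
  tm_verdict (tm_of_indexed loop_trans (inl None) loop_halt) w t =
  Some (verdict (mf (den w p init_store))).
Proof.
move=> let_; rewrite indexed_verdict.
have [||t' let' R] := @runs_den D w p init_store [ffun=> 0] => //.
  by move=> j _; rewrite ffunE.
have -> : t = t - (t' + ((size w).*2 + 4)) + (t' + ((size w).*2 + 4)) by lia.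
rewrite iterD (iterD t') setup_iter (main_iter R).
by rewrite (istep_halted _ _ (b := verdict (mf (den w p init_store)))).
Qed.

End Machine.
End LoopPrograms.

(** For [n >= 2] one has [n.+2 <= n ^ 2] and [C <= n ^ C], which gives the exponent [C + d.*2]; the
    additive [k] covers the lengths 0 and 1, where powers of [n] do not grow. *)
Lemma poly_time_bound C d : exists k, forall n, C * n.+2 ^ d <= n ^ k + k.
Proof.
exists (C * 3 ^ d + C + d.*2) => n.
have [n0|n1|n2] := ltngtP n 1.
- have -> : n = 0 by lia.
  have : C * 2 ^ d <= C * 3 ^ d.
    by rewrite leq_mul2l; case: (d) => [|e]; rewrite ?expn0 ?leq_exp2r ?orbT.
  lia.
- have : C * n.+2 ^ d <= n ^ (C + d.*2).
    rewrite expnD; apply: leq_mul.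
      by apply: leq_trans (ltnW (ltn_expl C (ltnSn 1))) _; case: (C) => // c; rewrite leq_exp2r.
    by rewrite -mul2n expnM; case: (d) => // e; rewrite leq_exp2r //; nia.
  move=> H; apply: leq_trans H _; apply: leq_trans (leq_addr _ _).
  by rewrite leq_exp2l //; lia.
- rewrite n2 exp1n; lia.
Qed.

Theorem loop_PTIME (Sigma : finType) (r : nat) (F S : finType)
    (p : lprog Sigma r F S) (f0 : F) (verdict : pred F) (L : language Sigma) :
  (forall w, L w <-> verdict (mf (den w p (init_store r S f0)))) -> PTIME L.
Proof.
move=> HL; have [C [d Hc]] := cost_poly p.
have [k Hk] := poly_time_bound (C + 4) d.+1.
exists (tm_of_indexed (@loop_trans _ _ _ _ p f0) (inl None) (loop_halt verdict)), k => w.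
exists (verdict (mf (den w p (init_store r S f0)))); last exact: HL.
apply: loop_verdict; apply: leq_trans (Hk _).
have := Hc (size w); rewrite expnS.
have : 0 < (size w).+2 ^ d by rewrite expn_gt0.
nia.
Qed.

(** * Rovers in polynomial time *)

Local Arguments den : simpl never.

Section RoverPTIME.
Variables (Sigma : finType) (m : nat) (M : rover Sigma m) (K : nat).
Notation Q := (aut_state M).
Notation prg := (lprog Sigma m bool {set Q}).
Notation memory := (store m bool {set Q}).
Notation table := (nat -> option {set Q}).

Definition loopN k (p : prg) : prg := iter k (@LLoop _ _ _ _) p.

Definition lskip : prg := LAct (fun f o s => (f, [ffun=> Stay], s, Stay)).

Definition tmove (d : dir) : prg :=
  LAct (fun f o s => (f, [ffun=> Stay], s, d)).

Definition rmove (j : 'I_m) (d : dir) : prg :=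
  LAct (fun f o s => (f, [ffun k => if k == j then d else Stay], s, Stay)).

(* The register [j] has weight [(size w).+2 ^ (K.+1 * j)] in table positions;
   the radix [(size w).+2 ^ K.+1] leaves room for the value [(size w).+2 ^ K],
   which a register may reach but from which it is not explored. *)
Definition tshift (j : 'I_m) (d : dir) : prg := loopN (K.+1 * j) (tmove d).

Definition seqs (ps : seq prg) : prg := foldr (@LSeq _ _ _ _) lskip ps.

Definition tshifts (mv : {ffun 'I_m -> dir}) : prg :=
  seqs [seq tshift j (mv j) | j <- enum 'I_m].

(** A decrement at 0 has no effect, but its reverse would have one; replacing it by [Stay] makes
    every shift of the table head invertible by [flip]. *)
Definition effective (o : {ffun 'I_m -> marked Sigma}) (mv : {ffun 'I_m -> dir}) :
    {ffun 'I_m -> dir} :=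
  [ffun j => if (mv j == Minus) && (o j == lmark) then Stay else mv j].

Definition states_at (T : table) (i : nat) : {set Q} := odflt set0 (T i).

Definition edge_enabled (e : Q * Q * {ffun 'I_m -> dir})
    (o : {ffun 'I_m -> marked Sigma}) (s : option {set Q}) : bool :=
  (e.1.1 \in odflt set0 s) &&
  [exists mv, ((e.1.2, mv) \in aut_trans e.1.1 o) && (e.2 == effective o mv)].

Definition add_state (q : Q) : prg :=
  LAct (fun f o s => (f, [ffun=> Stay], Some (q |: odflt set0 s), Stay)).

Definition edge (e : Q * Q * {ffun 'I_m -> dir}) : prg :=
  LIf (fun _ o s => edge_enabled e o s)
    (LSeq (tshifts e.2) (LSeq (add_state e.1.2) (tshifts [ffun j => flip (e.2 j)])))
    lskip.

Definition check_acc : prg :=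
  LAct (fun f o s =>
    (f || [exists q in odflt set0 s, aut_acc q], [ffun=> Stay], s, Stay)).

Definition explore : prg :=
  LSeq check_acc (seqs [seq edge e | e <- enum {: Q * Q * {ffun 'I_m -> dir}}]).

(** Nested loops over the registers, with the table head following. After its last pass a register
    stands on [(size w).+2 ^ K], and the second loop takes it down to 0 again. *)
Fixpoint sweep (js : seq 'I_m) (b : prg) : prg :=
  if js is j :: js then
    LSeq (loopN K (LSeq (sweep js b) (LSeq (rmove j Plus) (tshift j Plus))))
         (loopN K (LSeq (rmove j Minus) (tshift j Minus)))
  else b.

(** A sweep extends reachability by at least one step from every explored entry, whatever the order
    of the visits. Hence as many sweeps as there are configurations suffice; the exponent comes from
    their number, bounded in [card_cfg]. *)
Definition rover_prog : prg :=
  LSeq (add_state (aut_init M))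
       (loopN (#|Q| + K * m).+1 (sweep (enum 'I_m) explore)).

Variable w : seq Sigma.
Implicit Types (x y : {ffun 'I_m -> nat}) (j : 'I_m) (mv : {ffun 'I_m -> dir}).
Notation n2 := (size w).+2.
Notation B := (n2 ^ K).
Notation W := (n2 ^ K.+1).

Lemma den_loopN k p mm : den w (loopN k p) mm = iter (n2 ^ k) (den w p) mm.
Proof.
elim: k mm => [|k IH] mm //; rewrite expnS iterM.
exact: (@eq_iter _ _ _ IH n2).
Qed.

Lemma den_lskip mm : den w lskip mm = mm.
Proof. exact: mem_apply_noop. Qed.

Definition set_pos (mm : memory) (i : nat) : memory :=
  Store (mf mm) (mr mm) (mt mm) i.

Lemma den_tmove d mm : den w (tmove d) mm = set_pos mm (shift d (mp mm)).
Proof.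
case: mm => f R T i; rewrite /den /mem_apply /set_pos /=; congr Store.
  by apply/ffunP => j; rewrite !ffunE.
by apply: functional_extensionality => k; case: eqP => // ->.
Qed.

Definition moved (d : dir) (a i : nat) : nat :=
  match d with Minus => i - a | Stay => i | Plus => i + a end.

Lemma den_tshift j d mm :
  den w (tshift j d) mm = set_pos mm (moved d (W ^ j) (mp mm)).
Proof.
rewrite den_loopN -expnM.
elim: (n2 ^ (K.+1 * j)) => [|a IH].
  by case: mm d => f R T i []; rewrite /set_pos /moved /= ?subn0 ?addn0.
rewrite iterS IH den_tmove /set_pos /=; congr Store.
by case: (d) => /=; lia.
Qed.

Definition idx (x : {ffun 'I_m -> nat}) : nat := \sum_j x j * W ^ j.

Lemma idx_upd x j v : idx (upd x j v) + x j * W ^ j = idx x + v * W ^ j.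
Proof.
rewrite /idx (bigD1 j) //= [\sum_j x j * _](bigD1 j) //= ffunE eqxx.
rewrite (eq_bigr (fun i : 'I_m => x i * W ^ i)) => [|i ij]; first lia.
by rewrite ffunE (negPf ij).
Qed.

Lemma moved_idx x j d : (d = Minus -> 0 < x j) ->
  moved d (W ^ j) (idx x) = idx (upd x j (shift d (x j))).
Proof.
move=> Hd; have := idx_upd x j (shift d (x j)).
case: d Hd => /= Hd; [have {Hd} := Hd erefl| |]; last 2 first.
- lia.
- rewrite mulSn; lia.
case: (x j) => // a _; rewrite mulSn /=; lia.
Qed.

(** Uniqueness of digits in base [W], peeled off from the least significant one: two configurations
    never share a cell of the table. *)
Lemma idx_inj x y : (forall j, x j < W) -> (forall j, y j < W) ->
  idx x = idx y -> x = y.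
Proof.
rewrite /idx => ltx lty; elim: m x y ltx lty => [|k IH] x y ltx lty.
  by move=> _; apply/ffunP => -[].
rewrite !big_ord_recl /= !expn0 !muln1.
have shiftW (z : {ffun 'I_k.+1 -> nat}) :
    \sum_(i < k) z (lift ord0 i) * W ^ bump 0 i
    = (\sum_(i < k) [ffun i => z (lift ord0 i)] i * W ^ i) * W.
  by rewrite big_distrl /=; apply: eq_bigr => i _; rewrite ffunE /bump leq0n add1n expnSr mulnA.
rewrite !shiftW => E.
have W0 : 0 < W by rewrite expn_gt0.
have E0 : x ord0 = y ord0.
  by have := congr1 (modn^~ W) E; rewrite addnC modnMDl [in RHS]addnC modnMDl !modn_small.
have /IH E1 : \sum_(i < k) [ffun i => x (lift ord0 i)] i * W ^ i
    = \sum_(i < k) [ffun i => y (lift ord0 i)] i * W ^ i.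
  by apply/eqP; rewrite -(eqn_pmul2r W0); apply/eqP; lia.
apply/ffunP => i; case: (unliftP ord0 i) => [j ->|-> //].
have /ffunP/(_ j) : [ffun i => x (lift ord0 i)] = [ffun i => y (lift ord0 i)].
  by apply: E1 => l; rewrite ffunE.
by rewrite !ffunE.
Qed.

Lemma den_tshifts_seq (mv : {ffun 'I_m -> dir}) (js : seq 'I_m) x mm :
  uniq js -> (forall j, j \in js -> mv j = Minus -> 0 < x j) ->
  mp mm = idx x ->
  den w (seqs [seq tshift j (mv j) | j <- js]) mm =
  set_pos mm (idx [ffun j => if j \in js then shift (mv j) (x j) else x j]).
Proof.
elim: js x mm => [|j js IH] x mm.
  move=> _ _ E; rewrite den_lskip.
  case: mm E => f R T i /= ->; rewrite /set_pos; congr Store.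
  by congr idx; apply/ffunP => j; rewrite ffunE.
rewrite cons_uniq => /andP[jjs ujs] Hmv E.
rewrite -[LHS]/(den w (seqs [seq tshift j (mv j) | j <- js])
                    (den w (tshift j (mv j)) mm)).
rewrite den_tshift E moved_idx; last by apply: Hmv; rewrite mem_head.
rewrite (IH (upd x j (shift (mv j) (x j)))) //.
  rewrite /set_pos; congr Store; congr idx; apply/ffunP => k; rewrite !ffunE in_cons.
  by case: eqP => [->|_] //=; rewrite (negPf jjs).
move=> k kjs mvk; rewrite ffunE; case: eqP => [kj|_].
  by rewrite -kj kjs in jjs.
by apply: Hmv mvk; rewrite in_cons kjs orbT.
Qed.

Lemma den_tshifts mv x mm : (forall j, mv j = Minus -> 0 < x j) ->
  mp mm = idx x ->
  den w (tshifts mv) mm = set_pos mm (idx [ffun j => shift (mv j) (x j)]).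
Proof.
move=> Hmv E; rewrite (den_tshifts_seq (x := x)) ?enum_uniq //.
  by congr set_pos; congr idx; apply/ffunP => j; rewrite !ffunE mem_enum.
by move=> j _; exact: Hmv.
Qed.

Definition add_at (T : table) (i : nat) (q : Q) : table :=
  fun k => if k == i then Some (q |: states_at T k) else T k.

Lemma states_add_at T i q k :
  states_at (add_at T i q) k = if k == i then q |: states_at T k else states_at T k.
Proof. by rewrite /add_at /states_at; case: (k == i). Qed.

Lemma den_add_state q mm :
  den w (add_state q) mm = Store (mf mm) (mr mm) (add_at (mt mm) (mp mm) q) (mp mm).
Proof.
case: mm => f R T i; rewrite /den /mem_apply /=; congr Store.
  by apply/ffunP => j; rewrite !ffunE.
by apply: functional_extensionality => k; rewrite /add_at; case: eqP => // ->.
Qed.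

Definition good (mm : memory) (x : {ffun 'I_m -> nat}) : Prop :=
  mr mm = x /\ mp mm = idx x.

Lemma den_edge e x mm : good mm x ->
  den w (edge e) mm =
  if edge_enabled e (rover_obs w x) (mt mm (idx x))
  then Store (mf mm) x (add_at (mt mm) (idx [ffun j => shift (e.2 j) (x j)]) e.1.2)
           (idx x)
  else mm.
Proof.
case: mm => f R T i [/= -> ->].
rewrite -[LHS]/(if edge_enabled e (rover_obs w x) (T (idx x))
  then den w (tshifts [ffun j => flip (e.2 j)]) (den w (add_state e.1.2)
       (den w (tshifts e.2) (Store f x T (idx x)))) else den w lskip (Store f x T (idx x))).
case: ifP => [/andP[_ /existsP[mv /andP[_ /eqP e2]]]|_]; last exact: den_lskip.
have pos j : e.2 j = Minus -> 0 < x j.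
  rewrite e2 !ffunE; case: eqP => [_|//] /=.
  by rewrite input_sym_eq_lmark; case: (x j).
rewrite (den_tshifts (mv := e.2) (x := x)) // den_add_state /=.
rewrite (den_tshifts (x := [ffun j => shift (e.2 j) (x j)])) //=.
  rewrite /set_pos /=; congr Store; congr idx; apply/ffunP => j; rewrite !ffunE.
  by have := pos j; case: (e.2 j) => //= /(_ erefl); case: (x j).
by move=> j; rewrite !ffunE; case: (e.2 j).
Qed.

(** * Soundness and progress of one sweep of the table *)

Definition below (x : {ffun 'I_m -> nat}) : Prop := forall j, x j < B.

Definition sub_table (T T' : table) : Prop :=
  forall i, states_at T i \subset states_at T' i.

Definition reached (s : Q * {ffun 'I_m -> nat}) : Prop :=
  star (aut_step (rover_obs w) (rover_app B.+1) (M := M)) (aut_init M, [ffun=> 0]) s.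

(** Entries may have registers equal to [B], reached from configurations below [B]; therefore the
    digits are bounded by [W] and the runs by [B.+1]. *)
Definition sound (f : bool) (T : table) : Prop :=
  (f -> rover_accepts M B.+1 w) /\
  forall i q, q \in states_at T i ->
    exists x, [/\ i = idx x, forall j, x j < W & reached (q, x)].

Lemma B_lt_W : B < W.
Proof. by rewrite ltn_exp2l. Qed.

Lemma shift_effective x mv :
  [ffun j => shift (effective (rover_obs w x) mv j) (x j)]
  = [ffun j => shift (mv j) (x j)].
Proof.
apply/ffunP => j; rewrite !ffunE input_sym_eq_lmark.
by case: ifP => // /andP[/eqP -> /eqP ->].
Qed.

Lemma sound_reached f T q x : sound f T -> below x ->
  q \in states_at T (idx x) -> reached (q, x).
Proof.
move=> [_ H] ltx /H[y [E lty]]; rewrite (idx_inj lty _ (esym E)) // => j.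
exact: ltn_trans (ltx j) B_lt_W.
Qed.

Lemma edge_sound e x mm : below x -> good mm x -> sound (mf mm) (mt mm) ->
  let mm' := den w (edge e) mm in
  [/\ good mm' x, sound (mf mm') (mt mm'), mf mm' = mf mm & sub_table (mt mm) (mt mm')].
Proof.
move=> ltx gx snd; cbv zeta; rewrite (den_edge e gx).
case: ifP => [/andP[qT /existsP[mv /andP[tr /eqP e2]]]|_]; last by split=> // i.
split=> //=; last first.
  by move=> i; rewrite states_add_at; case: eqP => // _; rewrite subsetUr.
have rq := sound_reached snd ltx qT.
split; first exact: snd.1.
move=> i q; rewrite states_add_at; case: eqP => [->|_]; last exact: snd.2.
rewrite in_setU1 => /predU1P[->|]; last exact: snd.2.
exists [ffun j => shift (e.2 j) (x j)]; split=> // [j|].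
  rewrite ffunE; apply: leq_ltn_trans B_lt_W; have := ltx j; case: (e.2 j) => /=; lia.
rewrite e2 shift_effective; apply: rtn1_trans rq; exists mv => //; split=> // j _.
by have := ltx j.
Qed.

Lemma edges_sound es x mm : below x -> good mm x -> sound (mf mm) (mt mm) ->
  let mm' := den w (seqs [seq edge e | e <- es]) mm in
  [/\ good mm' x, sound (mf mm') (mt mm'), mf mm' = mf mm & sub_table (mt mm) (mt mm')].
Proof.
move=> ltx; elim: es mm => [|e es IH] mm gx snd.
  by cbv zeta; rewrite (_ : seqs _ = lskip) // den_lskip; split=> // i.
have [gx1 snd1 fE s1] := edge_sound e ltx gx snd.
have [? ? fE' s2] := IH _ gx1 snd1; split=> //; first by rewrite -fE -fE'.
by move=> i; exact: subset_trans (s1 i) (s2 i).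
Qed.

(** The table only grows and stays sound, so the hypotheses survive the earlier edges until the one
    in question has its turn, and the conclusion survives the later ones. *)
Lemma edges_complete es x mm q q' mv : below x -> good mm x ->
  sound (mf mm) (mt mm) -> q \in states_at (mt mm) (idx x) ->
  (q', mv) \in aut_trans q (rover_obs w x) ->
  (q, q', effective (rover_obs w x) mv) \in es ->
  q' \in states_at (mt (den w (seqs [seq edge e | e <- es]) mm))
                   (idx [ffun j => shift (mv j) (x j)]).
Proof.
move=> ltx + + + tr; elim: es mm => // e es IH mm gx snd qT.
have [gx' snd' _ sub] := edge_sound e ltx gx snd.
rewrite in_cons => /predU1P[eE|]; last first.
  by apply: IH => //; exact: (subsetP (sub _)).
have [_ _ _ sub'] := edges_sound es ltx gx' snd'.
apply: (subsetP (sub' _)); rewrite (den_edge e gx) -eE ifT.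
  by rewrite shift_effective states_add_at eqxx setU11.
apply/andP; split; first exact: qT.
by apply/existsP; exists mv; rewrite /= tr eqxx.
Qed.

Lemma den_check_acc mm :
  den w check_acc mm =
  Store (mf mm || [exists q in states_at (mt mm) (mp mm), aut_acc q])
      (mr mm) (mt mm) (mp mm).
Proof.
case: mm => f R T i; rewrite /den /mem_apply /=; congr Store.
  by apply/ffunP => j; rewrite !ffunE.
by apply: functional_extensionality => k; case: eqP => // ->.
Qed.

Lemma check_acc_sound x mm : below x -> good mm x -> sound (mf mm) (mt mm) ->
  let mm' := den w check_acc mm in good mm' x /\ sound (mf mm') (mt mm').
Proof.
move=> ltx gx snd; cbv zeta; rewrite den_check_acc; split=> //; split; last exact: snd.2.
move=> /orP[|/existsP[q /andP[qT qacc]]]; first exact: snd.1.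
rewrite gx.2 in qT; exists (q, x) => //.
exact: sound_reached snd ltx qT.
Qed.

Lemma explore_sound x mm : below x -> good mm x -> sound (mf mm) (mt mm) ->
  let mm' := den w explore mm in
  [/\ good mm' x, sound (mf mm') (mt mm'), (mf mm -> mf mm') & sub_table (mt mm) (mt mm')].
Proof.
move=> ltx gx snd; have [gx' snd'] := check_acc_sound ltx gx snd.
have [? ? fE sub] := edges_sound (enum {: Q * Q * {ffun 'I_m -> dir}}) ltx gx' snd'.
split=> //; first by move=> fm; rewrite [mf _]fE den_check_acc /= fm.
by move: sub; rewrite (_ : mt (den w check_acc mm) = mt mm) // den_check_acc.
Qed.

Lemma explore_acc x mm q : below x -> good mm x -> sound (mf mm) (mt mm) ->
  q \in states_at (mt mm) (idx x) -> aut_acc q -> mf (den w explore mm).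
Proof.
move=> ltx gx snd qT qacc; have [gx' snd'] := check_acc_sound ltx gx snd.
have [_ _ fE _] := edges_sound (enum {: Q * Q * {ffun 'I_m -> dir}}) ltx gx' snd'.
rewrite [mf _]fE den_check_acc /= gx.2; apply/orP; right; apply/existsP; exists q; exact/andP.
Qed.

Lemma explore_complete x mm q q' mv : below x -> good mm x ->
  sound (mf mm) (mt mm) -> q \in states_at (mt mm) (idx x) ->
  (q', mv) \in aut_trans q (rover_obs w x) ->
  q' \in states_at (mt (den w explore mm)) (idx [ffun j => shift (mv j) (x j)]).
Proof.
move=> ltx gx snd qT tr; have [gx' snd'] := check_acc_sound ltx gx snd.
have qT' : q \in states_at (mt (den w check_acc mm)) (idx x) by rewrite den_check_acc.
by apply: (edges_complete ltx gx' snd' qT' tr); rewrite mem_enum.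
Qed.

Lemma den_step_up j x mm : good mm x ->
  let mm' := den w (LSeq (rmove j Plus) (tshift j Plus)) mm in
  [/\ good mm' (upd x j (x j).+1), mf mm' = mf mm & mt mm' = mt mm].
Proof.
case: mm => f R T i [/= -> ->].
rewrite -[den _ _ _]/(den w (tshift j Plus) (den w (rmove j Plus) (Store f x T (idx x)))).
rewrite den_tshift {2}/den /mem_apply /=; split=> //; last first.
  by apply: functional_extensionality => k; case: eqP => // ->.
split=> /=; last exact: (@moved_idx x j Plus).
by apply/ffunP => k; rewrite !ffunE; case: eqP => // ->.
Qed.

Lemma den_step_down j x mm : good mm x -> 0 < x j ->
  let mm' := den w (LSeq (rmove j Minus) (tshift j Minus)) mm in
  [/\ good mm' (upd x j (x j).-1), mf mm' = mf mm & mt mm' = mt mm].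
Proof.
case: mm => f R T i [/= -> ->] xj.
rewrite -[den _ _ _]/(den w (tshift j Minus) (den w (rmove j Minus) (Store f x T (idx x)))).
rewrite den_tshift {2}/den /mem_apply /=; split=> //; last first.
  by apply: functional_extensionality => k; case: eqP => // ->.
split=> /=; last exact: (@moved_idx x j Minus).
by apply/ffunP => k; rewrite !ffunE; case: eqP => // ->.
Qed.

Lemma den_steps_down j x a k mm : good mm (upd x j (a + k)) ->
  let mm' := iter k (den w (LSeq (rmove j Minus) (tshift j Minus))) mm in
  [/\ good mm' (upd x j a), mf mm' = mf mm & mt mm' = mt mm].
Proof.
elim: k mm => [|k IH] mm gx; first by rewrite addn0 in gx.
rewrite [iter _ _ _]iterSr.
have [|g1 f1 t1] := den_step_down (j := j) gx; first by rewrite upd_at addnS.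
rewrite upd_at upd_upd addnS /= in g1.
by have [g2 f2 t2] := IH _ g1; split; rewrite ?f2 ?t2.
Qed.

Definition sweep_body b j js : prg :=
  LSeq (sweep js b) (LSeq (rmove j Plus) (tshift j Plus)).

Definition zero_on (js : seq 'I_m) x := forall j, j \in js -> x j = 0.

(** The precondition [ok] is there for [sweep], whose own registers have to start from 0. *)
Definition keeps (J : bool -> table -> Prop) (ok : {ffun 'I_m -> nat} -> Prop)
    (p : prg) :=
  forall x mm, ok x -> below x -> good mm x -> J (mf mm) (mt mm) ->
    good (den w p mm) x /\ J (mf (den w p mm)) (mt (den w p mm)).

Lemma below_upd x j v : below x -> v < B -> below (upd x j v).
Proof. by move=> ltx ltv k; rewrite ffunE; case: eqP. Qed.

Lemma zero_on_upd js x j v : j \notin js -> zero_on js x -> zero_on js (upd x j v).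
Proof.
by move=> jjs z k kjs; rewrite ffunE; case: eqP => [kj|_]; [rewrite -kj kjs in jjs | exact: z].
Qed.

Lemma sweep_body_iter J b j js x a k mm : keeps J (zero_on js) (sweep js b) ->
  j \notin js -> zero_on js x -> below x -> a + k <= B ->
  good mm (upd x j a) -> J (mf mm) (mt mm) ->
  let mm' := iter k (den w (sweep_body b j js)) mm in
  good mm' (upd x j (a + k)) /\ J (mf mm') (mt mm').
Proof.
move=> Hjs jjs zx ltx; elim: k => [|k IH] leB gx Jm; first by rewrite addn0.
have [|g1 J1] := IH _ gx Jm; first lia.
have [||g2 J2] := Hjs _ _ _ _ g1 J1.
- exact: zero_on_upd.
- by apply: below_upd => //; lia.
have [] := den_step_up j g2; rewrite upd_at upd_upd addnS.
rewrite -[den w _ _]/(den w (sweep_body b j js) (iter k (den w (sweep_body b j js)) mm)) -iterS.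
by move=> g3 f3 t3; cbv zeta; rewrite f3 t3.
Qed.

Lemma den_sweep_cons b j js mm :
  den w (sweep (j :: js) b) mm =
  iter B (den w (LSeq (rmove j Minus) (tshift j Minus)))
    (iter B (den w (sweep_body b j js)) mm).
Proof.
by rewrite -!den_loopN.
Qed.

Lemma sweep_keeps J b js : uniq js -> keeps J (fun _ => True) b ->
  keeps J (zero_on js) (sweep js b).
Proof.
move=> + Hb; elim: js => [_|j js IH /= /andP[jjs ujs]] x mm zx ltx gx Jm.
  exact: Hb.
have zj : x j = 0 by apply: zx; rewrite mem_head.
have gx0 : good mm (upd x j 0) by rewrite -zj upd_id.
have [||g1 J1] := sweep_body_iter (k := B) (IH ujs) jjs _ ltx _ gx0 Jm.
- by move=> k kjs; apply: zx; rewrite in_cons kjs orbT.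
- by rewrite add0n.
rewrite -/(sweep (j :: js) b) den_sweep_cons.
have [g2 -> ->] := den_steps_down g1; split=> //.
by rewrite -zj upd_id in g2.
Qed.

(** The loop on each register is cut at pass [y j]. Before it only [J] is maintained, the pass
    itself establishes [P] by induction on the remaining registers, and the later passes preserve
    [P] along with [J]. *)
Lemma sweep_visits J P b y js : uniq js -> keeps J (fun _ => True) b ->
  keeps (fun f T => J f T /\ P f T) (fun _ => True) b -> below y ->
  (forall mm, good mm y -> J (mf mm) (mt mm) ->
     P (mf (den w b mm)) (mt (den w b mm))) ->
  forall x mm, zero_on js x -> (forall j, j \notin js -> x j = y j) -> below x ->
  good mm x -> J (mf mm) (mt mm) ->
  P (mf (den w (sweep js b) mm)) (mt (den w (sweep js b) mm)).
Proof.
move=> + HJ HJP lty Hy; elim: js => [_|j js IH /= /andP[jjs ujs]] x mm zx xy ltx gx Jm.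
  by apply: Hy => //; rewrite (_ : y = x) //; apply/ffunP => j; rewrite xy.
have zj : x j = 0 by apply: zx; rewrite mem_head.
have zjs : zero_on js x by move=> k kjs; apply: zx; rewrite in_cons kjs orbT.
have gx0 : good mm (upd x j 0) by rewrite -zj upd_id.
rewrite -/(sweep (j :: js) b) den_sweep_cons.
have ltyj := lty j.
have EB : B = (B - (y j).+1) + (1 + y j) by lia.
rewrite {2 4}EB !iterD.
have [|g1 J1] := sweep_body_iter (a := 0) (k := y j)
  (sweep_keeps ujs HJ) jjs zjs ltx _ gx0 Jm; first lia.
rewrite add0n in g1.
set mm1 := iter (y j) _ _ in g1 J1 *.
have z1 := zero_on_upd (y j) jjs zjs.
have l1 := below_upd j ltx ltyj.
have [g2 J2] := sweep_keeps ujs HJ z1 l1 g1 J1.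
have P2 : P (mf (den w (sweep js b) mm1)) (mt (den w (sweep js b) mm1)).
  apply: (IH ujs _ _ z1 _ l1 g1 J1) => k kjs; rewrite ffunE.
  by case: eqP => [->//|/eqP kj]; apply: xy; rewrite in_cons negb_or kj.
have [g3 f3 t3] := den_step_up j g2; rewrite upd_at upd_upd in g3.
rewrite [iter 1 _ _]/(den w (sweep_body b j js) mm1).
rewrite -/(sweep_body b j js) -[den w (LSeq _ _) _]/(den w (sweep_body b j js) mm1) in g3 f3 t3.
have JP3 : J (mf (den w (sweep_body b j js) mm1)) (mt (den w (sweep_body b j js) mm1))
  /\ P (mf (den w (sweep_body b j js) mm1)) (mt (den w (sweep_body b j js) mm1)).
  by rewrite f3 t3.
have [|g4 [J4 P4]] := sweep_body_iter (J := fun f T => J f T /\ P f T)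
  (k := B - (y j).+1) (sweep_keeps ujs HJP) jjs zjs ltx _ g3 JP3.
  by lia.
rewrite (_ : (y j).+1 + (B - (y j).+1) = 0 + B) in g4; last by lia.
by have [_ -> ->] := den_steps_down g4.
Qed.

(** * Repeated sweeps follow paths of configurations *)

Notation round := (den w (sweep (enum 'I_m) explore)).

Lemma explore_keeps (T0 : table) (f0 : bool) :
  keeps (fun f T => sound f T /\ sub_table T0 T /\ (f0 -> f)) (fun _ => True) explore.
Proof.
move=> x mm _ ltx gx [snd [sub fl]].
have [g1 snd1 fl1 sub1] := explore_sound ltx gx snd; split=> //; split=> //.
split=> [i|/fl/fl1//]; exact: subset_trans (sub i) (sub1 i).
Qed.

Lemma B_gt0 : 0 < B. Proof. by rewrite expn_gt0. Qed.

Lemma below0 : below [ffun=> 0].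
Proof. by move=> j; rewrite ffunE B_gt0. Qed.

Lemma zero_on0 js : zero_on js [ffun=> 0].
Proof. by move=> j _; rewrite ffunE. Qed.

Lemma round_sound mm : good mm [ffun=> 0] -> sound (mf mm) (mt mm) ->
  [/\ good (round mm) [ffun=> 0], sound (mf (round mm)) (mt (round mm)),
      sub_table (mt mm) (mt (round mm)) & (mf mm -> mf (round mm))].
Proof.
move=> g0 snd; 
pose J := fun f T => sound f T /\ sub_table (mt mm) T /\ (mf mm -> f).
have J0 : J (mf mm) (mt mm) by split=> //; split=> // i.
have [] := @sweep_keeps J explore (enum 'I_m) (enum_uniq _)
  (@explore_keeps (mt mm) (mf mm)) _ _ (@zero_on0 _) below0 g0 J0.
by move=> ? [? [? ?]]; split.
Qed.

Lemma round_step mm q q' mv x : good mm [ffun=> 0] -> sound (mf mm) (mt mm) ->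
  below x -> q \in states_at (mt mm) (idx x) ->
  (q', mv) \in aut_trans q (rover_obs w x) ->
  q' \in states_at (mt (round mm)) (idx [ffun j => shift (mv j) (x j)]).
Proof.
move=> g0 snd ltx qT tr.
pose J := fun f T => sound f T /\ sub_table (mt mm) T /\ (mf mm -> f).
pose P := fun (_ : bool) T => q' \in states_at T (idx [ffun j => shift (mv j) (x j)]).
apply: (@sweep_visits J P explore x (enum 'I_m) (enum_uniq _) _ _ ltx _ [ffun=> 0]) => //.
- exact: explore_keeps.
- move=> y m1 _ lty gy [Jm Pm].
  have [? ?] := explore_keeps I lty gy Jm; split=> //; split=> //.
  have [_ _ _ sub] := explore_sound lty gy Jm.1.
  exact: (subsetP (sub _)).
- move=> m1 gm [snd1 [sub1 _]]; apply: (explore_complete ltx gm snd1 _ tr).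
  exact: (subsetP (sub1 _)).
- exact: zero_on0.
- by move=> j; rewrite mem_enum.
- exact: below0.
- by split=> //; split=> // i.
Qed.

Lemma round_acc mm q x : good mm [ffun=> 0] -> sound (mf mm) (mt mm) ->
  below x -> q \in states_at (mt mm) (idx x) -> aut_acc q -> mf (round mm).
Proof.
move=> g0 snd ltx qT qacc.
pose J := fun f T => sound f T /\ sub_table (mt mm) T /\ (mf mm -> f).
pose P := fun (f : bool) (_ : table) => is_true f.
apply: (@sweep_visits J P explore x (enum 'I_m) (enum_uniq _) _ _ ltx _ [ffun=> 0]) => //.
- exact: explore_keeps.
- move=> y m1 _ lty gy [Jm Pm].
  have [? ?] := explore_keeps I lty gy Jm; split=> //; split=> //.
  by have [_ _ fl _] := explore_sound lty gy Jm.1; exact: fl.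
- move=> m1 gm [snd1 [sub1 _]]; apply: (explore_acc ltx gm snd1 _ qacc).
  exact: (subsetP (sub1 _)).
- exact: zero_on0.
- by move=> j; rewrite mem_enum.
- exact: below0.
- by split=> //; split=> // i.
Qed.

Definition ready mm := good mm [ffun=> 0] /\ sound (mf mm) (mt mm).

Lemma rounds_ready k mm : ready mm -> ready (iter k round mm).
Proof.
by move=> rm; elim: k => //= k [g0 snd]; have [] := round_sound g0 snd; split.
Qed.

Lemma rounds_flag k mm : ready mm -> mf mm -> mf (iter k round mm).
Proof.
move=> rm fm; elim: k => //= k IH; have [g0 snd] := rounds_ready k rm.
by have [_ _ _] := round_sound g0 snd; apply.
Qed.

Notation cfg := (Q * {ffun 'I_m -> 'I_B})%type.

Definition cfg_regs (c : cfg) : {ffun 'I_m -> nat} := [ffun j => c.2 j : nat].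

Lemma below_cfg c : below (cfg_regs c).
Proof. by move=> j; rewrite ffunE. Qed.

Definition cfg_step : rel cfg := fun c c' =>
  [exists mv, ((c'.1, mv) \in aut_trans c.1 (rover_obs w (cfg_regs c)))
    && (cfg_regs c' == [ffun j => shift (mv j) (cfg_regs c j)])].

Definition in_table (mm : memory) (c : cfg) := c.1 \in states_at (mt mm) (idx (cfg_regs c)).

Lemma path_rounds p c mm : ready mm -> in_table mm c -> path cfg_step c p ->
  in_table (iter (size p) round mm) (last c p).
Proof.
elim: p c mm => //= c' p IH c mm rm cT /andP[/existsP[mv /andP[tr /eqP cE]] cp].
have [g0 snd] := rm; rewrite -iterS iterSr; apply: IH cp.
  exact: (@rounds_ready 1).
by rewrite /in_table cE; apply: round_step g0 snd (below_cfg _) cT tr.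
Qed.

Definition cfg0 : cfg := (aut_init M, [ffun=> Ordinal B_gt0]).

Lemma cfg_regs0 : cfg_regs cfg0 = [ffun=> 0].
Proof. by apply/ffunP => j; rewrite !ffunE. Qed.

Lemma reach_connect s :
  star (aut_step (rover_obs w) (rover_app B) (M := M)) (aut_init M, [ffun=> 0]) s ->
  exists2 c : cfg, connect cfg_step cfg0 c & s = (c.1, cfg_regs c).
Proof.
elim=> [|[q x] [q' x'] [mv /= tr [-> Hb]] _ [c c0 [qE xE]]].
  by exists cfg0 => //; rewrite cfg_regs0.
pose c' : cfg := (q', [ffun j => insubd (c.2 j) (shift (mv j) (x j))]).
have c'E : cfg_regs c' = [ffun j => shift (mv j) (x j)].
  apply/ffunP => j; rewrite !ffunE val_insubd ifT //.
  have : x j < B by rewrite xE ffunE.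
  by have := Hb j; case: (mv j) => //= [_|/(_ erefl)//]; lia.
exists c'; last by rewrite c'E.
apply: connect_trans c0 (connect1 _); apply/existsP; exists mv.
by rewrite -qE -xE tr c'E eqxx.
Qed.

Definition mm0 : memory := den w (add_state (aut_init M)) (init_store m {set Q} false).

Lemma idx0 : idx [ffun=> 0] = 0.
Proof. by rewrite /idx big1 // => j _; rewrite ffunE. Qed.

Lemma ready0 : ready mm0 /\ in_table mm0 cfg0.
Proof.
rewrite /mm0 den_add_state /=; split; last first.
  by rewrite /in_table cfg_regs0 idx0 states_add_at eqxx setU11.
split; first by split=> //=; rewrite idx0.
split=> // i q; rewrite states_add_at /states_at /=.
case: eqP => [->|_]; rewrite ?inE // orbF => /eqP ->.
exists [ffun=> 0]; split; [by rewrite idx0| |exact: rtn1_refl].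
by move=> j; rewrite ffunE expn_gt0.
Qed.

Lemma card_cfg : #|{: cfg}| < n2 ^ (#|Q| + K * m).+1.
Proof.
rewrite card_prod card_ffun !card_ord -expnM expnS expnD.
have : #|Q| <= n2 ^ #|Q| by apply: ltnW; apply: ltn_expl.
have : 0 < n2 ^ (K * m) by rewrite expn_gt0.
have : 0 < n2 ^ #|Q| by rewrite expn_gt0.
nia.
Qed.

(** Acceptance is caught between the bounds [B] and [B.+1], since exploration starts below [B] but
    may step onto it; [rover_class] tolerates the gap. *)
Lemma rover_progP :
  (rover_accepts M B w -> mf (den w rover_prog (init_store m {set Q} false))) /\
  (mf (den w rover_prog (init_store m {set Q} false)) -> rover_accepts M B.+1 w).
Proof.
rewrite -[den _ _ _]/(den w (loopN (#|Q| + K * m).+1 (sweep (enum 'I_m) explore)) mm0).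
rewrite den_loopN; have [r0 c0] := ready0; split; last first.
  by have [_ [H _]] := rounds_ready (n2 ^ (#|Q| + K * m).+1) r0.
move=> [s /reach_connect[c /connectP[p0 p0P cE] ->] /= cacc].
case/shortenP: p0P cE => p pP up _ cE.
(* One sweep for each edge of a path without repetition, and one more to notice the accepting
   state. *)
have ltp : (size p).+1 <= n2 ^ (#|Q| + K * m).+1.
  apply: leq_trans (ltnW card_cfg); rewrite -[(size p).+1]/(size (cfg0 :: p)).
  by rewrite -(card_uniqP up) max_card.
rewrite -(subnK ltp) iterD; apply: rounds_flag; first exact: rounds_ready.
have [g1 snd1] := rounds_ready (size p) r0.
have := path_rounds r0 c0 pP; rewrite -cE => cT.
exact: round_acc g1 snd1 (below_cfg c) cT cacc.
Qed.

End RoverPTIME.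

Theorem rover_PTIME (Sigma : finType) (L : language Sigma) :
  rover_class L -> PTIME L.
Proof.
move=> [m [M [K HM]]]; apply: (@loop_PTIME _ m _ _ (rover_prog M K) false id) => w.
have [H1 H2] := rover_progP M K w; have [HL1 HL2] := HM w.
by split=> [/HL2/H1|/H2/HL1].
Qed.

(** * Automata with one marked cell *)

Section Lipschitz.
Variable c : nat -> nat.
Hypothesis c_down : forall k, c k <= (c k.+1).+1.

(** Only descents have to go by single units; upward jumps cannot skip a value that is finally
    passed downwards. *)
Lemma crossing_down a b v : a <= b -> c b <= v <= c a ->
  exists2 k, a <= k <= b & c k = v.
Proof.
move=> leab; have -> : b = (b - a) + a by lia.
elim: (b - a) => [|n IH] /andP[le1 le2].
  by rewrite add0n in le1 *; exists a; lia.
have [Hv|Hv] := leqP (c (n + a)) v.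
  by have [|k kle kv] := IH; [lia | exists k => //; lia].
by exists (n.+1 + a); have := c_down (n + a); rewrite ?addSn in le1 *; lia.
Qed.

(** Each next time is a crossing of the value just below the current one. These times are the
    pigeons of [repeated_state]. *)
Lemma descending_times n a b : a <= b -> c b + n <= c a ->
  exists s : seq nat, [/\ size s = n.+1,
    pairwise (fun i j => (i < j) && (c j < c i)) s &
    all (fun k => (a <= k <= b) && (c k <= c a)) s].
Proof.
elim: n a => [|n IH] a leab lec.
  by exists [:: a]; split; rewrite //= !leqnn leab.
have [|k kle kv] := @crossing_down a b (c a).-1 leab; first lia.
have [||s [ss ps als]] := IH k; [lia..|].
exists (a :: s); split; first by rewrite /= ss.
  rewrite /= ps andbT; apply: sub_all als => j /= /andP[/andP[? ?] ?].
  have : a <> k by move=> E; rewrite -E in kv; lia.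
  lia.
rewrite /= !leqnn leab /=; apply: sub_all als => j /=; lia.
Qed.

End Lipschitz.

(** * Minimal runs and pumping around the marked cell *)

Section Pumping.
Variables (U : finType) (zero_step mark_step : U -> U * dir).
Variables (u0 : U) (acc : pred U).

Definition cell_step (p : nat) (s : U * nat) : U * nat :=
  let: (u, d) := (if s.2 == p then mark_step else zero_step) s.1 in
  (u, shift d s.2).

Notation trace p k := (iter k (cell_step p) (u0, 0)).
Notation K := #|U|.

Lemma shift_lipschitz d n : (shift d n <= n.+1) /\ (n <= (shift d n).+1).
Proof. by case: d => /=; lia. Qed.

Lemma trace_lipschitz p k :
  (trace p k.+1).2 <= (trace p k).2.+1 /\ (trace p k).2 <= (trace p k.+1).2.+1.
Proof.
rewrite iterS /cell_step; case: (trace p k) => u c /=.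
by case: ifP => _; case: (_ u) => v d; exact: shift_lipschitz.
Qed.

(** Only the order of the two cells is compared, not their distance, because the loop at cell 0 may
    shrink the distance. *)
Lemma zero_step_mono p u c c' : c <= c' -> c != p -> c' != p ->
  (cell_step p (u, c)).1 = (cell_step p (u, c')).1 /\
  (cell_step p (u, c)).2 <= (cell_step p (u, c')).2.
Proof.
move=> lec /negPf cp /negPf cp'; rewrite /cell_step /= cp cp'.
by case: (zero_step u) => v [] /=; split=> //; lia.
Qed.

Section MinimalRun.
Variables (p t : nat).
Hypothesis acc_t : acc (trace p t).1.
Hypothesis t_min : forall k, acc (trace p k).1 -> t <= k.
Notation uu k := (trace p k).1.
Notation cc k := (trace p k).2.

Lemma minimal_no_repeat i j : i < j -> j <= t ->
  (forall k, uu (j + k) = uu (i + k)) -> False.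
Proof.
move=> ltij lejt H; have := H (t - j); rewrite subnKC // => E.
by have := @t_min (i + (t - j)); rewrite -E => /(_ acc_t); lia.
Qed.

Definition beyond (right : bool) (k k' : nat) : bool := if right then k' < k else k < k'.

Definition farther (right : bool) (k k' : nat) : bool := if right then k <= k' else k' <= k.

(* While the marked cell is not met, a repeated state reached at a cell not
   nearer to it makes the run periodic and drifting away from it. *)
Lemma no_drift right i j : i < j -> j <= t -> uu i = uu j ->
  (forall k, i <= k <= j -> beyond right (cc k) p) -> ~~ farther right (cc i) (cc j).
Proof.
move=> ltij lejt uE ltp; apply/negP => lec.
suff H k : beyond right (cc (i + k)) p /\
    (uu (j + k) = uu (i + k) /\ farther right (cc (i + k)) (cc (j + k))).
  by apply: (@minimal_no_repeat i j) => // k; have [_ []] := H k.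
elim/ltn_ind: k => k IH.
have P : beyond right (cc (i + k)) p.
  (* During the first period by hypothesis; afterwards time [i + k] is one period after
     [i + (k - (j - i))], where the cell was beyond [p] and from where it has come no nearer. *)
  have [le_k|lt_k] := leqP k (j - i); first by apply: ltp; lia.
  have [|H1 [_ H2]] := IH (k - (j - i)); first lia.
  rewrite (_ : j + (k - (j - i)) = i + k) in H2; last by lia.
  by move: H1 H2; rewrite /beyond /farther; case: (right); lia.
split=> //; case: k IH P => [|k] IH P; first by rewrite !addn0.
have [//|H1 [H2 H3]] := IH k; rewrite !addnS !iterS.
case E1: (trace p (j + k)) H2 H3 => [u1 c1] /= -> H3.
case E2: (trace p (i + k)) H1 H3 => [u2 c2] /= H1 H3.
rewrite /farther /beyond in H1 H3 *; case: (right) H1 H3 => H1 H3.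
  by have [|||E L] := @zero_step_mono p u2 c2 c1; [lia..|split].
by apply: zero_step_mono => //; lia.
Qed.

Lemma repeated_state (R : rel nat) (s : seq nat) :
  size s = K.+1 -> pairwise R s ->
  exists i j, [/\ i \in s, j \in s, R i j & uu i = uu j].
Proof.
move=> sz pw; have : ~~ uniq [seq uu k | k <- s].
  apply/negP => /card_uniqP E; have := max_card (mem [seq uu k | k <- s]).
  by rewrite E size_map sz ltnn.
move=> /(uniqPn u0)[i [j [ltij]]]; rewrite size_map => ltj E.
have lti := ltn_trans ltij ltj.
exists (nth 0 s i), (nth 0 s j); rewrite !mem_nth //; split=> //.
  by move/(pairwiseP 0): pw; apply.
by move: E; rewrite !(nth_map 0).
Qed.

(** A larger drift would contain [K.+1] times at which the distance to [p] grows strictly, two of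
    them with the same state, against [no_drift]. *)
Lemma bounded_drift right a b : a <= b -> b <= t ->
  (forall k, a <= k <= b -> beyond right (cc k) p) ->
  if right then cc b <= cc a + K else cc a <= cc b + K.
Proof.
move=> leab lebt ltp; apply: contraT => Hc.
(* On the right of [p], reflecting the cells at their maximum turns a climb into a descent. *)
pose M := \max_(k < b.+1) cc k; pose c' k := if right then M - cc k else cc k.
have leM k : k <= b -> cc k <= M.
  by move=> lek; rewrite -[k]/(nat_of_ord (Ordinal (lek : k < b.+1))) leq_bigmax.
have [||s [sz pw als]] := @descending_times c' _ K a b leab _.
- by move=> k; have := trace_lipschitz p k; rewrite /c'; case: (right); lia.
- have := leM a leab; have := leM b (leqnn _); move: Hc; rewrite /c'; case: (right); lia.
have [i [j [si sj /andP[ltij ltc] uE]]] := repeated_state sz pw.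
have /andP[ai _] := allP als i si; have /andP[bj _] := allP als j sj.
have lejt : j <= t by lia.
have H k : i <= k <= j -> beyond right (cc k) p by move=> ?; apply: ltp; lia.
move: (no_drift ltij lejt uE H) ltc (leM i) (leM j).
by rewrite /farther /c'; case: (right); lia.
Qed.

Lemma last_visit a b : a <= b ->
  (forall k, a <= k <= b -> cc k <> p) \/
  exists v, [/\ a <= v <= b, cc v = p & forall k, v < k <= b -> cc k <> p].
Proof.
move=> leab; have -> : b = (b - a) + a by lia.
elim: (b - a) => [|n IH].
  have [E|/eqP E] := eqVneq (cc a) p; last by left=> k ?; have -> : k = a by lia.
  by right; exists a; split=> //; lia.
have [E|/eqP E] := eqVneq (cc (n.+1 + a)) p.
  by right; exists (n.+1 + a); split=> // [|k]; lia.
case: IH => [H|[v [Hv vp H]]]; [left=> k Hk|right; exists v; split=> // [|k Hk]].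
- by have [kn|kn] := leqP k (n + a); [apply: H; lia | have -> : k = n.+1 + a by lia].
- lia.
- by have [kn|kn] := leqP k (n + a); [apply: H; lia | have -> : k = n.+1 + a by lia].
Qed.

Lemma stays_beyond right a b : (forall k, a <= k <= b -> cc k <> p) ->
  beyond right (cc a) p -> forall k, a <= k <= b -> beyond right (cc k) p.
Proof.
move=> H ltp k /andP[ak kb]; have := kb; have -> : k = (k - a) + a by lia.
elim: (k - a) => // n IH leb; have := trace_lipschitz p (n + a).
have := H (n.+1 + a); have := IH _; rewrite addSn /beyond; case: (right); lia.
Qed.

(** If the run ends to the left of [p], it is followed from [a] or from the last visit to [p]: it
    then drifts by at most [K], plus the one step that leaves [p]. *)
Lemma run_lower_bound a b : a <= b -> b <= t -> cc a <= p -> cc a <= cc b + K.+1.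
Proof.
move=> leab lebt lep; have [H|[v [vle vp H]]] := last_visit leab.
  have Ha : cc a < p by have := H a; lia.
  by have := bounded_drift leab lebt (stays_beyond (right := false) H Ha); lia.
have [vb|vb] := eqVneq v b; first by rewrite -vb; lia.
have [Hb|Hb] := leqP p (cc b); first lia.
have L := trace_lipschitz p v.
have H' k : v.+1 <= k <= b -> cc k <> p by move=> ?; apply: H; lia.
have [Hv|Hv] := leqP p (cc v.+1).
  have Hv' : p < cc v.+1 by have := H v.+1; lia.
  by have := stays_beyond (right := true) H' Hv' (k := b); rewrite /beyond; lia.
have ltvb : v.+1 <= b by lia.
by have := bounded_drift ltvb lebt (stays_beyond (right := false) H' Hv); lia.
Qed.

Lemma run_upper_bound b : b <= t -> cc b <= p + K.+1.
Proof.
move=> lebt; have [H|[v [vle vp H]]] := last_visit (leq0n b).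
  have : cc b < p; last lia.
  by apply: (stays_beyond (right := false) H) => //; have := H 0; rewrite /beyond /=; lia.
have [vb|vb] := eqVneq v b; first by rewrite -vb; lia.
have [Hb|Hb] := leqP (cc b) p; first lia.
have L := trace_lipschitz p v.
have H' k : v.+1 <= k <= b -> cc k <> p by move=> ?; apply: H; lia.
have [Hv|Hv] := leqP (cc v.+1) p.
  have Hv' : cc v.+1 < p by have := H v.+1; lia.
  by have := stays_beyond (right := false) H' Hv' (k := b); rewrite /beyond; lia.
have ltvb : v.+1 <= b by lia.
by have := bounded_drift ltvb lebt (stays_beyond (right := true) H' Hv); lia.
Qed.

End MinimalRun.

(** Climbing from height [K + 2] to [2 * K + 2], the run repeats a state at a greater height.
    Cutting out that piece lowers the rest of the run and the mark by the gain [d <= K]. A minimal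
    run never falls more than [K.+1] below the cut, so a cut at height at least [K + 2] keeps the
    lowered run off cell 0; and [3 * K + 6 < p] keeps the lowered mark above all cells met before
    the cut. *)
Lemma pump_down p t : acc (trace p t).1 -> 3 * K + 6 < p ->
  exists p' t', p' < p /\ acc (trace p' t').1.
Proof.
move=> acct ltp.
have /ex_minnP[t0 acc0 min0] : exists k, acc (trace p k).1 by exists t.
have same q k : (forall i, i < k -> (trace p i).2 <> p /\ (trace p i).2 <> q) ->
    trace q k = trace p k.
  elim: k => //= k IH H; rewrite IH => [|i lti]; last by apply: H; lia.
  have [/eqP/negPf Hp /eqP/negPf Hq] := H k (ltnSn k).
  by rewrite /cell_step Hp Hq.
have c0 : (trace p 0).2 = 0 by [].
pose reach k := (k <= t0) && (2 * K + 2 <= (trace p k).2).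
have [/existsP[[k0 lek0] /= Hk0]|none] :=
    boolP [exists k : 'I_t0.+1, reach k]; last first.
  have low k : k <= t0 -> (trace p k).2 < 2 * K + 2.
    move=> lek; rewrite ltnNge; apply/negP => Hk; case/existsP: none.
    by exists (Ordinal (lek : k < t0.+1)); rewrite /reach /= lek.
  (* The run stays so low that it meets neither the old mark nor the new one. *)
  exists (2 * K + 3), t0; split; first lia.
  by rewrite same // => k lek; have := low k; lia.
have /ex_minnP[b /andP[bt cb] minb] : exists k, reach k by exists k0.
have low k : k < b -> (trace p k).2 < 2 * K + 2.
  move=> lek; rewrite ltnNge; apply/negP => Hk.
  by have := minb k; rewrite /reach; lia.
have cbE : (trace p b).2 = 2 * K + 2.
  case: (b) cb low => [|b'] cb low; first by rewrite c0 in cb; lia.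
  have := low b' (ltnSn _); have := trace_lipschitz p b'; lia.
have lowb k : k <= b -> (trace p k).2 <= 2 * K + 2.
  by have [->|ne] := eqVneq k b; [rewrite cbE | move=> ?; apply/ltnW/low; lia].
pose M k := 2 * K + 2 - (trace p k).2.
have Mdown k : M k <= (M k.+1).+1 by have := trace_lipschitz p k; rewrite /M; lia.
have [||a aleb Ma] := @crossing_down M Mdown 0 b K; [lia|rewrite /M cbE c0; lia|].
have [||s [sz pw als]] := @descending_times M Mdown K a b; [lia|rewrite Ma /M cbE; lia|].
have [i [j [si sj /andP[ltij ltM] uE]]] := repeated_state p sz pw.
have /andP[ai Mi] := allP als i si; have /andP[aj Mj] := allP als j sj.
have {ltM} ltc : (trace p i).2 < (trace p j).2 by rewrite /M in ltM; lia.
have ci : K + 2 <= (trace p i).2 by rewrite Ma /M in Mi; lia.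
have cj := lowb j; pose d := (trace p j).2 - (trace p i).2.
have lejt : j <= t0 by lia.
exists (p - d), (i + (t0 - j)); split; first by rewrite /d; lia.
suff H k : k <= t0 - j ->
    trace (p - d) (i + k) = ((trace p (j + k)).1, (trace p (j + k)).2 - d).
  by rewrite H //= subnKC.
elim: k => [|k IH] lek.
  rewrite !addn0 same => [|k ltk]; last by have := lowb k; rewrite /d; lia.
  by rewrite -uE [LHS]surjective_pairing /d; congr pair; lia.
rewrite !addnS !iterS IH; last lia.
(* Strictly above [d]: in the lowered run a move to the left must not be absorbed by the loop at
   cell 0. *)
have Hlow : d < (trace p (j + k)).2.
  have lejk : j + k <= t0 by lia.
  have lecj : (trace p j).2 <= p by lia.
  by have := run_lower_bound acc0 min0 (leq_addr k j) lejk lecj; rewrite /d; lia.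
case: (trace p (j + k)) Hlow => u c /= Hlow.
rewrite /cell_step /= (_ : (c - d == p - d) = (c == p)); last by rewrite /d in Hlow *; lia.
by case: (_ u) => v [] /=; congr pair; lia.
Qed.

Lemma bounded_run : (exists p t, acc (trace p t).1) ->
  exists p t, [/\ acc (trace p t).1, p <= 3 * K + 6 &
                  forall k, k <= t -> (trace p k).2 <= 4 * K + 7].
Proof.
move=> [p [t acct]]; elim/ltn_ind: p t acct => p IH t acct.
have [lep|ltp] := leqP p (3 * K + 6); last first.
  by have [p' [t' [/IH H /H]]] := pump_down acct ltp.
have /ex_minnP[t0 acc0 min0] : exists k, acc (trace p k).1 by exists t.
exists p, t0; split=> // k lek; have := run_upper_bound acc0 min0 lek; lia.
Qed.

End Pumping.

Section Pack.
Variable h : nat.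

Definition pack (T : Type) (g : 'I_h -> T) (a b : T) : {ffun 'I_(h + 2) -> T} :=
  [ffun j => match split j with inl i => g i | inr k => if k == ord0 then a else b end].

Definition head_reg (i : 'I_h) : 'I_(h + 2) := lshift 2 i.
Definition cell_reg : 'I_(h + 2) := rshift h (ord0 : 'I_2).
Definition dist_reg : 'I_(h + 2) := rshift h (ord_max : 'I_2).

Lemma pack_head T g (a b : T) i : pack g a b (head_reg i) = g i.
Proof. by rewrite ffunE (unsplitK (inl i)). Qed.

Lemma pack_cell T g (a b : T) : pack g a b cell_reg = a.
Proof. by rewrite ffunE (unsplitK (inr _)). Qed.

Lemma pack_dist T g (a b : T) : pack g a b dist_reg = b.
Proof. by rewrite ffunE (unsplitK (inr _)). Qed.

Lemma pack_forall (P : 'I_(h + 2) -> Prop) :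
  (forall i, P (head_reg i)) -> P cell_reg -> P dist_reg -> forall j, P j.
Proof.
move=> Hh Hc Hd j; rewrite -(splitK j); case: (split j) => [i|k] /=; first exact: Hh.
case: k => [[|[|//]] ltk]; [move: Hc | move: Hd]; congr (P (rshift _ _)); exact: val_inj.
Qed.

Lemma eq_pack T (x : {ffun 'I_(h + 2) -> T}) g a b :
  (forall i, x (head_reg i) = g i) -> x cell_reg = a -> x dist_reg = b ->
  x = pack g a b.
Proof.
move=> Hh Hc Hd; apply/ffunP; apply: pack_forall => [i||].
- by rewrite pack_head.
- by rewrite pack_cell.
- by rewrite pack_dist.
Qed.

End Pack.

(** * The rover that follows a run with one marked cell *)

Section HeadsToRover.
Variables (Sigma : finType) (h : nat) (A : head_automaton Sigma h).
Notation F := (ha_state A * ha_mem A * bool)%type.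
Notation obs := {ffun 'I_(h + 2) -> marked Sigma}.
Notation cmd := {ffun 'I_(h + 2) -> dir}.
Notation dist_reg := (dist_reg h).
Notation cell_reg := (cell_reg h).

(* In a state [(q, s, right)] the marked cell holds [s], the register
   [dist_reg] is its distance from the current cell, and [right] tells on which
   side of it the current cell is. *)
Definition sim_sym (f : F) (o : obs) : ha_mem A :=
  if o dist_reg == lmark then f.1.2 else ha_zero A.

Definition sim_trans (f : F) (o : obs) :=
  ha_trans f.1.1 [ffun i => o (head_reg i)] (sim_sym f o).

(** The loop at cell 0 is resolved beforehand; otherwise the distance to the mark would change with
    a move that leaves the cell unchanged. *)
Definition sim_cell_dir (f : F) (o : obs) : dir :=
  let d := (sim_trans f o).2 in
  if (d == Minus) && (o cell_reg == lmark) then Stay else d.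

(** The side is meaningful only at a positive distance, so it is set anew at each step taken from
    the marked cell. *)
Definition sim_state (f : F) (o : obs) : F :=
  ((sim_trans f o).1.1, f.1.2,
   if o dist_reg == lmark then sim_cell_dir f o == Plus else f.2).

Definition sim_cmd (f : F) (o : obs) : cmd :=
  let d := sim_cell_dir f o in
  pack (fun i => let e := (sim_trans f o).1.2 i in
                 if (e == Plus) && (o (head_reg i) == rmark) then Stay else e)
       d (if o dist_reg == lmark then if d == Stay then Stay else Plus
          else if f.2 then d else flip d).

(** The component of [f] that holds the marked symbol is left unconstrained, which is the guess of
    the symbol; the guess of the cell is the number of passes of [incr_dist]. Cell 0 is never to the
    right of the mark, whence [~~ f.2]. *)
Definition guess_sym : prog obs cmd F :=
  Atom (fun _ o f c => [&& f.1.1 == ha_init A, ~~ f.2 & c == rover_idle o]).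

Definition incr_dist : prog obs cmd F :=
  Atom (fun f o f' c => (f' == f) && (c == pack (fun=> Stay) Stay Plus)).

Definition sim_step : prog obs cmd F :=
  Atom (fun f o f' c => (f' == sim_state f o) && (c == sim_cmd f o)).

Definition heads_prog : prog obs cmd F :=
  Seq guess_sym (Seq (Star incr_dist) (Star sim_step)).

Definition heads_rover : rover Sigma (h + 2) :=
  compile (@rover_idle Sigma (h + 2)) (ha_init A, ha_zero A, false)
    (fun f => ha_acc f.1.1) heads_prog.

Variable w : seq Sigma.
Notation n := (size w).

Definition marked_at (p : nat) (s : ha_mem A) : nat -> ha_mem A :=
  fun i => if i == p then s else ha_zero A.

(** A content without a marked cell counts as one whose cell 0 is marked by the distinguished symbol
    itself. *)
Lemma U1_marked_at m : U1 m -> exists p s, m = marked_at p s.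
Proof.
move=> Um; have [[p mp]|none] := classic (exists p, m p <> ha_zero A).
  exists p, (m p); apply: functional_extensionality => i; rewrite /marked_at.
  by case: eqP => [->//|ip]; apply: NNPP => mi; apply: ip; exact: Um.
exists 0, (ha_zero A); apply: functional_extensionality => i.
by rewrite /marked_at if_same; apply: NNPP => mi; apply: none; exists i.
Qed.

Lemma marked_at_U1 p s : U1 (marked_at p s).
Proof. by move=> i j; rewrite /marked_at; do 2 case: eqP => // ->. Qed.

Definition matches (p : nat) (s : ha_mem A) (c : ha_conf A)
    (fx : F * {ffun 'I_(h + 2) -> nat}) : Prop :=
  exists (right : bool) (d : nat),
    [/\ fx = (ha_q c, s, right, pack (ha_heads c) (ha_cell c) d),
        if right then ha_cell c = p + d else ha_cell c + d = p &
        forall i, ha_heads c i <= n.+1].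

Lemma matches_step p s c f x : matches p s c (f, x) ->
  let o := rover_obs w x in
  matches p s (ha_step (marked_at p s) w c)
    (sim_state f o, [ffun j => shift (sim_cmd f o j) (x j)]).
Proof.
move=> [right [d [[-> ->] Hd Hh]]] o {f x}.
have oh i : o (head_reg i) = input_sym w (ha_heads c i) by rewrite ffunE pack_head.
have oc : (o cell_reg == lmark) = (ha_cell c == 0).
  by rewrite ffunE pack_cell input_sym_eq_lmark.
have od : (o dist_reg == lmark) = (d == 0).
  by rewrite ffunE pack_dist input_sym_eq_lmark.
clearbody o.
have at_p : (d == 0) = (ha_cell c == p) by case: right Hd => /=; lia.
set f := (_, _, right).
have trE : sim_trans f o = ha_trans (ha_q c) [ffun i => input_sym w (ha_heads c i)]
    (marked_at p s (ha_cell c)).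
  rewrite /sim_trans /sim_sym od at_p; congr ha_trans.
  by apply/ffunP => i; rewrite ffunE oh ffunE.
rewrite /ha_step /matches -trE.
case E: (sim_trans f o) => [[q mv] e] /=.
exists (if d == 0 then sim_cell_dir f o == Plus else right),
  (shift (sim_cmd f o dist_reg) d); split=> /=.
- rewrite /sim_state E od; congr (_, _); apply: eq_pack => [i||]; rewrite [LHS]ffunE.
  + rewrite [RHS]ffunE pack_head /sim_cmd pack_head E /= oh input_sym_eq_rmark /move_head.
    have := Hh i; case: (mv i) => //= Hi.
    * by apply/esym/minn_idPl; lia.
    * by apply/esym/minn_idPl; lia.
    * by case: ltnP => /= ?; lia.
  + rewrite pack_cell /sim_cmd pack_cell /sim_cell_dir E /= oc.
    by case: e E => //= _; case: eqP => //= ->.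
  + by rewrite pack_dist.
- rewrite /sim_cmd pack_dist od /sim_cell_dir E /= oc.
  move: Hd; case: e {E} => /=; case: (right) => /= Hd; case: (d =P 0) => /= d0;
    case: (ha_cell c =P 0) => /= c0; lia.
- by move=> i; rewrite ffunE /move_head; lia.
Qed.

Lemma pack0 : [ffun=> 0] = pack (fun _ : 'I_h => 0) 0 0.
Proof. by apply: eq_pack => *; rewrite ffunE. Qed.

Notation app B := (@rover_app (h + 2) B).
Notation obs_of := (@rover_obs Sigma (h + 2) w).

Lemma heads_rover_sound B : rover_accepts heads_rover B w -> ha_accepts_U1 A w.
Proof.
move=> /(compile_accepts (@rover_app_idle _ _ w B))[[f x] /=].
move=> [[f1 x1] [c /and3P[/eqP q1 /negPf r1 /eqP ->] /= /rover_app_idle x1E]].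
move=> [[f2 x2] H12 H23] acc.
have [d [f2E x2E]] : exists d, f2 = f1 /\ x2 = pack (fun _ : 'I_h => 0) 0 d.
  apply: (star_inv (I := fun s => exists d, s.1 = f1 /\
    s.2 = pack (fun _ : 'I_h => 0) 0 d)) H12; last by exists 0; rewrite x1E pack0.
  move=> [f' x'] [f3 x3] /= [d [-> ->]] [c' /= /andP[/eqP -> /eqP ->] [-> _]].
  exists d.+1; split=> //; apply: eq_pack => [i||]; rewrite ffunE.
  - by rewrite !pack_head.
  - by rewrite !pack_cell.
  - by rewrite !pack_dist.
rewrite {}f2E {}x2E in H23.
have [t M] : exists t, matches d f1.1.2
    (iter t (ha_step (marked_at d f1.1.2) w) (ha_start A)) (f, x).
  apply: (star_inv (I := fun s => exists t, matches d f1.1.2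
    (iter t (ha_step (marked_at d f1.1.2) w) (ha_start A)) s)) H23.
    move=> [f' x'] [f3 x3] [t Mt] [c' /= /andP[/eqP -> /eqP ->] [-> _]].
    by exists t.+1; exact: matches_step.
  exists 0, false, d; split=> //=; last by move=> i; rewrite ffunE.
  rewrite -q1 -r1 -!surjective_pairing; congr (_, _); apply: eq_pack => [i||].
  - by rewrite pack_head ffunE.
  - by rewrite pack_cell.
  - by rewrite pack_dist.
exists (marked_at d f1.1.2); first exact: marked_at_U1.
by exists t; case: M acc => right [e [[-> _]]].
Qed.

(** For a fixed word the state and the heads together are the finite state of [Pumping]; its
    cardinal is polynomial in the length of the word. *)
Notation U := (ha_state A * {ffun 'I_h -> 'I_n.+2})%type.

Definition ha_surface_step (s : ha_mem A) (u : U) : U * dir :=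
  let: (q, mv, d) := ha_trans u.1 [ffun i => input_sym w (u.2 i)] s in
  ((q, [ffun i => inord (move_head w (mv i) (u.2 i))]), d).

Definition start_surface : U := (ha_init A, [ffun=> ord0]).

Definition conf_of (s : U * nat) : ha_conf A :=
  HaConf s.1.1 [ffun i => s.1.2 i : nat] s.2.

Lemma conf_of_step p s t :
  iter t (ha_step (marked_at p s) w) (ha_start A) =
  conf_of (iter t (cell_step (ha_surface_step (ha_zero A)) (ha_surface_step s) p)
                (start_surface, 0)).
Proof.
elim: t => [|t IH]; first by congr HaConf; apply/ffunP => i; rewrite !ffunE.
rewrite !iterS IH; case: (iter t _ _) => [[q g] c].
rewrite /ha_step /cell_step /conf_of /marked_at /=.
have -> : [ffun i => input_sym w ([ffun i0 => g i0 : nat] i)]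
        = [ffun i => input_sym w (g i)] by apply/ffunP => i; rewrite !ffunE.
rewrite -[in RHS](fun_if ha_surface_step) /ha_surface_step /=.
case: ha_trans => [[q' mv] d] /=; congr HaConf; apply/ffunP => i.
by rewrite !ffunE inordK // /move_head; lia.
Qed.

Lemma heads_rover_complete :
  ha_accepts_U1 A w -> rover_accepts heads_rover (n.+2 ^ (#|ha_state A| + h + 5)) w.
Proof.
set B := n.+2 ^ _; move=> [m /U1_marked_at[p0 [s ->]] [t0 acc0]].
pose run p t := iter t (ha_step (marked_at p s) w) (ha_start A).
have [|p [t [acct lep lec]]] := @bounded_run U (ha_surface_step (ha_zero A))
    (ha_surface_step s) start_surface (fun u => ha_acc u.1).
  by exists p0, t0; move: acc0; rewrite conf_of_step.
set K := #|{: U}| in lep lec.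
have {}acct : ha_acc (ha_q (run p t)) by rewrite /run conf_of_step.
have {}lec k : k <= t -> ha_cell (run p k) <= 4 * K + 7.
  by move=> lek; rewrite /run conf_of_step; exact: lec.
(* Here [K] is [#|ha_state A| * n.+2 ^ h] and [#|ha_state A| < n.+2 ^ #|ha_state A|]; the factor
   [n.+2 ^ 5 >= 32] absorbs the constants. *)
have ltB : 4 * K + 8 < B.
  rewrite /K card_prod card_ffun !card_ord /B !expnD.
  have := ltn_expl #|ha_state A| (isT : 1 < n.+2).
  have : 0 < #|ha_state A| by apply/card_gt0P; exists (ha_init A).
  have : 0 < n.+2 ^ h by rewrite expn_gt0.
  have : 2 ^ 5 <= n.+2 ^ 5 by rewrite leq_exp2r.
  nia.
have nB : n.+1 < B.
  have : n.+2 ^ 1 <= B by rewrite leq_exp2l //; lia.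
  lia.
apply/(compile_accepts (@rover_app_idle _ _ w B)).
pose f1 : F := (ha_init A, s, false).
have matches_lt k fx : k <= t -> matches p s (run p k) fx -> forall j, fx.2 j < B.
  move=> lek [right [d [-> Hd Hh]]]; apply: pack_forall => [i||] /=.
  - by rewrite pack_head; have := Hh i; lia.
  - by rewrite pack_cell; have := lec k lek; lia.
  - by rewrite pack_dist; have := lec k lek; case: right Hd => /=; lia.
have app_lt (mv : cmd) (x : {ffun 'I_(h + 2) -> nat}) :
    (forall j, [ffun j => shift (mv j) (x j)] j < B) ->
    rover_app B mv x [ffun j => shift (mv j) (x j)].
  by move=> H; split=> // j mvj; have := H j; rewrite ffunE mvj.
have [[f x] Sk Mk] : exists2 fx, star (prel (obs_of) (app B) sim_step)
    (f1, pack (fun=> 0) 0 p) fx & matches p s (run p t) fx.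
  elim: t lec {acct} matches_lt => [|k IH] lec matches_lt.
    exists (f1, pack (fun=> 0) 0 p); first exact: rtn1_refl.
    exists false, p; split=> //=; last by move=> i; rewrite ffunE.
    congr (_, _); apply: eq_pack => [i||].
    - by rewrite pack_head ffunE.
    - by rewrite pack_cell.
    - by rewrite pack_dist.
  have [|k' fx lek|[f x] S M] := IH; first by move=> k' lek; apply: lec; lia.
    by apply: matches_lt; lia.
  have M' := matches_step M.
  exists (sim_state f (obs_of x), [ffun j => shift (sim_cmd f (obs_of x) j) (x j)]) => //.
  apply: rtn1_trans S; exists (sim_cmd f (obs_of x)); first by rewrite /= !eqxx.
  by apply: app_lt; exact: (matches_lt k.+1 _ (leqnn _) M').
exists (f, x); last by case: Mk acct => right [d [[-> _]]].
exists (f1, [ffun=> 0]).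
  exists (rover_idle (obs_of [ffun=> 0])); first by rewrite /= !eqxx.
  exact/rover_app_idle.
exists (f1, pack (fun=> 0) 0 p) => //.
have : p < B by lia.
rewrite pack0; elim: (p) => [|k IH] ltk; first exact: rtn1_refl.
apply: rtn1_trans (IH _); last lia.
exists (pack (fun=> Stay) Stay Plus); first by rewrite /= !eqxx.
have E : pack (fun _ : 'I_h => 0) 0 k.+1 = [ffun j => shift
    (pack (fun=> Stay) Stay Plus j) (pack (fun _ : 'I_h => 0) 0 k j)].
  apply/esym; apply: eq_pack => [i||]; rewrite ffunE.
  - by rewrite !pack_head.
  - by rewrite !pack_cell.
  - by rewrite !pack_dist.
rewrite /= E; apply: app_lt; rewrite -E; apply: pack_forall => [i||].
- by rewrite pack_head; lia.
- by rewrite pack_cell; lia.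
- by rewrite pack_dist.
Qed.

End HeadsToRover.

Theorem R_U1_W2_rover (Sigma : finType) (L : language Sigma) :
  R_U1_W2 L -> rover_class L.
Proof.
move=> [h [A [_ HL]]].
exists (h + 2), (heads_rover A), (#|ha_state A| + h + 5) => w.
split=> [B /heads_rover_sound|/HL/heads_rover_complete//].
by move=> H; apply/HL.
Qed.

(** * Counter automata simulate rovers *)

Section CounterDevice.
Variables (Sigma Wk : finType) (blank : Wk).
Notation nobs := (marked Sigma * Wk * bool)%type.
Notation ncmd := (Wk * dir * dir * dir)%type.

Definition nidle (o : nobs) : ncmd := (o.1.2, Stay, Stay, Stay).

Definition counter_of (M : automaton nobs ncmd) : counter_automaton Sigma :=
  @CounterAutomaton Sigma (aut_state M) Wk blank
    (fun q a g z => [set t | (t.1.1.1.1, (t.1.1.1.2, t.1.1.2, t.1.2, t.2))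
                               \in aut_trans q (a, g, z)])
    (aut_init M) (@aut_acc _ _ M).

Variable w : seq Sigma.
Notation n := (size w).

Record ndev := NDev {
  nhead : 'I_n.+2;
  ntape : nat -> Wk;
  npos : nat;
  nctr : nat
}.

Definition ndev_obs (d : ndev) : nobs :=
  (input_sym w (nhead d), ntape d (npos d), nctr d == 0).

Definition hmove (e : dir) (i : 'I_n.+2) : 'I_n.+2 := inord (move_head w e i).

Definition write (T : nat -> Wk) (i : nat) (g : Wk) : nat -> Wk :=
  fun k => if k == i then g else T k.

Definition ndev_apply (c : ncmd) (d : ndev) : ndev :=
  NDev (hmove c.1.1.2 (nhead d)) (write (ntape d) (npos d) c.1.1.1)
       (shift c.1.2 (npos d)) (shift c.2 (nctr d)).

Definition ndev_app (c : ncmd) (d d' : ndev) : Prop :=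
  d' = ndev_apply c d /\ (c.2 = Minus -> 0 < nctr d).

Definition ndev0 : ndev := NDev ord0 (fun _ => blank) 0 0.

Lemma val_hmove e i : hmove e i = move_head w e i :> nat.
Proof. by rewrite inordK // /move_head; lia. Qed.

Lemma hmove_stay i : hmove Stay i = i.
Proof. by apply: val_inj; rewrite /= val_hmove /move_head /=; have := ltn_ord i; lia. Qed.

Lemma write_id T i : write T i (T i) = T.
Proof. by apply: functional_extensionality => k; rewrite /write; case: eqP => // ->. Qed.

Lemma ndev_app_idle d d' : ndev_app (nidle (ndev_obs d)) d d' <-> d' = d.
Proof.
rewrite /ndev_app /ndev_apply /= hmove_stay write_id.
by case: d => i T p k; split=> [[]|->].
Qed.

Section Conversion.
Variable M : automaton nobs ncmd.
Notation N := (counter_of M).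

Definition nc_conf_of (s : aut_state M * ndev) : nc_conf N :=
  @NcConf Sigma N s.1 (nhead s.2) (ntape s.2) (npos s.2) (nctr s.2).

Lemma star_nc_reach s :
  star (aut_step ndev_obs ndev_app (M := M)) (aut_init M, ndev0) s ->
  nc_reach w (nc_conf_of s).
Proof.
elim=> [|[q d] [q' d'] [[[[g di] dw] dc] /= tr [-> pos]] _ IH]; first exact: NcReach0.
apply: NcReachS IH _.
have := @NcStep _ N w (nc_conf_of (q, d)) q' g di dw dc.
rewrite /nc_conf_of /= val_hmove; apply=> //; by rewrite inE.
Qed.

Lemma nc_reach_star c : nc_reach w c ->
  exists2 s, star (aut_step ndev_obs ndev_app (M := M)) (aut_init M, ndev0) s
           & c = nc_conf_of s.
Proof.
elim=> [|_ _ _ [[q d] S ->] [q' g di dw dc tr pos]].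
  by exists (aut_init M, ndev0) => //; exact: rtn1_refl.
exists (q', ndev_apply (g, di, dw, dc) d).
  apply: rtn1_trans S; exists (g, di, dw, dc) => //.
  by move: tr; rewrite inE.
by rewrite /nc_conf_of /= val_hmove.
Qed.

Lemma counter_of_accepts :
  nc_accepts N w <-> aut_accepts ndev_obs ndev_app M ndev0.
Proof.
split=> [[c /nc_reach_star[s S ->] acc]|[s S acc]]; first by exists s.
by exists (nc_conf_of s) => //; exact: star_nc_reach.
Qed.

End Conversion.
End CounterDevice.

(** * Positional notation on parallel tracks *)

Section Digits.
Variables r b : nat.
Notation vec := {ffun 'I_r -> 'I_b.+1}.
Implicit Types (v : vec) (ds : seq vec) (j : 'I_r).

Definition set_digit j (z : 'I_b.+1) v : vec := [ffun k => if k == j then z else v k].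

(** Least significant digit first. A cell carries one digit of every register, so all registers
    share the same cells. *)
Definition value ds j : nat := foldr (fun v s => v j + b.+1 * s) 0 ds.

Lemma value_cat a c j : value (a ++ c) j = value a j + b.+1 ^ size a * value c j.
Proof.
elim: a => [|v a IH] /=; first by rewrite mul1n.
by rewrite -/(value _ j) IH -/(value a j) expnS; lia.
Qed.

Lemma value_lt ds j : value ds j < b.+1 ^ size ds.
Proof.
elim: ds => [|v ds IH] //=; rewrite -/(value ds j) expnS.
have := ltn_ord (v j); nia.
Qed.

Lemma value_nseq0 l j : value (nseq l [ffun=> ord0]) j = 0.
Proof. by elim: l => //= l; rewrite -/(value _ j) => ->; rewrite ffunE muln0. Qed.

Lemma value_set_other j k y a : k != j -> value (map (set_digit j y) a) k = value a k.
Proof.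
move=> kj; elim: a => //= v a; rewrite -!/(value _ k) => ->.
by rewrite ffunE (negPf kj).
Qed.

Lemma value_const0 a j : all (fun v : vec => v j == ord0) a -> value a j = 0.
Proof.
by elim: a => //= v a IH /andP[/eqP-> /IH]; rewrite -/(value _ j) => ->; rewrite muln0.
Qed.

Lemma value_max a j : all (fun v : vec => v j == ord_max) a -> (value a j).+1 = b.+1 ^ size a.
Proof.
elim: a => //= v a IH /andP[/eqP-> /IH]; rewrite -/(value _ j) expnS /=.
by lia.
Qed.

Lemma value_set j y a : all (fun v : vec => v j == y) (map (set_digit j y) a).
Proof. by elim: a => //= v a ->; rewrite ffunE !eqxx. Qed.

Definition succ_digit (z : 'I_b.+1) : option 'I_b.+1 :=
  if z == ord_max then None else Some (inord z.+1).
Definition pred_digit (z : 'I_b.+1) : option 'I_b.+1 :=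
  if z == ord0 then None else Some (inord z.-1).

(** The first digit different from [x] is where a carry, or a borrow, comes to rest. *)
Lemma split_digits j x ds :
  all (fun v : vec => v j == x) ds \/
  exists a v c, [/\ ds = a ++ v :: c, all (fun v : vec => v j == x) a & v j != x].
Proof.
elim: ds => [|v ds IH]; first by left.
have [vx|vx] := eqVneq (v j) x; last by right; exists [::], v, ds.
case: IH => [H|[a [u [c [-> H ux]]]]]; first by left; rewrite /= vx eqxx.
by right; exists (v :: a), u, c; rewrite /= vx eqxx.
Qed.

End Digits.

Section TrackPrograms.
Variables (Sigma F : finType) (r b : nat).
Notation vec := {ffun 'I_r -> 'I_b.+1}.
Notation Wk := (option (bool + vec)).
Notation nobs := (marked Sigma * Wk * bool)%type.
Notation ncmd := (Wk * dir * dir * dir)%type.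
Notation prg := (prog nobs ncmd F).

Definition left_end : Wk := Some (inl false).
Definition right_end : Wk := Some (inl true).
Definition digits (v : vec) : Wk := Some (inr v).

Definition tact (g : marked Sigma -> Wk -> bool -> option ncmd) : prg :=
  Atom (fun f o f' c => (f' == f) && (g o.1.1 o.1.2 o.2 == Some c)).

Definition leave_left : prg :=
  tact (fun _ s _ => if s == left_end then Some (s, Stay, Plus, Stay) else None).
Definition at_right : prg :=
  tact (fun _ s _ => if s == right_end then Some (s, Stay, Minus, Stay) else None).
Definition go_left : prg :=
  tact (fun _ s _ => if s == left_end then None else Some (s, Stay, Minus, Stay)).
Definition at_left : prg :=
  tact (fun _ s _ => if s == left_end then Some (s, Stay, Stay, Stay) else None).
Definition go_back : prg := Seq (Star go_left) at_left.

Definition carry (j : 'I_r) (x y : 'I_b.+1) : prg :=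
  tact (fun _ s _ =>
    if s is Some (inr v) then
      if v j == x then Some (digits (set_digit j y v), Stay, Plus, Stay) else None
    else None).

Definition bump_digit (j : 'I_r) (g : 'I_b.+1 -> option 'I_b.+1) : prg :=
  tact (fun _ s _ =>
    if s is Some (inr v) then
      if g (v j) is Some z then Some (digits (set_digit j z v), Stay, Minus, Stay)
      else None
    else None).

(** Schoolbook carrying. Leaving the loop of [carry] too early is ruled out by [g], which for [incr]
    and [decr] is undefined at [x]; on overflow or underflow the right end is reached, where
    [bump_digit] blocks. *)
Definition change j x y g : prg :=
  Seq leave_left (Seq (Star (carry j x y)) (Seq (bump_digit j g) go_back)).

Definition incr j : prg := change j ord_max ord0 (@succ_digit b).
Definition decr j : prg := change j ord0 ord_max (@pred_digit b).

Definition is_zero j : prg :=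
  Seq leave_left (Seq (Star (carry j ord0 ord0)) (Seq at_right go_back)).

Variable w : seq Sigma.
Notation n := (size w).
Notation dev := (ndev Wk w).
Notation rel p := (prel (@ndev_obs Sigma Wk w) (@ndev_app Sigma Wk w) (p : prg)).

Lemma rel_tact g (s s' : F * dev) : rel (tact g) s s' <->
  exists c, [/\ g (input_sym w (nhead s.2)) (ntape s.2 (npos s.2)) (nctr s.2 == 0)
                  = Some c,
                s' = (s.1, ndev_apply c s.2) & c.2 = Minus -> 0 < nctr s.2].
Proof.
case: s s' => [f d] [f' d']; split=> /=.
  by move=> [c /andP[/eqP/= -> /eqP Hc] [-> H]]; exists c.
by move=> [c [Hc [-> ->] H]]; exists c => //=; rewrite eqxx Hc eqxx.
Qed.

Definition layout (ds : seq vec) : nat -> Wk :=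
  nth None (left_end :: rcons (map digits ds) right_end).

Local Arguments layout : simpl never.

Definition dv (hd : 'I_n.+2) (ds : seq vec) (i : nat) : dev :=
  NDev hd (layout ds) i 0.

Lemma layout_left ds i : (layout ds i == left_end) = (i == 0).
Proof.
case: i => [|i] //; rewrite /layout /= nth_rcons size_map.
case: ltngtP => // lti; case: ds lti => // v ds lti.
by rewrite (nth_map v).
Qed.

Lemma layout_mid a v c : layout (a ++ v :: c) (size a).+1 = digits v.
Proof.
by rewrite /layout /= map_cat rcons_cat nth_cat size_map ltnn subnn.
Qed.

Lemma layout_end ds : layout ds (size ds).+1 = right_end.
Proof. by rewrite /layout /= nth_rcons size_map ltnn eqxx. Qed.

Lemma layout_write a v c z :
  write (layout (a ++ v :: c)) (size a).+1 (digits z) =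
  layout (a ++ z :: c).
Proof.
apply: functional_extensionality => k; rewrite /write /layout.
case: k => [|k] //=; rewrite eqSS !map_cat !rcons_cat !nth_cat size_map.
have [->|ne] := eqVneq k (size a); first by rewrite ltnn subnn.
case: ltnP => // lek; case E: (k - size a) => [|e] //; lia.
Qed.

Lemma dv_stay hd ds i e : ndev_apply (layout ds i, Stay, e, Stay) (dv hd ds i)
  = dv hd ds (shift e i).
Proof. by rewrite /ndev_apply /= hmove_stay write_id. Qed.

Lemma rel_go_back f hd ds i s' :
  rel go_back (f, dv hd ds i) s' <-> s' = (f, dv hd ds 0).
Proof.
split=> [/prel_seq[s1 /prel_star S /rel_tact[c []]]|->].
  have [k ->] : exists k, s1 = (f, dv hd ds k).
    apply: (star_inv (I := fun s => exists k, s = (f, dv hd ds k))) S; last by exists i.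
    move=> u v [k ->] /rel_tact[c' /= []]; case: ifP => // _ [<-] -> _.
    by exists k.-1; rewrite dv_stay.
  rewrite /= layout_left; case: eqP => // -> [<-] -> _.
  by rewrite (dv_stay hd ds 0).
apply/prel_seq; exists (f, dv hd ds 0); last first.
  by apply/rel_tact; exists (left_end, Stay, Stay, Stay); rewrite (dv_stay hd ds 0).
apply/prel_star; elim: i => [|i IH]; first exact: rtn1_refl.
apply: star_cons IH; apply/rel_tact.
exists (layout ds i.+1, Stay, Minus, Stay) => /=.
by rewrite layout_left dv_stay.
Qed.

Lemma rel_leave_left f hd ds s' :
  rel leave_left (f, dv hd ds 0) s' <-> s' = (f, dv hd ds 1).
Proof.
split=> [/rel_tact[c /= [[<-] -> _]]|->]; first by rewrite (dv_stay hd ds 0 Plus).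
apply/rel_tact; exists (left_end, Stay, Plus, Stay).
by rewrite (dv_stay hd ds 0 Plus).
Qed.

Lemma rel_carries f hd ds j x y s' :
  rel (Star (carry j x y)) (f, dv hd ds 1) s' <->
  exists a c, [/\ ds = a ++ c, all (fun v : vec => v j == x) a &
    s' = (f, dv hd (map (set_digit j y) a ++ c) (size a).+1)].
Proof.
split=> [/prel_star S|[a [c [-> ax ->]]]].
  apply: (star_inv (I := fun s => exists a c, [/\ ds = a ++ c,
    all (fun v : vec => v j == x) a &
    s = (f, dv hd (map (set_digit j y) a ++ c) (size a).+1)])) S; last first.
    by exists [::], ds.
  move=> u v [a [c [dsE ax ->]]] /rel_tact[c' /= []].
  case: c dsE => [|z c] dsE.
    by rewrite cats0 -(size_map (set_digit j y)) layout_end.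
  rewrite -(size_map (set_digit j y)) layout_mid /=; case: eqP => // zx [<-] -> _.
  exists (rcons a z), c; rewrite all_rcons ax zx eqxx cat_rcons; split=> //.
  rewrite /ndev_apply /= hmove_stay layout_write size_rcons map_rcons cat_rcons.
  by rewrite size_map.
apply/prel_star; elim/last_ind: a c ax => [|a z IH] c ax; first exact: rtn1_refl.
rewrite all_rcons in ax; have /andP[/eqP zx ax'] := ax.
rewrite cat_rcons; apply: rtn1_trans (IH (z :: c) ax'); apply/rel_tact => /=.
exists (digits (set_digit j y z), Stay, Plus, Stay).
rewrite -[in X in layout _ X](size_map (set_digit j y)) layout_mid /= zx eqxx.
split=> //; rewrite /ndev_apply /= hmove_stay -[in X in write _ X](size_map (set_digit j y)).
by rewrite layout_write map_rcons cat_rcons size_rcons.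
Qed.

Lemma rel_change f hd ds j x y g s' :
  rel (change j x y g) (f, dv hd ds 0) s' <->
  exists a v c z, [/\ ds = a ++ v :: c, all (fun v : vec => v j == x) a, g (v j) = Some z &
    s' = (f, dv hd (map (set_digit j y) a ++ set_digit j z v :: c) 0)].
Proof.
split=> [/prel_seq[s1 /rel_leave_left-> /prel_seq[s2 /rel_carries[a [c [-> ax ->]]]]]|].
  move=> /prel_seq[s3 /rel_tact[c' /= [+ -> _]]]; case: c => [|v c].
    by rewrite cats0 -(size_map (set_digit j y)) layout_end.
  rewrite -(size_map (set_digit j y)) layout_mid /=.
  case gv: (g (v j)) => [z|//] [<-].
  rewrite /ndev_apply /= hmove_stay layout_write => /rel_go_back ->.
  by exists a, v, c, z.
move=> [a [v [c [z [-> ax gv ->]]]]].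
apply/prel_seq; exists (f, dv hd (a ++ v :: c) 1); first exact/rel_leave_left.
apply/prel_seq; exists (f, dv hd (map (set_digit j y) a ++ v :: c) (size a).+1).
  by apply/rel_carries; exists a, (v :: c).
apply/prel_seq.
exists (f, dv hd (map (set_digit j y) a ++ set_digit j z v :: c) (size a)); last first.
  exact/rel_go_back.
apply/rel_tact; exists (digits (set_digit j z v), Stay, Minus, Stay) => /=.
rewrite -[in X in layout _ X](size_map (set_digit j y)) layout_mid /= gv.
split=> //; rewrite /ndev_apply /= hmove_stay -[in X in write _ X](size_map (set_digit j y)).
by rewrite layout_write.
Qed.

Lemma rel_is_zero f hd ds j s' :
  rel (is_zero j) (f, dv hd ds 0) s' <-> s' = (f, dv hd ds 0) /\ value ds j = 0.
Proof.
have same a : all (fun v : vec => v j == ord0) a -> map (set_digit j (ord0 : 'I_b.+1)) a = a.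
  elim: a => //= v a IH /andP[/eqP v0 /IH ->]; congr cons.
  by apply/ffunP => k; rewrite ffunE; case: eqP => // ->.
split=> [/prel_seq[s1 /rel_leave_left-> /prel_seq[s2 /rel_carries[a [c [-> ax ->]]]]]|].
  move=> /prel_seq[s3 /rel_tact[c' /= [+ -> _]]]; rewrite same //; case: c => [|v c].
    rewrite cats0 layout_end eqxx => -[<-]; rewrite -(layout_end a) dv_stay.
    by move=> /rel_go_back ->; rewrite value_const0.
  by rewrite layout_mid.
move=> [-> v0]; have ax : all (fun v : vec => v j == ord0) ds.
  elim: ds v0 => //= v ds IH; rewrite -/(value ds j) => E.
  rewrite IH ?andbT; last by nia.
  by apply/eqP/val_inj => /=; lia.
apply/prel_seq; exists (f, dv hd ds 1); first exact/rel_leave_left.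
apply/prel_seq; exists (f, dv hd ds (size ds).+1).
  by apply/rel_carries; exists ds, [::]; rewrite same // cats0.
apply/prel_seq; exists (f, dv hd ds (size ds)); last exact/rel_go_back.
apply/rel_tact; exists (right_end, Stay, Minus, Stay) => /=; rewrite layout_end eqxx.
by rewrite -(layout_end ds) dv_stay.
Qed.

End TrackPrograms.

(** * Register programs and their realization on the work tape *)

Section RegisterPrograms.
Variables (Sigma F : finType) (r b : nat).
Notation vec := {ffun 'I_r -> 'I_b.+1}.
Notation Wk := (option (bool + vec)).
Notation nobs := (marked Sigma * Wk * bool)%type.
Notation ncmd := (Wk * dir * dir * dir)%type.
Notation left_end := (left_end r b).
Notation right_end := (right_end r b).

(** An intermediate language of number registers and an input head. Each instruction is realized by
    an excursion of the work head that starts and ends on the left end, which is why [AAct] may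
    demand to be there. *)
Inductive aprog :=
| AIncr of 'I_r
| ADecr of 'I_r
| AZero of 'I_r
| AAct of F -> marked Sigma -> F -> dir -> bool
| ASeq of aprog & aprog
| AAlt of aprog & aprog
| AStar of aprog.

Fixpoint realize (p : aprog) : prog nobs ncmd F :=
  match p with
  | AIncr j => incr Sigma F b j
  | ADecr j => decr Sigma F b j
  | AZero j => is_zero Sigma F b j
  | AAct G => Atom (fun f o f' c =>
      [&& o.1.2 == left_end, G f o.1.1 f' c.1.1.2 & c == (left_end, c.1.1.2, Stay, Stay)])
  | ASeq p q => Seq (realize p) (realize q)
  | AAlt p q => Alt (realize p) (realize q)
  | AStar p => Star (realize p)
  end.

Variable w : seq Sigma.
Notation n := (size w).
Notation dev := (ndev Wk w).
Notation rel p := (prel (@ndev_obs Sigma Wk w) (@ndev_app Sigma Wk w) p).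
Notation astate := (F * {ffun 'I_r -> nat} * 'I_n.+2)%type.

(** Increments block at [B], later the capacity of the digits, so that an overflow loses a run but
    never falsifies one. *)
Fixpoint arel (B : nat) (p : aprog) (a a' : astate) : Prop :=
  let: (f, x, i) := a in
  match p with
  | AIncr j => a' = (f, upd x j (x j).+1, i) /\ (x j).+1 < B
  | ADecr j => a' = (f, upd x j (x j).-1, i) /\ 0 < x j
  | AZero j => a' = a /\ x j = 0
  | AAct G => exists f' e, G f (input_sym w i) f' e /\ a' = (f', x, hmove e i)
  | ASeq p q => exists2 a1, arel B p a a1 & arel B q a1 a'
  | AAlt p q => arel B p a a' \/ arel B q a a'
  | AStar p => star (arel B p) a a'
  end.

Lemma arel_seq B p q a a' :
  arel B (ASeq p q) a a' <-> exists2 a1, arel B p a a1 & arel B q a1 a'.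
Proof. by case: a => [[f x] i]. Qed.

Lemma arel_alt B p q a a' :
  arel B (AAlt p q) a a' <-> arel B p a a' \/ arel B q a a'.
Proof. by case: a => [[f x] i]. Qed.

Lemma arel_star B p a a' : arel B (AStar p) a a' <-> star (arel B p) a a'.
Proof. by case: a => [[f x] i]. Qed.

Variable l : nat.
Notation B := (b.+1 ^ l).

Definition represents (a : astate) (s : F * dev) : Prop :=
  exists ds, [/\ size ds = l, forall j, value ds j = a.1.2 j &
                 s = (a.1.1, dv a.2 ds 0)].

Lemma value_incr (a c : seq vec) (v : vec) j z :
  all (fun v : vec => v j == ord_max) a -> succ_digit (v j) = Some z ->
  forall k, value (map (set_digit j ord0) a ++ set_digit j z v :: c) k =
    upd [ffun k => value (a ++ v :: c) k] j (value (a ++ v :: c) j).+1 k.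
Proof.
rewrite /succ_digit => ax; case: eqP => // vj [<-] k; rewrite !ffunE.
rewrite !value_cat size_map /= -!/(value c _).
case: eqP => [->|/eqP kj]; last by rewrite value_set_other // ffunE (negPf kj).
have := value_max ax; rewrite (value_const0 (value_set j ord0 a)) ffunE eqxx.
rewrite inordK; first by nia.
by have := ltn_ord (v j); rewrite !ltnS leq_eqVlt => /predU1P[/(@val_inj _ _ _ (v j) ord_max)|].
Qed.

Lemma value_decr (a c : seq vec) (v : vec) j z :
  all (fun v : vec => v j == ord0) a -> pred_digit (v j) = Some z ->
  (forall k, value (map (set_digit j ord_max) a ++ set_digit j z v :: c) k =
    upd [ffun k => value (a ++ v :: c) k] j (value (a ++ v :: c) j).-1 k) /\
  0 < value (a ++ v :: c) j.
Proof.
rewrite /pred_digit => ax; case: eqP => // vj [<-].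
have v0 : 0 < v j by rewrite lt0n; apply/eqP => E; apply: vj; exact: val_inj.
have B0 : 0 < b.+1 ^ size a by rewrite expn_gt0.
have vE : value (a ++ v :: c) j = b.+1 ^ size a * (v j + b.+1 * value c j).
  by rewrite value_cat /= -/(value c j) (value_const0 ax).
split=> [k|]; last by rewrite vE; nia.
rewrite !ffunE; case: eqP => [->|/eqP kj]; last first.
  rewrite !value_cat size_map /= -!/(value c _) value_set_other //.
  by rewrite ffunE (negPf kj).
rewrite vE value_cat size_map /= -/(value c j) ffunE eqxx inordK; last first.
  by have := ltn_ord (v j); lia.
have := value_max (value_set j ord_max a); rewrite size_map.
by case: (nat_of_ord (v j)) v0 => // d _; rewrite /=; nia.
Qed.

Lemma realize_sound p a s s' : represents a s -> rel (realize p) s s' ->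
  exists2 a', arel B p a a' & represents a' s'.
Proof.
elim: p a s s' => [j|j|j|G|p IHp q IHq|p IHp q IHq|p IHp] [[f x] i] s s'.
- move=> [ds [sz vs ->]] /rel_change[a [v [c [z [E ax gv ->]]]]].
  have V := value_incr c ax gv; rewrite -E in V.
  exists (f, upd x j (x j).+1, i); last first.
    exists (map (set_digit j ord0) a ++ set_digit j z v :: c); split=> //=.
      by rewrite -sz E !size_cat size_map.
    by move=> k; rewrite V !ffunE vs /= vs.
  split=> //; have := V j; rewrite upd_at vs /= => <-.
  by rewrite -sz E; apply: leq_trans (value_lt _ _) _; rewrite !size_cat size_map.
- move=> [ds [sz vs ->]] /rel_change[a [v [c [z [E ax gv ->]]]]].
  have [V V0] := value_decr c ax gv; rewrite -E in V V0.
  exists (f, upd x j (x j).-1, i); last first.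
    exists (map (set_digit j ord_max) a ++ set_digit j z v :: c); split=> //=.
      by rewrite -sz E !size_cat size_map.
    by move=> k; rewrite V !ffunE vs /= vs.
  by split=> //; rewrite vs in V0.
- move=> [ds [sz vs ->]] /rel_is_zero[-> v0].
  exists (f, x, i); first by split=> //; rewrite -v0 vs.
  by exists ds.
- move=> [ds [sz vs ->]]; case: s' => [f' d'].
  move=> [[[[g di] dw] dc] /and3P[_ /= HG /eqP/= [-> -> ->]] [-> _]].
  exists (f', x, hmove di i); first by exists f', di.
  exists ds; split=> //=; congr (_, _); rewrite /ndev_apply /dv /=.
  by congr NDev; exact: (write_id (layout ds) 0).
- move=> Ra /prel_seq[s1 /(IHp _ _ _ Ra)[a1 aa1 R1] /(IHq _ _ _ R1)[a2 aa2 R2]].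
  by exists a2 => //; apply/arel_seq; exists a1.
- move=> Ra /prel_alt[/(IHp _ _ _ Ra)|/(IHq _ _ _ Ra)] [a1 aa1 R1].
  + by exists a1 => //; apply/arel_alt; left.
  + by exists a1 => //; apply/arel_alt; right.
- move=> Ra /prel_star S.
  have [a' aa' Ra'] : exists2 a', star (arel B p) (f, x, i) a' & represents a' s'.
    apply: (star_inv (I := fun s => exists2 a', star (arel B p) (f, x, i) a'
      & represents a' s)) S; last by exists (f, x, i) => //; exact: rtn1_refl.
    move=> u v [a' aa' /IHp H] /H[a2 ? ?]; exists a2 => //.
    by apply: rtn1_trans aa'.
  by exists a' => //; apply/arel_star.
Qed.

Lemma realize_complete p a s a' : represents a s -> arel B p a a' ->
  exists2 s', rel (realize p) s s' & represents a' s'.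
Proof.
elim: p a s a' => [j|j|j|G|p IHp q IHq|p IHp q IHq|p IHp] [[f x] i] s a'.
- move=> [ds [sz vs ->]] [-> ltB].
  have [ax|[a [v [c [E ax vx]]]]] := split_digits j ord_max ds.
    by have := value_max ax; rewrite vs sz /=; lia.
  have [z gv] : exists z, succ_digit (v j) = Some z.
    by rewrite /succ_digit (negPf vx); eexists.
  have V := value_incr c ax gv; rewrite -E in V.
  exists (f, dv i (map (set_digit j ord0) a ++ set_digit j z v :: c) 0).
    by apply/rel_change; exists a, v, c, z.
  exists (map (set_digit j ord0) a ++ set_digit j z v :: c); split=> //=.
    by rewrite -sz E !size_cat size_map.
  by move=> k; rewrite V !ffunE vs /= vs.
- move=> [ds [sz vs ->]] [-> x0].
  have [ax|[a [v [c [E ax vx]]]]] := split_digits j ord0 ds.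
    by have := value_const0 ax; rewrite vs /=; lia.
  have [z gv] : exists z, pred_digit (v j) = Some z.
    by rewrite /pred_digit (negPf vx); eexists.
  have [V _] := value_decr c ax gv; rewrite -E in V.
  exists (f, dv i (map (set_digit j ord_max) a ++ set_digit j z v :: c) 0).
    by apply/rel_change; exists a, v, c, z.
  exists (map (set_digit j ord_max) a ++ set_digit j z v :: c); split=> //=.
    by rewrite -sz E !size_cat size_map.
  by move=> k; rewrite V !ffunE vs /= vs.
- move=> [ds [sz vs ->]] [-> x0]; exists (f, dv i ds 0); last by exists ds.
  by apply/rel_is_zero; rewrite vs.
- move=> [ds [sz vs ->]] [f' [e [HG ->]]].
  exists (f', dv (hmove e i) ds 0); last by exists ds.
  exists (left_end, e, Stay, Stay); first by rewrite /= HG !eqxx.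
  split=> //; rewrite /ndev_apply /dv /=.
  by congr NDev; apply/esym; exact: (write_id (layout ds) 0).
- move=> Ra /arel_seq[a1 /(IHp _ _ _ Ra)[s1 ss1 R1] /(IHq _ _ _ R1)[s2 ss2 R2]].
  by exists s2 => //; apply/prel_seq; exists s1.
- move=> Ra /arel_alt[/(IHp _ _ _ Ra)|/(IHq _ _ _ Ra)] [s1 ss1 R1].
  + by exists s1 => //; apply/prel_alt; left.
  + by exists s1 => //; apply/prel_alt; right.
- move=> Ra /arel_star S.
  have [s' ss' Rs'] : exists2 s', star (rel (realize p)) s s' & represents a' s'.
    apply: (star_inv (I := fun a => exists2 s', star (rel (realize p)) s s'
      & represents a s')) S; last by exists s => //; exact: rtn1_refl.
    move=> u v [s' ss' /IHp H] /H[s2 ? ?]; exists s2 => //.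
    by apply: rtn1_trans ss'.
  by exists s'.
Qed.

(* Once the right end is laid, no atom moves the work head past it. *)
Definition confined (s : F * dev) : Prop :=
  npos s.2 <= l.+1 /\ ntape s.2 l.+1 = right_end.

Definition respects_end (a : F -> nobs -> F -> ncmd -> bool) : Prop :=
  forall f o f' c, a f o f' c -> o.1.2 = right_end ->
    c.1.1.1 = right_end /\ c.1.2 <> Plus.

Lemma confined_atom a : respects_end a ->
  preserves (@ndev_obs Sigma Wk w) (@ndev_app Sigma Wk w) confined (Atom a).
Proof.
move=> Ha [f d] [f' d'] [/= lep Tl] [[[[g di] dw] dc] /= Hc [/= -> _]].
rewrite /confined /= /write.
have [E|ne] := eqVneq (npos d) l.+1.
  have [/= -> dwP] := Ha _ _ _ _ Hc (etrans (congr1 _ E) Tl).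
  by split=> //; case: dw dwP {Hc} => //= _; lia.
rewrite Tl; split=> //.
by case: dw {Hc} => /=; lia.
Qed.

Lemma confined_tact g :
  (forall a z c, g a right_end z = Some c -> c.1.1.1 = right_end /\ c.1.2 <> Plus) ->
  preserves (@ndev_obs Sigma Wk w) (@ndev_app Sigma Wk w) confined (tact F g).
Proof.
move=> Hg; apply: confined_atom => f [[a s] z] f' c /andP[_ /eqP/= E] sE.
by rewrite sE in E; exact: Hg E.
Qed.

Lemma confined_go_back :
  preserves (@ndev_obs Sigma Wk w) (@ndev_app Sigma Wk w) confined (go_back Sigma F r b).
Proof.
by split; apply: confined_tact => a z c //= [<-].
Qed.

Lemma confined_realize p :
  preserves (@ndev_obs Sigma Wk w) (@ndev_app Sigma Wk w) confined (realize p).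
Proof.
elim: p => [j|j|j|G|p IHp q IHq|p IHp q IHq|p IHp] //.
- split; first exact: confined_tact.
  split; first exact: confined_tact.
  split; [exact: confined_tact | exact: confined_go_back].
- split; first exact: confined_tact.
  split; first exact: confined_tact.
  split; [exact: confined_tact | exact: confined_go_back].
- split; first exact: confined_tact.
  split; first exact: confined_tact.
  split; last exact: confined_go_back.
  by apply: confined_tact => a z c /= [<-].
(* [AAct] fires only on the left end, so it is never enabled on the right end. *)
- by apply: confined_atom => f [[a s] z] f' c /= /and3P[/eqP/= ->].
Qed.

End RegisterPrograms.

Arguments arel : simpl never.

(** * Laying out logarithmically many cells *)

Section LogSetup.
Variables (Sigma F : finType) (r b : nat).
Notation vec := {ffun 'I_r -> 'I_b.+1}.
Notation Wk := (option (bool + vec)).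
Notation nobs := (marked Sigma * Wk * bool)%type.
Notation ncmd := (Wk * dir * dir * dir)%type.
Notation prg := (prog nobs ncmd F).
Notation left_end := (left_end r b).
Notation right_end := (right_end r b).
Notation go_back := (go_back Sigma F r b).
Notation vec0 := ([ffun=> ord0] : vec).

Definition count_input : prg :=
  tact F (fun a s z => if a == rmark then None else Some (s, Plus, Stay, Plus)).
Definition at_rmark : prg :=
  tact F (fun a s z => if a == rmark then Some (s, Stay, Stay, Stay) else None).
Definition rewind_input : prg :=
  tact F (fun a s z => if a == lmark then None else Some (s, Minus, Stay, Stay)).
Definition put_left : prg :=
  tact F (fun a s z => if a == lmark then Some (left_end, Stay, Plus, Stay) else None).
Definition ctr_pos : prg :=
  tact F (fun a s z => if z then None else Some (s, Stay, Stay, Stay)).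
Definition ctr_zero : prg :=
  tact F (fun a s z => if z then Some (s, Stay, Stay, Stay) else None).
Definition ctr_dec : prg :=
  tact F (fun a s z => if z then None else Some (s, Stay, Stay, Minus)).
Definition ctr_to_head : prg :=
  tact F (fun a s z => if z then None else Some (s, Plus, Stay, Minus)).
Definition head_to_ctr : prg :=
  tact F (fun a s z => if a == lmark then None else Some (s, Minus, Stay, Plus)).
Definition put_digit : prg :=
  tact F (fun a s z => if a == lmark then Some (digits vec0, Stay, Plus, Stay) else None).
Definition put_right : prg :=
  tact F (fun a s z => if z then Some (right_end, Stay, Stay, Stay) else None).

Definition init_pre : prg := Seq (Star count_input) (Seq at_rmark (Star rewind_input)).
Definition setup_init : prg := Seq init_pre put_left.

(** Two units of the counter become one step of the input head, a remainder of at most one is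
    dropped, and the head is paid back into the counter. A loop left too early fails at the next
    test, which after the last loop is that of [put_digit]. *)
Definition halve_pre : prg :=
  Seq ctr_pos (Seq (Star (Seq ctr_dec ctr_to_head))
    (Seq (Alt ctr_zero (Seq ctr_dec ctr_zero)) (Star head_to_ctr))).
Definition halve : prg := Seq halve_pre put_digit.

Variable w : seq Sigma.
Notation n := (size w).
Notation dev := (ndev Wk w).
Notation rel p := (prel (@ndev_obs Sigma Wk w) (@ndev_app Sigma Wk w) (p : prg)).
Notation dev0 := (ndev0 None w : dev).

Definition sd (k : nat) (T : nat -> Wk) (p c : nat) : dev := NDev (inord k) T p c.

Lemma sd_apply k T p c e g dw dc : k <= n.+1 ->
  ndev_apply (g, e, dw, dc) (sd k T p c) =
  sd (move_head w e k) (write T p g) (shift dw p) (shift dc c).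
Proof.
move=> lek; rewrite /ndev_apply /sd /=; congr NDev.
by apply: val_inj; rewrite /= val_hmove !inordK // /move_head; lia.
Qed.

Lemma sd_sym k : k <= n.+1 -> input_sym w (inord k : 'I_n.+2) = input_sym w k.
Proof. by move=> lek; rewrite inordK. Qed.

Lemma rel_sd g f k T p c s' : k <= n.+1 ->
  rel (tact F g) (f, sd k T p c) s' <->
  exists x, [/\ g (input_sym w k) (T p) (c == 0) = Some x,
    s' = (f, sd (move_head w x.1.1.2 k) (write T p x.1.1.1) (shift x.1.2 p)
                (shift x.2 c)) & x.2 = Minus -> 0 < c].
Proof.
move=> lek; rewrite rel_tact /= sd_sym //.
by split=> -[[[[x1 x2] x3] x4] /= [H1 H2 H3]]; exists (x1, x2, x3, x4);
  split=> //=; move: H2; rewrite sd_apply.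
Qed.

Definition laid (i : nat) : nat -> Wk :=
  nth None (left_end :: nseq i (digits vec0)).

Lemma laid_start : write (fun _ => None) 0 left_end = laid 0.
Proof. by apply: functional_extensionality => -[|k] //; rewrite /laid /= nth_nil. Qed.

Lemma laid_digit i : write (laid i) i.+1 (digits vec0) = laid i.+1.
Proof.
apply: functional_extensionality => -[|k] //.
rewrite /write /laid eqSS -![nth _ (_ :: _) _.+1]/(nth _ _ k) !nth_nseq ltnS.
by case: ltngtP.
Qed.

Lemma laid_end i : write (laid i) i.+1 right_end = layout (nseq i vec0).
Proof.
apply: functional_extensionality => -[|k] //.
rewrite /write /laid /layout eqSS -![nth _ (_ :: _) _.+1]/(nth _ _ k).
by rewrite nth_rcons size_map size_nseq map_nseq !nth_nseq; case: ltngtP.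
Qed.

Lemma rel_setup_init f s' :
  rel setup_init (f, dev0) s' <-> s' = (f, sd 0 (laid 0) 1 n.+1).
Proof.
have -> : dev0 = sd 0 (fun _ => None) 0 0.
  by rewrite /sd /ndev0; congr NDev; apply: val_inj; rewrite /= inordK.
split=> [/prel_seq[s2 /prel_seq[s1 /prel_star S1 /prel_seq[s3 H3 /prel_star S2]] H4]|->].
  have [k lek E1] : exists2 k, k <= n.+1 & s1 = (f, sd k (fun _ => None) 0 k).
    apply: (star_inv (I := fun s => exists2 k, k <= n.+1 &
      s = (f, sd k (fun _ => None) 0 k))) S1; last by exists 0.
    move=> u v [k lek ->] /(rel_sd _ _ _ _ _ _ lek)[x /= []].
    rewrite input_sym_eq_rmark; case: ltnP => // lekn [<-] -> _ /=.
    exists k.+1; first by lia.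
    by rewrite write_id /move_head /= (minn_idPl _).
  subst s1; move: H3 => /(rel_sd _ _ _ _ _ _ lek)[x /= []].
  rewrite input_sym_eq_rmark; case: ltnP => // ltnk [<-] E _; subst s3.
  rewrite /= write_id /move_head /= (minn_idPl lek) in S2.
  have kE : k = n.+1 by lia.
  have [k' lek' E2] : exists2 k', k' <= n.+1 & s2 = (f, sd k' (fun _ => None) 0 k).
    apply: (star_inv (I := fun s => exists2 k', k' <= n.+1 &
      s = (f, sd k' (fun _ => None) 0 k))) S2; last by exists k.
    move=> u v [k' lek' ->] /(rel_sd _ _ _ _ _ _ lek')[x' /= []].
    rewrite input_sym_eq_lmark; case: eqP => // k0 [<-] -> _ /=.
    exists k'.-1; first by lia.
    by rewrite write_id /move_head /= (minn_idPl _) //; lia.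
  subst s2; move: H4 => /(rel_sd _ _ _ _ _ _ lek')[x' /= []].
  rewrite input_sym_eq_lmark; case: eqP => // -> [<-] -> _ /=.
  by rewrite laid_start /move_head min0n kE.
apply/prel_seq; exists (f, sd 0 (fun _ => None) 0 n.+1); last first.
  apply/rel_sd => //; exists (left_end, Stay, Plus, Stay) => /=.
  by rewrite laid_start /move_head min0n.
apply/prel_seq; exists (f, sd n.+1 (fun _ => None) 0 n.+1).
  apply/prel_star; suff H k : k <= n.+1 ->
      star (rel count_input) (f, sd 0 (fun _ => None) 0 0) (f, sd k (fun _ => None) 0 k).
    exact: H.
  elim: k => [|k IH] lek; first exact: rtn1_refl.
  apply: rtn1_trans (IH (ltnW lek)); apply/rel_sd; first exact: ltnW.
  exists (None, Plus, Stay, Plus) => /=.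
  rewrite input_sym_eq_rmark ltnNge -ltnS lek /= (write_id (fun=> None)).
  by rewrite /move_head /= (minn_idPl lek).
apply/prel_seq; exists (f, sd n.+1 (fun _ => None) 0 n.+1).
  apply/rel_sd => //; exists (None, Stay, Stay, Stay) => /=.
  by rewrite input_sym_eq_rmark ltnSn (write_id (fun=> None)) /move_head /= minnn.
apply/prel_star; suff H k : k <= n.+1 -> star (rel rewind_input)
    (f, sd k (fun _ => None) 0 n.+1) (f, sd 0 (fun _ => None) 0 n.+1) by exact: H.
elim: k => [|k IH] lek; first exact: rtn1_refl.
apply: star_cons (IH (ltnW lek)); apply/rel_sd => //.
exists (None, Minus, Stay, Stay) => /=.
rewrite input_sym_eq_lmark /= (write_id (fun=> None)) /move_head /=.
by rewrite (minn_idPl (ltnW lek)).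
Qed.

Lemma rel_halve f i v s' : v <= n.+1 ->
  rel halve (f, sd 0 (laid i) i.+1 v) s' <->
  0 < v /\ s' = (f, sd 0 (laid i.+1) i.+2 v./2).
Proof.
set T := laid i; set p := i.+1 => lev.
have stay k (lek : k <= n.+1) : move_head w Stay k = k.
  by rewrite /move_head /=; exact/minn_idPl.
have plus k (lek : k.+1 <= n.+1) : move_head w Plus k = k.+1.
  by rewrite /move_head /=; exact/minn_idPl.
have minus k (lek : k <= n.+1) : move_head w Minus k = k.-1.
  by rewrite /move_head /=; apply/minn_idPl; lia.
split.
  move=> /prel_seq[s1 /prel_seq[s2 H2 /prel_seq[s3 /prel_star S3]]].
  move=> /prel_seq[s4 H4 /prel_star S5] H6.
  move: H2 => /(rel_sd _ _ _ _ _ _ (leq0n _))[x /= []].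
  case: eqP => // v0 [<-] E _; rewrite /= write_id stay // in E; subst s2.
  split; first lia.
  have [k kv E] : exists2 k, k.*2 <= v & s3 = (f, sd k T p (v - k.*2)).
    apply: (star_inv (I := fun s => exists2 k, k.*2 <= v &
      s = (f, sd k T p (v - k.*2)))) S3; last by exists 0; rewrite ?subn0.
    move=> u u' [k kv ->] /prel_seq[u1].
    have lek : k <= n.+1 by lia.
    move=> /(rel_sd _ _ _ _ _ _ lek)[x1 /= []]; case: eqP => // c0 [<-] -> _ /=.
    rewrite write_id stay // => /(rel_sd _ _ _ _ _ _ lek)[x2 /= []].
    case: eqP => // c1 [<-] -> _ /=; exists k.+1; first by lia.
    by rewrite write_id plus; [congr (_, sd _ _ _ _); lia | lia].
  subst s3; have lek : k <= n.+1 by lia.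
  have [kE E] : k = v./2 /\ s4 = (f, sd k T p 0).
    case/prel_alt: H4 => [/(rel_sd _ _ _ _ _ _ lek)[x1 /= []]|/prel_seq[u1]].
      case: eqP => // c0 [<-] -> _ /=; rewrite write_id stay // c0; split=> //; lia.
    move=> /(rel_sd _ _ _ _ _ _ lek)[x1 /= []]; case: eqP => // c0 [<-] -> _ /=.
    rewrite write_id stay // => /(rel_sd _ _ _ _ _ _ lek)[x2 /= []].
    by case: eqP => // c1 [<-] -> _ /=; rewrite write_id stay // c1; split=> //; lia.
  subst s4.
  have [c lec E] : exists2 c, c <= k & s1 = (f, sd (k - c) T p c).
    apply: (star_inv (I := fun s => exists2 c, c <= k & s = (f, sd (k - c) T p c))) S5;
      last by exists 0; rewrite ?subn0.
    move=> u u' [c lec ->].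
    have lekc : k - c <= n.+1 by lia.
    move=> /(rel_sd _ _ _ _ _ _ lekc)[x1 /= []]; rewrite input_sym_eq_lmark.
    case: eqP => // c0 [<-] -> _ /=; exists c.+1; first by lia.
    by rewrite write_id minus //; congr (_, sd _ _ _ _); lia.
  subst s1; have lekc : k - c <= n.+1 by lia.
  move: H6 => /(rel_sd _ _ _ _ _ _ lekc)[x1 /= []]; rewrite input_sym_eq_lmark.
  case: eqP => // c0 [<-] -> _ /=; rewrite c0 laid_digit stay //.
  by congr (_, sd _ _ _ _); lia.
move=> [v0 ->]; apply/prel_seq; exists (f, sd 0 T p v./2); last first.
  apply/rel_sd => //; exists (digits vec0, Stay, Plus, Stay) => /=.
  by rewrite laid_digit stay.
apply/prel_seq; exists (f, sd 0 T p v).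
  apply/rel_sd => //; exists (T p, Stay, Stay, Stay) => /=.
  by rewrite write_id stay //; case: eqP => //; lia.
apply/prel_seq; exists (f, sd v./2 T p (v - v./2.*2)).
  apply/prel_star; have : v./2.*2 <= v by lia.
  elim: (v./2) => [|k IH] lek; first by rewrite subn0; exact: rtn1_refl.
  apply: rtn1_trans (IH _); last by lia.
  have lekn : k <= n.+1 by lia.
  apply/prel_seq; exists (f, sd k T p (v - k.*2).-1).
    apply/rel_sd => //; exists (T p, Stay, Stay, Minus) => /=.
    by rewrite write_id stay //; case: eqP => //; [lia | split=> // _; lia].
  apply/rel_sd => //; exists (T p, Plus, Stay, Minus) => /=.
  rewrite write_id plus; last by lia.
  case: eqP => ?; first by lia.
  by split=> // [|_]; [congr (_, sd _ _ _ _); lia | lia].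
have lek : v./2 <= n.+1 by lia.
apply/prel_seq; exists (f, sd v./2 T p 0).
  apply/prel_alt; have [c0|c0] := eqVneq (v - v./2.*2) 0; [left|right].
    apply/rel_sd => //; exists (T p, Stay, Stay, Stay) => /=.
    by rewrite c0 eqxx write_id stay.
  apply/prel_seq; exists (f, sd v./2 T p 0).
    apply/rel_sd => //; exists (T p, Stay, Stay, Minus) => /=.
    rewrite (negPf c0) write_id stay //; split=> // [|_]; last by lia.
    by congr (_, sd _ _ _ _); lia.
  apply/rel_sd => //; exists (T p, Stay, Stay, Stay) => /=.
  by rewrite write_id stay.
apply/prel_star.
suff H c : c <= v./2 -> star (rel head_to_ctr) (f, sd v./2 T p 0) (f, sd (v./2 - c) T p c).
  by have := H _ (leqnn _); rewrite subnn.
elim: c => [|c IH] lec; first by rewrite subn0; exact: rtn1_refl.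
apply: rtn1_trans (IH (ltnW lec)); apply/rel_sd; first by lia.
exists (T p, Minus, Stay, Plus) => /=.
rewrite input_sym_eq_lmark; case: eqP => ?; first by lia.
rewrite write_id minus; last by lia.
by split=> //; congr (_, sd _ _ _ _); lia.
Qed.

(** The first part says that [v] is the quotient of [n.+1] by [2 ^ i]; at [v = 0] it makes [i]
    binary digits sufficient for [n.+1]. The second part bounds the number of cells, with a factor 2
    because the last halving goes from 1 to 0. *)
Definition stage (i v : nat) : bool :=
  (2 ^ i * v <= n.+1 < 2 ^ i * v.+1) && (2 ^ i <= 2 * n.+1).

Lemma stage_le i v : stage i v -> v <= n.+1.
Proof.
move=> /andP[/andP[le1 _] _]; apply: leq_trans le1.
by rewrite leq_pmull // expn_gt0.
Qed.

Lemma stage_half i v : 0 < v -> stage i v -> stage i.+1 v./2.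
Proof.
have vE := odd_double_half v.
rewrite /stage expnS => v0 /andP[/andP[le1 le2] le3]; apply/andP; split; last nia.
by apply/andP; split; nia.
Qed.

Lemma stage0 : stage 0 n.+1.
Proof. by rewrite /stage expn0; lia. Qed.

Lemma halves_stage f s : star (rel halve) (f, sd 0 (laid 0) 1 n.+1) s ->
  exists i v, s = (f, sd 0 (laid i) i.+1 v) /\ stage i v.
Proof.
apply: (star_inv (I := fun s => exists i v,
  s = (f, sd 0 (laid i) i.+1 v) /\ stage i v)); last first.
  by exists 0, n.+1; split=> //; exact: stage0.
move=> u u' [i [v [-> st]]] /(rel_halve _ _ _ (stage_le st))[v0 ->].
by exists i.+1, v./2; split=> //; exact: stage_half.
Qed.

Definition setup : prg := Seq setup_init (Seq (Star halve) (Seq put_right go_back)).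

Lemma rel_put_right f i v s' :
  rel put_right (f, sd 0 (laid i) i.+1 v) s' <->
  v = 0 /\ s' = (f, dv (inord 0) (nseq i vec0) i.+1).
Proof.
have E : sd (move_head w Stay 0) (write (laid i) i.+1 right_end) i.+1 0 =
    dv (inord 0) (nseq i vec0) i.+1 by rewrite laid_end /move_head min0n.
split=> [/(rel_sd _ _ _ _ _ _ (leq0n _))[x /= []]|[-> ->]].
  by case: eqP => // -> [<-] -> _; rewrite E.
apply/rel_sd => //; exists (right_end, Stay, Stay, Stay) => /=.
by rewrite E.
Qed.

Lemma setup_sound f s' : rel setup (f, dev0) s' ->
  exists l, s' = (f, dv (inord 0) (nseq l vec0) 0) /\ n.+1 < 2 ^ l.
Proof.
move=> /prel_seq[s1 /rel_setup_init-> /prel_seq[s2 /prel_star/halves_stage[i [v [-> st]]]]].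
move=> /prel_seq[s3 /rel_put_right[v0 ->] /rel_go_back ->]; exists i; split=> //.
by move: st; rewrite v0 /stage muln1 => /andP[/andP[_ ->]].
Qed.

Lemma setup_complete f : exists l,
  rel setup (f, dev0) (f, dv (inord 0) (nseq l vec0) 0) /\ n.+1 < 2 ^ l.
Proof.
suff H v i : stage i v -> exists2 l, star (rel halve) (f, sd 0 (laid i) i.+1 v)
    (f, sd 0 (laid l) l.+1 0) & stage l 0.
  have [l S st] := H _ _ stage0; exists l; split; last first.
    by move: st; rewrite /stage muln1 => /andP[/andP[_ ->]].
  apply/prel_seq; exists (f, sd 0 (laid 0) 1 n.+1); first exact/rel_setup_init.
  apply/prel_seq; exists (f, sd 0 (laid l) l.+1 0); first exact/prel_star.
  apply/prel_seq; exists (f, dv (inord 0) (nseq l vec0) l.+1).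
    exact/rel_put_right.
  exact/rel_go_back.
elim/ltn_ind: v i => v IH i st; have [v0|v0] := posnP v.
  by rewrite v0 in st *; exists i => //; exact: rtn1_refl.
have [|l S st'] := IH v./2 _ _ (stage_half v0 st); first by lia.
exists l => //; apply: star_cons S; apply/rel_halve => //; exact: stage_le st.
Qed.

Lemma tact_keeps_pos p g : (forall a s z c, g a s z = Some c -> c.1.2 = Stay) ->
  preserves (@ndev_obs Sigma Wk w) (@ndev_app Sigma Wk w)
    (fun s => npos s.2 = p) (tact F g).
Proof. by move=> Hg s s' sp /rel_tact[c [/Hg E -> _]]; rewrite /= E. Qed.

Lemma visits_atom_pos a s s' :
  visits (@ndev_obs Sigma Wk w) (@ndev_app Sigma Wk w) (Atom a : prg) s s' ->
  npos s'.2 <= (npos s.2).+1.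
Proof. by move=> [->//|[c _ [-> _]]] /=; case: c.1.2 => /=; lia. Qed.

(** Until the right end is laid, the position is read off the [stage]: only the last atoms of
    [setup_init] and [halve] move the work head, and [init_pre] and [halve_pre] are split off for
    this reason. From then on [confined] takes over. *)
Lemma visits_setup (p : aprog Sigma F r) f s :
  visits (@ndev_obs Sigma Wk w) (@ndev_app Sigma Wk w)
    (Seq setup_init (Seq (Star halve) (Seq put_right (Seq go_back (realize b p)))))
    (f, dev0) s ->
  exists l, 2 ^ l <= 2 * n.+1 /\ npos s.2 <= l.+2.
Proof.
move=> [H|[s1 /rel_setup_init-> [[s2 /halves_stage[i [v [-> st]]] H]|]]].
- have keeps0 : preserves (@ndev_obs Sigma Wk w) (@ndev_app Sigma Wk w)
      (fun s => npos s.2 = 0) init_pre.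
    by do 2?split; apply: tact_keeps_pos => a g z c; case: ifP => // _ [<-].
  exists 0; split=> //; case: H => [H|[s1 H1 H]].
    suff -> : npos s.2 = 0 by [].
    exact: (preserves_visits (I := fun s => npos s.2 = 0) keeps0) H.
  have p1 : npos s1.2 = 0.
    exact: (preserves_prel (I := fun s => npos s.2 = 0) keeps0) H1.
  by have := visits_atom_pos H; rewrite p1; lia.
- exists i; split; first by case/andP: st.
  have keeps : preserves (@ndev_obs Sigma Wk w) (@ndev_app Sigma Wk w)
      (fun s => npos s.2 = i.+1) halve_pre.
    by repeat split; apply: tact_keeps_pos => a g z c; case: ifP => // _ [<-].
  case: H => [H|[s3 H1 H]].
    suff -> : npos s.2 = i.+1 by [].
    exact: (preserves_visits (I := fun s => npos s.2 = i.+1) keeps) H.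
  have p1 : npos s3.2 = i.+1.
    exact: (preserves_prel (I := fun s => npos s.2 = i.+1) keeps) H1.
  by have := visits_atom_pos H; rewrite p1; lia.
move=> [s2 /halves_stage[i [v [-> st]]] H].
exists i; split; first by case/andP: st.
case: H => [H|[s3 /rel_put_right[_ ->] H]]; first exact: (visits_atom_pos H).
have [] : confined i s; last by lia.
apply: (preserves_visits (p := Seq go_back (realize b p))) H.
  by split; [exact: confined_go_back | exact: confined_realize].
by split=> //=; rewrite -[in X in layout _ X](size_nseq i vec0) layout_end.
Qed.

End LogSetup.

(** * A rover step as a register program *)

Section RoverToCounter.
Variables (Sigma : finType) (m : nat) (M : rover Sigma m) (K : nat).
Notation F := (aut_state M * {ffun 'I_m -> marked Sigma} * {ffun 'I_m -> dir})%type.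
Notation r := m.+1.
(** Numbers are written in base [b.+1]. The setup yields [l] digits with [(size w).+1 < 2 ^ l], so
    the capacity [b.+1 ^ l] is at least [(2 ^ l) ^ K], hence at least [(size w).+2 ^ K]. *)
Notation b := (2 ^ K).
Notation aprg := (aprog Sigma F r).
Notation regs := {ffun 'I_r -> nat}.
Implicit Types (f : F) (x : regs) (y : {ffun 'I_m -> nat}) (j : 'I_m).

(* Register 0 is scratch: register [j] of the rover is emptied into it while
   the input head moves to the position to be read. *)
Definition scratch : 'I_r := ord0.
Definition reg j : 'I_r := lift ord0 j.

Definition atest (P : F -> marked Sigma -> bool) : aprg :=
  AAct r (fun f a f' e => [&& P f a, f' == f & e == Stay]).

Definition ahead (d : dir) : aprg := AAct r (fun f a f' e => (f' == f) && (e == d)).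

Definition arewind : aprg :=
  ASeq (AStar (ASeq (atest (fun _ a => a != lmark)) (ahead Minus)))
       (atest (fun _ a => a == lmark)).

Definition record_sym j (a : marked Sigma) f : F :=
  (f.1.1, [ffun k => if k == j then a else f.1.2 k], f.2).

Definition aread j : aprg :=
  ASeq arewind
  (ASeq (AStar (ASeq (ADecr Sigma F (reg j)) (ASeq (AIncr Sigma F scratch) (ahead Plus))))
  (ASeq (AZero Sigma F (reg j))
  (ASeq (AAct r (fun f a f' e => (f' == record_sym j a f) && (e == Stay)))
  (ASeq (AStar (ASeq (ADecr Sigma F scratch) (AIncr Sigma F (reg j))))
        (AZero Sigma F scratch))))).

Definition achoose : aprg :=
  AAct r (fun f a f' e =>
    [&& (f'.1.1, f'.2) \in aut_trans f.1.1 f.1.2, f'.1.2 == f.1.2 & e == Stay]).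

Definition aupdate j : aprg :=
  AAlt (atest (fun f _ => f.2 j == Stay))
  (AAlt (ASeq (atest (fun f _ => f.2 j == Plus)) (AIncr Sigma F (reg j)))
        (ASeq (atest (fun f _ => f.2 j == Minus))
              (AAlt (AZero Sigma F (reg j)) (ADecr Sigma F (reg j))))).

Definition aseqs (ps : seq aprg) : aprg :=
  foldr (@ASeq _ _ _) (atest (fun _ _ => true)) ps.

(** All symbols are recorded in the finite control before any register is updated, since a
    transition depends on all heads at once. *)
Definition around : aprg :=
  ASeq (aseqs [seq aread j | j <- enum 'I_m])
  (ASeq achoose (aseqs [seq aupdate j | j <- enum 'I_m])).

Section Word.
Variables (w : seq Sigma) (B : nat).
Notation n := (size w).
Notation ar p := (@arel Sigma F r w B p).
Implicit Type i : 'I_n.+2.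

Lemma arel_atest P f x i a' :
  ar (atest P) (f, x, i) a' <-> P f (input_sym w i) /\ a' = (f, x, i).
Proof.
split=> [[f' [e [/and3P[HP /eqP -> /eqP ->] ->]]]|[HP ->]].
  by rewrite hmove_stay.
by exists f, Stay; rewrite HP !eqxx hmove_stay.
Qed.

Lemma arel_ahead d f x i a' : ar (ahead d) (f, x, i) a' <-> a' = (f, x, hmove d i).
Proof.
split=> [[f' [e [/andP[/eqP -> /eqP ->] ->]]]|->] //.
by exists f, d; rewrite !eqxx.
Qed.

Lemma arel_arewind f x i a' : ar arewind (f, x, i) a' <-> a' = (f, x, ord0).
Proof.
split=> [/arel_seq[a1 /arel_star S]|->].
  have [i' ->] : exists i', a1 = (f, x, i').
    apply: (star_inv (I := fun a => exists i', a = (f, x, i'))) S; last by exists i.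
    move=> u v [i' ->] /arel_seq[u1 /arel_atest[_ ->] /arel_ahead ->].
    by exists (hmove Minus i').
  move=> /arel_atest[]; rewrite input_sym_eq_lmark => /eqP i0 ->.
  by congr (_, _); exact: val_inj.
apply/arel_seq; exists (f, x, ord0); last exact/arel_atest.
apply/arel_star; move Ek: (nat_of_ord i) => k; elim: k i Ek => [|k IH] i Ek.
  by rewrite (_ : i = ord0); [exact: rtn1_refl | exact: val_inj].
apply: (star_cons (y := (f, x, hmove Minus i))).
  apply/arel_seq; exists (f, x, i); last exact/arel_ahead.
  by apply/arel_atest; rewrite input_sym_eq_lmark Ek.
apply: IH; rewrite val_hmove /move_head Ek /=.
by have := ltn_ord i; lia.
Qed.

Section Read.
Variables (j : 'I_m) (x : regs).
Hypothesis x0 : x scratch = 0.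
Notation X := (x (reg j)).

Lemma reg_scratch : reg j != scratch.
Proof. by rewrite eq_sym neq_lift. Qed.

Notation moving := (upd2 (reg j) scratch x).

Definition moving_reg := upd2_fst x reg_scratch.
Definition moving_scratch := upd2_snd (reg j) scratch x.
Definition upd_moving_reg := upd_upd2_fst x reg_scratch.
Definition upd_moving_scratch := upd_upd2_snd (reg j) scratch x.

Lemma moving_id : moving X 0 = x.
Proof. by rewrite upd2_zero ?reg_scratch // upd_id. Qed.

(** The input head stops at the right endmarker while the register counts on; by [sym_pos_at] it
    still reads what the rover's head sees. *)
Definition pos_at (k : nat) : 'I_n.+2 := inord (minn k n.+1).

Lemma hmove_pos_at k : hmove Plus (pos_at k) = pos_at k.+1.
Proof.
apply: val_inj; rewrite /= val_hmove /pos_at !inordK /move_head /=; lia.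
Qed.

Lemma pos_at0 : pos_at 0 = ord0.
Proof. by apply: val_inj; rewrite /= inordK. Qed.

Lemma sym_pos_at k : input_sym w (pos_at k) = input_sym w k.
Proof. by rewrite /pos_at inordK ?input_sym_minn //; lia. Qed.

Lemma aread_sound f i a' : ar (aread j) (f, x, i) a' ->
  exists i', a' = (record_sym j (input_sym w X) f, x, i').
Proof.
move=> /arel_seq[a1 /arel_arewind-> /arel_seq[a2 /arel_star S2]].
have [k lek ->] : exists2 k, k <= X & a2 = (f, moving (X - k) k, pos_at k).
  apply: (star_inv (I := fun a => exists2 k, k <= X &
    a = (f, moving (X - k) k, pos_at k))) S2; last first.
    by exists 0; rewrite // subn0 moving_id pos_at0.
  move=> u v [k lek ->] /arel_seq[u1 [-> pos]].
  rewrite upd_moving_reg moving_reg in pos *.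
  move=> /arel_seq[u2 [-> _] /arel_ahead ->].
  rewrite moving_scratch upd_moving_scratch hmove_pos_at.
  by exists k.+1; [lia | rewrite -subnS].
move=> /arel_seq[a3 [-> E]]; rewrite moving_reg in E.
have {E} kE : k = X by lia.
rewrite {}kE subnn {lek k} => /arel_seq[a4 [f' [e [/andP[/eqP -> /eqP ->] ->]]]].
rewrite sym_pos_at hmove_stay; set f1 := record_sym _ _ _.
move=> /arel_seq[a5 /arel_star S5].
have [k lek ->] : exists2 k, k <= X & a5 = (f1, moving k (X - k), pos_at X).
  apply: (star_inv (I := fun a => exists2 k, k <= X &
    a = (f1, moving k (X - k), pos_at X))) S5; last by exists 0; rewrite ?subn0.
  move=> u v [k lek ->] /arel_seq[u1 [-> pos] [-> _]].
  rewrite upd_moving_scratch !moving_scratch in pos *.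
  rewrite moving_reg upd_moving_reg; exists k.+1; [lia|].
  by rewrite -subnS.
move=> [-> E]; rewrite moving_scratch in E; exists (pos_at X).
by rewrite (_ : k = X) ?subnn ?moving_id //; lia.
Qed.

Lemma aread_complete f i : X < B ->
  exists i', ar (aread j) (f, x, i) (record_sym j (input_sym w X) f, x, i').
Proof.
move=> ltX; exists (pos_at X); apply/arel_seq; exists (f, x, ord0); first exact/arel_arewind.
apply/arel_seq; exists (f, moving 0 X, pos_at X).
  apply/arel_star; suff H k : k <= X ->
      star (ar (ASeq (ADecr Sigma F (reg j)) (ASeq (AIncr Sigma F scratch) (ahead Plus))))
        (f, x, ord0) (f, moving (X - k) k, pos_at k).
    by have := H X (leqnn _); rewrite subnn.
  elim: k => [|k IH] lek; first by rewrite subn0 moving_id pos_at0; exact: rtn1_refl.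
  apply: rtn1_trans (IH (ltnW lek)); apply/arel_seq.
  exists (f, moving (X - k.+1) k, pos_at k).
    by split; rewrite ?moving_reg ?upd_moving_reg -?subnS; [|lia].
  apply/arel_seq; exists (f, moving (X - k.+1) k.+1, pos_at k); last first.
    by apply/arel_ahead; rewrite hmove_pos_at.
  by split; rewrite moving_scratch ?upd_moving_scratch; [|lia].
apply/arel_seq; exists (f, moving 0 X, pos_at X); first by split; rewrite ?moving_reg.
set f1 := record_sym _ _ _.
apply/arel_seq; exists (f1, moving 0 X, pos_at X).
  by exists f1, Stay; rewrite sym_pos_at !eqxx hmove_stay.
apply/arel_seq; exists (f1, x, pos_at X); last by split.
apply/arel_star; suff H k : k <= X ->
    star (ar (ASeq (ADecr Sigma F scratch) (AIncr Sigma F (reg j))))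
      (f1, moving 0 X, pos_at X) (f1, moving k (X - k), pos_at X).
  by have := H X (leqnn _); rewrite subnn moving_id.
elim: k => [|k IH] lek; first by rewrite subn0; exact: rtn1_refl.
apply: rtn1_trans (IH (ltnW lek)); apply/arel_seq.
exists (f1, moving k (X - k.+1), pos_at X).
  by split; rewrite ?moving_scratch ?upd_moving_scratch -?subnS; [|lia].
by split; rewrite moving_reg ?upd_moving_reg; [|lia].
Qed.

End Read.

Definition recorded (js : seq 'I_m) x f : F :=
  (f.1.1, [ffun k => if k \in js then input_sym w (x (reg k)) else f.1.2 k], f.2).

Lemma recorded_nil x f : recorded [::] x f = f.
Proof.
case: f => [[q o] mv]; congr (_, _, _).
by apply/ffunP => k; rewrite ffunE.
Qed.

Lemma recorded_cons j js x f :
  recorded js x (record_sym j (input_sym w (x (reg j))) f) = recorded (j :: js) x f.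
Proof.
congr (_, _, _); apply/ffunP => k; rewrite !ffunE in_cons.
by case: (k \in js); case: eqP => //= ->.
Qed.

Lemma areads_sound js f x i a' : x scratch = 0 ->
  ar (aseqs [seq aread j | j <- js]) (f, x, i) a' ->
  exists i', a' = (recorded js x f, x, i').
Proof.
move=> x0; elim: js f i => [|j js IH] f i.
  by move=> /arel_atest[_ ->]; exists i; rewrite recorded_nil.
move=> /arel_seq[a1 /(aread_sound x0)[i1 ->] /IH[i' ->]].
by exists i'; rewrite recorded_cons.
Qed.

Lemma areads_complete js f x i : x scratch = 0 -> (forall k, x k < B) ->
  exists i', ar (aseqs [seq aread j | j <- js]) (f, x, i) (recorded js x f, x, i').
Proof.
move=> x0 ltx; elim: js f i => [|j js IH] f i.
  by exists i; rewrite recorded_nil; apply/arel_atest.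
have [i1 H1] := aread_complete x0 f i (ltx (reg j)).
have [i2 H2] := IH (record_sym j (input_sym w (x (reg j))) f) i1.
exists i2; apply/arel_seq; exists (record_sym j (input_sym w (x (reg j))) f, x, i1) => //.
by rewrite -recorded_cons.
Qed.

Lemma arel_aupdate j f x i a' :
  ar (aupdate j) (f, x, i) a' <->
  a' = (f, upd x (reg j) (shift (f.2 j) (x (reg j))), i) /\
  (f.2 j = Plus -> (x (reg j)).+1 < B).
Proof.
split.
  move=> /arel_alt[/arel_atest[/eqP E ->]|/arel_alt[/arel_seq[a1]|/arel_seq[a1]]].
  - by rewrite E /= upd_id.
  - by move=> /arel_atest[/eqP E ->] [-> lt]; rewrite E.
  - move=> /arel_atest[/eqP E ->] /arel_alt[[-> x0]|[-> x0]]; rewrite E //=.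
    by rewrite x0 /= -x0 upd_id.
move=> [-> lt]; apply/arel_alt; case E: (f.2 j).
- right; apply/arel_alt; right; apply/arel_seq; exists (f, x, i).
    by apply/arel_atest; rewrite E.
  apply/arel_alt; have [x0|x0] := posnP (x (reg j)).
    by left; split; rewrite //= x0 /= -x0 upd_id.
  by right; split.
- by left; apply/arel_atest; rewrite E /= upd_id.
- right; apply/arel_alt; left; apply/arel_seq; exists (f, x, i).
    by apply/arel_atest; rewrite E.
  by split=> //; exact: lt.
Qed.

Definition emb y : regs := [ffun k => if unlift ord0 k is Some j then y j else 0].

Lemma emb_reg y j : emb y (reg j) = y j.
Proof. by rewrite ffunE liftK. Qed.

Lemma emb_scratch y : emb y scratch = 0.
Proof. by rewrite ffunE unlift_none. Qed.

Lemma upd_emb y j v : upd (emb y) (reg j) v = emb (upd y j v).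
Proof.
apply/ffunP => k; rewrite !ffunE; case: unliftP => [j' ->|->].
  by rewrite ffunE (inj_eq lift_inj).
by rewrite (negPf (neq_lift _ _)).
Qed.

Lemma arel_aupdates js f y i a' : uniq js ->
  ar (aseqs [seq aupdate j | j <- js]) (f, emb y, i) a' <->
  a' = (f, emb [ffun j => if j \in js then shift (f.2 j) (y j) else y j], i) /\
  (forall j, j \in js -> f.2 j = Plus -> (y j).+1 < B).
Proof.
elim: js y a' => [|j js IH] y a'.
  move=> _; have -> : [ffun j => if j \in [::] then shift (f.2 j) (y j) else y j] = y.
    by apply/ffunP => j; rewrite ffunE.
  by split=> [/arel_atest[_ ->]|[-> _]] //; apply/arel_atest.
rewrite cons_uniq => /andP[jjs ujs].
set y1 := upd y j (shift (f.2 j) (y j)).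
have E : [ffun k => if k \in js then shift (f.2 k) (y1 k) else y1 k]
    = [ffun k => if k \in j :: js then shift (f.2 k) (y k) else y k].
  apply/ffunP => k; rewrite !ffunE in_cons; case: (eqVneq k j) => [->|//] /=.
  by rewrite (negPf jjs).
have y1js k : k \in js -> y1 k = y k.
  by move=> kjs; rewrite upd_neq //; apply: contraNneq jjs => <-.
split=> [/arel_seq[a1 /arel_aupdate[-> lt]]|[-> lt]].
  rewrite upd_emb emb_reg -/y1 in lt * => /(IH _ _ ujs); rewrite E => -[-> ltjs]; split=> // k.
  by rewrite in_cons => /predU1P[->//|kjs]; rewrite -y1js //; exact: ltjs.
apply/arel_seq; exists (f, emb y1, i).
  apply/arel_aupdate; rewrite upd_emb emb_reg; split=> //; apply: lt; exact: mem_head.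
apply/(IH _ _ ujs); rewrite E; split=> // k kjs; rewrite y1js //; apply: lt.
by rewrite in_cons kjs orbT.
Qed.

Notation rstep := (aut_step (rover_obs w) (rover_app B) (M := M)).

Lemma recorded_obs y f : recorded (enum 'I_m) (emb y) f = (f.1.1, rover_obs w y, f.2).
Proof.
by congr (_, _, _); apply/ffunP => k; rewrite !ffunE mem_enum liftK.
Qed.

Lemma all_updates y (mv : {ffun 'I_m -> dir}) :
  [ffun j => if j \in enum 'I_m then shift (mv j) (y j) else y j]
  = [ffun j => shift (mv j) (y j)].
Proof. by apply/ffunP => j; rewrite !ffunE mem_enum. Qed.

Lemma around_sound f y i a' : ar around (f, emb y, i) a' ->
  exists f' y' i', a' = (f', emb y', i') /\ rstep (f.1.1, y) (f'.1.1, y').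
Proof.
move=> /arel_seq[a1 /(areads_sound (emb_scratch y))[i1 ->]]; rewrite recorded_obs.
move=> /arel_seq[a2 [f2 [e [/and3P[/= tr /eqP _ /eqP ->] ->]]]].
rewrite hmove_stay => /(arel_aupdates _ _ _ _ (enum_uniq _))[-> lt].
rewrite all_updates; exists f2, [ffun j => shift (f2.2 j) (y j)], i1; split=> //.
by exists f2.2 => //; split=> // j; apply: lt; rewrite mem_enum.
Qed.

Lemma around_complete f y i s' : (forall j, y j < B) -> 0 < B ->
  rstep (f.1.1, y) s' ->
  exists f' i', ar around (f, emb y, i) (f', emb s'.2, i') /\ f'.1.1 = s'.1.
Proof.
case: s' => q' y' lty B0 [mv /= tr [-> lt]].
have [|i1 H1] := areads_complete (enum 'I_m) f i (emb_scratch y).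
  by move=> k; rewrite ffunE; case: unlift.
rewrite recorded_obs in H1.
exists (q', rover_obs w y, mv), i1; split=> //; apply/arel_seq; eexists; first exact: H1.
apply/arel_seq; exists ((q', rover_obs w y, mv), emb y, i1).
  by exists (q', rover_obs w y, mv), Stay; rewrite /= tr !eqxx hmove_stay.
apply/(arel_aupdates _ _ _ _ (enum_uniq _)); rewrite all_updates; split=> // j _.
exact: lt.
Qed.

End Word.

Definition start_F : F := (aut_init M, [ffun=> lmark], [ffun=> Stay]).

Definition rover_counter_prog :=
  Seq (setup_init Sigma F r b) (Seq (Star (halve Sigma F r b))
  (Seq (put_right Sigma F r b) (Seq (go_back Sigma F r b) (realize b (AStar around))))).

Definition rover_counter_aut :=
  compile (@nidle Sigma (option (bool + {ffun 'I_r -> 'I_b.+1}))) start_F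
    (fun f => aut_acc f.1.1) rover_counter_prog.

Definition rover_counter := counter_of None rover_counter_aut.

Lemma rover_counter_logspace : nc_logspace rover_counter.
Proof.
(* With [t] the logarithm, [l <= t + 2] and the head is at most at [l + 2]; the factor 6 is large
   enough also at [t = 0]. *)
exists 6 => w c /nc_reach_star[s S ->].
have [l [le1 le2]] := visits_setup (compile_visits (@ndev_app_idle _ _ w) S).
have : 2 ^ l <= 2 ^ (trunc_log 2 (size w)).+2.
  apply: leq_trans le1 _; rewrite expnS leq_mul2l /=.
  exact: trunc_log_ltn.
rewrite leq_exp2l //= => lel; apply: leq_ltn_trans le2 _.
by move: (trunc_log _ _) lel => t; lia.
Qed.

Lemma represents_start (w : seq Sigma) l :
  represents l (start_F, emb [ffun=> 0], inord 0 : 'I_(size w).+2)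
    (start_F, dv (inord 0) (nseq l ([ffun=> ord0] : {ffun 'I_r -> 'I_b.+1})) 0).
Proof.
exists (nseq l [ffun=> ord0]); split=> //=; first exact: size_nseq.
by move=> k; rewrite value_nseq0 ffunE; case: unlift => // j; rewrite ffunE.
Qed.

Lemma rover_counter_sound w : nc_accepts rover_counter w ->
  exists B, rover_accepts M B w.
Proof.
move=> /counter_of_accepts/(compile_accepts (@ndev_app_idle _ _ w))[s'].
move=> /prel_seq[s1 H1 /prel_seq[s2 H2 /prel_seq[s3 H3 /prel_seq[s4 H4 H5]]]] acc.
have [|l [E ltl]] := @setup_sound Sigma F r b w start_F s4.
  apply/prel_seq; exists s1 => //; apply/prel_seq; exists s2 => //.
  by apply/prel_seq; exists s3.
rewrite {}E in H5; exists (b.+1 ^ l).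
have [a' /arel_star S [ds [_ _ sE]]] := realize_sound (represents_start w l) H5.
have [f [y [i [aE Sy]]]] : exists f y i, a' = (f, emb y, i) /\
    star (aut_step (rover_obs w) (rover_app (b.+1 ^ l)) (M := M))
      (aut_init M, [ffun=> 0]) (f.1.1, y).
  apply: (star_inv (I := fun a => exists f y i, a = (f, emb y, i) /\
    star (aut_step (rover_obs w) (rover_app (b.+1 ^ l)) (M := M))
      (aut_init M, [ffun=> 0]) (f.1.1, y))) S; last first.
    by exists start_F, [ffun=> 0], (inord 0); split=> //; exact: rtn1_refl.
  move=> u v [f [y [i [-> Sy]]]] /around_sound[f' [y' [i' [-> st]]]].
  by exists f', y', i'; split=> //; exact: rtn1_trans Sy.
by exists (f.1.1, y) => //; move: acc; rewrite sE aE.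
Qed.

Lemma rover_counter_complete w :
  rover_accepts M ((size w).+2 ^ K) w -> nc_accepts rover_counter w.
Proof.
move=> accB; apply/counter_of_accepts/(compile_accepts (@ndev_app_idle _ _ w)).
have [l [R ltl]] := @setup_complete Sigma F r b w start_F.
set B := b.+1 ^ l.
have leB : (size w).+2 ^ K <= B.
  apply: (@leq_trans ((2 ^ l) ^ K)).
    by case: (K) => // k; rewrite leq_exp2r.
  rewrite -expnM mulnC expnM /B.
  by case: (l) => // k; rewrite leq_exp2r.
have B0 : 0 < B by rewrite expn_gt0.
have [s S acc] := rover_accepts_leq leB accB.
have [lts [f [i [Sa fE]]]] : (forall j, s.2 j < B) /\ exists f i,
    star (arel B around) (start_F, emb [ffun=> 0], inord 0 : 'I_(size w).+2)
      (f, emb s.2, i) /\ f.1.1 = s.1.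
  elim: S => [|u v st _ [ltu [f [i [Sa fE]]]]].
    split=> [j|]; first by rewrite ffunE.
    by exists start_F, (inord 0); split=> //; exact: rtn1_refl.
  have st' := st; rewrite [u]surjective_pairing -fE in st'.
  have [f' [i' [H f'E]]] := around_complete i ltu B0 st'.
  split=> [j|]; last by exists f', i'; split=> //; exact: rtn1_trans Sa.
  have [mv _ [-> lt]] := st; rewrite ffunE.
  have := ltu j; have := lt j; case: (mv j) => //= [_|/(_ erefl)//]; lia.
have Ra : arel B (AStar around) (start_F, emb [ffun=> 0], inord 0 : 'I_(size w).+2)
    (f, emb s.2, i) by apply/arel_star.
have [s' Rs [ds [_ _ sE]]] := realize_complete (represents_start w l) Ra.
exists s'; last by rewrite sE /= fE.
move: R => /prel_seq[s1 H1 /prel_seq[s2 H2 /prel_seq[s3 H3 H4]]].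
apply/prel_seq; exists s1 => //; apply/prel_seq; exists s2 => //.
by apply/prel_seq; exists s3 => //; apply/prel_seq; eexists; first exact: H4.
Qed.

End RoverToCounter.

Theorem rover_Aux2NC (Sigma : finType) (L : language Sigma) :
  rover_class L -> Aux2NC L.
Proof.
move=> [m [M [K HM]]]; exists (rover_counter M K); split.
  exact: rover_counter_logspace.
move=> w; have [HL1 HL2] := HM w; split=> [/HL2/rover_counter_complete//|].
by move=> /rover_counter_sound[B /HL1].
Qed.

(** * Rovers simulate counter automata *)

Section OneCounter.
Variable X : finType.

Definition ostep (e : bool -> dir -> rel X) (s s' : X * nat) : Prop :=
  exists d, [/\ e (s.2 == 0) d s.1 s'.1, d = Minus -> 0 < s.2 & s'.2 = shift d s.2].

Definition ostep_le (e : bool -> dir -> rel X) (H : nat) (s s' : X * nat) : Prop :=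
  ostep e s s' /\ s'.2 <= H.

Lemma star_ostep_le e H H' s s' : H <= H' ->
  star (ostep_le e H) s s' -> star (ostep_le e H') s s'.
Proof.
move=> leH; apply: (star_map (f := id)) => u v [st le]; split=> //.
exact: leq_trans leH.
Qed.

Section Balanced.
Variable e : bool -> dir -> rel X.

(* One more nesting level of the runs that start and end at the same positive
   counter value and never go below it. *)
Definition extend_balanced (R : {set X * X}) : {set X * X} :=
  [set xy | (xy.1 == xy.2) ||
    [exists y, ((xy.1, y) \in R) &&
      (e false Stay y xy.2 ||
       [exists u, exists v, [&& e false Plus y u, (u, v) \in R & e false Minus v xy.2]])]].

Lemma extend_balanced_mono : {homo extend_balanced : R S / R \subset S}.
Proof.
move=> R S /subsetP RS; apply/subsetP => -[x z]; rewrite !inE => /orP[->//|].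
case/existsP=> y /andP[/RS xy H]; apply/orP; right; apply/existsP; exists y.
rewrite xy /=; case/orP: H => [->//|/existsP[u /existsP[v /and3P[yu /RS uv vz]]]].
apply/orP; right; apply/existsP; exists u; apply/existsP; exists v.
by rewrite yu uv vz.
Qed.

Definition balanced : {set X * X} := fixset extend_balanced.

Lemma balanced_refl x : (x, x) \in balanced.
Proof. by rewrite /balanced -(fixsetK extend_balanced_mono) inE eqxx. Qed.

Lemma balanced_stay x y z : (x, y) \in balanced -> e false Stay y z ->
  (x, z) \in balanced.
Proof.
move=> xy yz; rewrite /balanced -(fixsetK extend_balanced_mono) inE.
by apply/orP; right; apply/existsP; exists y; rewrite /= [_ \in _]xy yz.
Qed.

Lemma balanced_nest x y u v z : (x, y) \in balanced -> e false Plus y u ->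
  (u, v) \in balanced -> e false Minus v z -> (x, z) \in balanced.
Proof.
move=> xy yu uv vz; rewrite /balanced -(fixsetK extend_balanced_mono) inE.
apply/orP; right; apply/existsP; exists y; rewrite /= [_ \in _]xy /=.
apply/orP; right; apply/existsP; exists u; apply/existsP; exists v.
by rewrite yu vz andbT; exact: uv.
Qed.

Lemma iter_balanced_run k x y l :
  (x, y) \in iter k extend_balanced set0 -> 0 < l ->
  star (ostep_le e (l + k)) (x, l) (y, l).
Proof.
elim: k x y l => [|k IH] x y l; first by rewrite inE.
rewrite /= inE => /orP[/eqP/= -> _|/existsP[z /andP[/IH xz H]] l0]; first exact: rtn1_refl.
have {}xz : star (ostep_le e (l + k.+1)) (x, l) (z, l).
  by apply: star_ostep_le (xz _ l0); lia.
case/orP: H => [zy|/existsP[u /existsP[v /and3P[zu /IH uv vy]]]].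
  apply: rtn1_trans xz; split=> /=; last by lia.
  by exists Stay; split=> //=; rewrite gtn_eqF.
apply: rtn1_trans (star_trans xz (star_cons _ (_ : star _ (u, l.+1) (v, l.+1)))).
- split=> /=; last by lia.
  by exists Minus; split.
- split=> /=; last by lia.
  by exists Plus; split=> //=; rewrite gtn_eqF.
- by rewrite addnS -addSn; exact: uv.
Qed.

Notation H := (#|{: X * X}|.+1).

(** [fixset] is the iterate of order [#|{: X * X}|] from the empty set; this number, on top of the
    base level 1, is the height [H]. *)
Lemma balanced_run x y : (x, y) \in balanced -> star (ostep_le e H) (x, 1) (y, 1).
Proof. by move=> xy; have := iter_balanced_run xy (ltn0Sn 0). Qed.

Variable x0 : X.
Definition low_reach (s : X * nat) := star (ostep_le e H) (x0, 0) s.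

(* The pending increments of a run: each was followed by a balanced run. *)
Inductive stacked : X -> nat -> Prop :=
| StackedZero x of low_reach (x, 0) : stacked x 0
| StackedOne x u y of low_reach (x, 0) & e true Plus x u & (u, y) \in balanced :
    stacked y 1
| StackedUp x u y c of stacked x c.+1 & e false Plus x u & (u, y) \in balanced :
    stacked y c.+2.

Lemma stacked_extend x c y : stacked x c.+1 ->
  (forall u, (u, x) \in balanced -> (u, y) \in balanced) -> stacked y c.+1.
Proof.
move E: c.+1 => k S; case: S E => // [z u v Hz zu /[swap] _ uv K|z u v k' Hz zu uv _ K].
  by apply: StackedOne Hz zu _; exact: K.
by apply: StackedUp Hz zu _; exact: K.
Qed.

(** A decrement closes the topmost pending increment. Above level 1 the closed piece is merged into
    the balanced run below it; at level 1 it is an excursion from 0, replaced by one of height at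
    most [H]. Heights are thus controlled for completed excursions, that is, whenever the counter is
    back at 0. *)
Lemma reach_stacked s : star (ostep e) (x0, 0) s -> stacked s.1 s.2.
Proof.
elim=> [|[x c] [y c'] [d /= [exy dpos ->]] _ S]; first by apply: StackedZero; exact: rtn1_refl.
case: d exy dpos => /= exy dpos.
- case: c S dpos exy => [|c] S dpos exy; first by have := dpos erefl.
  move Ek: c.+1 S => k S; case: S Ek exy => // [z u v Hz zu uv [->]|z u v k' Hz zu uv [->]] exy.
    apply: StackedZero; apply: rtn1_trans (star_trans Hz (star_cons _ (balanced_run uv))).
      by split=> //; exists Minus; split.
    by split=> //; exists Plus; split.
  apply: stacked_extend Hz _ => u' u'z; exact: balanced_nest u'z zu uv exy.
- case: c S exy {dpos} => [|c] S exy.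
    apply: StackedZero; inversion_clear S.
    apply: rtn1_trans; last eassumption.
    by split=> //; exists Stay; split.
  by apply: stacked_extend S _ => u ux; exact: balanced_stay ux exy.
- case: c S exy {dpos} => [|c] S exy.
    by inversion_clear S; apply: StackedOne exy (balanced_refl _).
  exact: StackedUp S exy (balanced_refl _).
Qed.

End Balanced.

(** Since [stacked] yields a low run only at counter 0, decrementing loops are added at the target
    [x] to get there. In the low run so obtained the first added move starts at [x], and the part
    before it uses moves of [e] only. *)
Lemma bounded_counter e x0 x c : star (ostep e) (x0, 0) (x, c) ->
  exists c', star (ostep_le e #|{: X * X}|.+1) (x0, 0) (x, c').
Proof.
move=> S; pose e' z d u v := e z d u v || [&& ~~ z, d == Minus, u == x & v == x].
have S' : star (ostep e') (x0, 0) (x, 0).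
  have {}S : star (ostep e') (x0, 0) (x, c).
    apply: (star_map (f := id)) S => u v [d [H1 H2 H3]]; exists d; split=> //.
    by rewrite /e' H1.
  elim: c S => // c IH S; apply: IH; apply: rtn1_trans S.
  by exists Minus; split=> //=; rewrite /e' !eqxx orbT.
have R : low_reach e' x0 (x, 0) by have St := reach_stacked S'; inversion_clear St.
set H := #|{: X * X}|.+1 in R *.
have [R'|//] : star (ostep_le e H) (x0, 0) (x, 0) \/
    exists c', star (ostep_le e H) (x0, 0) (x, c'); last by exists 0.
apply: (star_inv (I := fun s => star (ostep_le e H) (x0, 0) s \/
    exists c', star (ostep_le e H) (x0, 0) (x, c'))) R; last by left; exact: rtn1_refl.
move=> u v [Su|?] [[d [/orP[euv|/and4P[_ _ /eqP ux _]] Hd vE] le]]; try by right.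
  by left; apply: rtn1_trans Su; split=> //; exists d.
by right; exists u.2; rewrite -ux -surjective_pairing.
Qed.

End OneCounter.

(** * Configurations without the counter value, finitely many for a word *)

Section Surfaces.
Variables (Sigma : finType) (N : counter_automaton Sigma) (w : seq Sigma) (L : nat).
Hypothesis pos_lt : forall c : nc_conf N, nc_reach w c -> nc_pos c < L.
Notation n := (size w).
Notation surface := (nc_state N * 'I_n.+2 * {ffun 'I_L -> nc_work N} * 'I_L)%type.
Notation move := (nc_state N * nc_work N * dir * dir * dir)%type.

Definition tape_of (T : {ffun 'I_L -> nc_work N}) (j : nat) : nc_work N :=
  if insub j is Some i then T i else nc_blank N.

Definition surface_conf (s : surface * nat) : nc_conf N :=
  NcConf s.1.1.1.1 s.1.1.1.2 (tape_of s.1.1.2) s.1.2 s.2.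

Definition surface_rel (z : bool) (d : dir) : rel surface := fun x y =>
  [exists t : move, [&&
    t \in nc_trans x.1.1.1 (input_sym w x.1.1.2) (x.1.2 x.2) z, t.2 == d,
    y.1.1.1 == t.1.1.1.1, y.1.1.2 == move_head w t.1.1.2 x.1.1.2 :> nat,
    y.1.2 == [ffun j => if j == x.2 then t.1.1.1.2 else x.1.2 j] &
    y.2 == shift t.1.2 x.2 :> nat]].

Definition nc_step_le (H : nat) (c c' : nc_conf N) : Prop :=
  nc_step w c c' /\ nc_ctr c' <= H.

Lemma tape_of_ord T (j : 'I_L) : tape_of T j = T j.
Proof. by rewrite /tape_of valK. Qed.

Lemma tape_of_write T (p : 'I_L) g :
  (fun i => if i == p :> nat then g else tape_of T i) =
  tape_of [ffun j => if j == p then g else T j].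
Proof.
apply: functional_extensionality => i; rewrite /tape_of.
case: insubP => [j _ <-|]; first by rewrite ffunE.
by case: eqP => // ->; rewrite ltn_ord.
Qed.

Lemma surface_rel_step s s' : ostep surface_rel s s' ->
  nc_step w (surface_conf s) (surface_conf s').
Proof.
case: s s' => [[[[q i] T] p] c] [[[[q' i'] T'] p'] c'].
move=> [d [/existsP[[[[[q1 g] di] dw] dc]]] /=].
move=> /and5P[tr /eqP/= dcE /eqP/= -> /eqP/= iE /andP[/eqP/= -> /eqP/= pE]] dpos ->.
subst d; have := @NcStep _ N w (surface_conf (q, i, T, p, c)) q1 g di dw dc.
rewrite /surface_conf /= tape_of_ord tape_of_write iE pE; apply=> //.
Qed.

Hypothesis L_gt0 : 0 < L.

Definition surface0 : surface :=
  (nc_init N, ord0, [ffun=> nc_blank N], Ordinal L_gt0).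

Lemma surface_conf0 : surface_conf (surface0, 0) = nc_start N.
Proof.
rewrite /surface_conf /nc_start /=; congr NcConf.
apply: functional_extensionality => i; rewrite /tape_of.
by case: insub => // j; rewrite ffunE.
Qed.

Lemma reach_surface c : nc_reach w c ->
  exists2 s, star (ostep surface_rel) (surface0, 0) s & c = surface_conf s.
Proof.
elim=> [|{}c c' Rc [s S cE] st].
  by exists (surface0, 0); [exact: rtn1_refl | rewrite surface_conf0].
have := pos_lt (NcReachS Rc st); case: st => q g di dw dc /= tr dpos pos'.
case: s S cE => [[[[q0 i] T] p] k] S cE; rewrite {}cE /= in tr dpos pos' *.
pose T' := [ffun j => if j == p then g else T j].
pose i' : 'I_n.+2 := inord (move_head w di i).
have iE : i' = move_head w di i :> nat by rewrite inordK // /move_head; lia.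
exists ((q, i', T', Ordinal pos'), shift dc k).
  apply: rtn1_trans S; exists dc; split=> //=; apply/existsP; exists (q, g, di, dw, dc).
  by rewrite /= !eqxx iE eqxx -tape_of_ord tr.
by rewrite /surface_conf /= iE tape_of_write.
Qed.

Lemma nc_accepts_le : nc_accepts N w ->
  exists2 c, star (nc_step_le #|{: surface * surface}|.+1) (nc_start N) c
           & nc_acc (nc_q c).
Proof.
move=> [c /reach_surface[[x k] S ->] acc].
have [k' S'] := bounded_counter S; exists (surface_conf (x, k')) => //.
rewrite -surface_conf0; apply: (star_map (f := surface_conf)) S' => u v [st le].
by split=> //; exact: surface_rel_step.
Qed.

End Surfaces.

(** * Stacks coded in registers *)

Section StackRegisters.
Variables (Sigma Wk Q : finType) (blank : Wk) (m : nat) (tmp : 'I_m).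
Notation F := (Q * Wk * dir)%type.
Notation regs := {ffun 'I_m -> nat}.
Notation obs := {ffun 'I_m -> marked Sigma}.
Notation cmd := {ffun 'I_m -> dir}.
Notation prg := (prog obs cmd F).
Notation idle := (@rover_idle Sigma m).
Implicit Types (f : F) (x : regs) (j : 'I_m) (g : Wk).

Definition base : nat := #|Wk|.+1.
(** The blank has digit 0, so that the unvisited part of the tape adds nothing to a stack; the other
    symbols have positive digits below [base]. *)
Definition code g : nat := if g == blank then 0 else (enum_rank g).+1.

Lemma code_blank : code blank = 0.
Proof. by rewrite /code eqxx. Qed.

Lemma code_lt g : code g < base.
Proof. by rewrite /code /base; case: eqP => // _; rewrite ltnS. Qed.

Lemma code_inj : injective code.
Proof.
move=> g g'; rewrite /code; case: eqP => [->|_]; case: eqP => [->|_] // [E].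
by apply: enum_rank_inj; exact: val_inj.
Qed.

Lemma push_inj k g k' g' : k * base + code g = k' * base + code g' -> k = k' /\ g = g'.
Proof.
move=> E; have gE : g = g'.
  apply: code_inj; have := congr1 (modn^~ base) E.
  by rewrite !modnMDl !modn_small // code_lt.
split=> //; move: E; rewrite gE => /addIn/eqP.
by rewrite eqn_pmul2r // => /eqP.
Qed.

Definition rinc j : prg :=
  Atom (fun f (o : obs) f' (c : cmd) =>
    (f' == f) && (c == [ffun k => if k == j then Plus else Stay])).
Definition rdec j : prg :=
  Atom (fun f (o : obs) f' (c : cmd) =>
    [&& f' == f, o j != lmark & c == [ffun k => if k == j then Minus else Stay]]).
Definition rzero j : prg :=
  Atom (fun f (o : obs) f' (c : cmd) =>
    [&& f' == f, o j == lmark & c == idle o]).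
Definition rtest (P : pred F) : prg :=
  Atom (fun f (o : obs) f' (c : cmd) =>
    [&& P f, f' == f & c == idle o]).
Definition rset g : prg :=
  Atom (fun f (o : obs) f' (c : cmd) =>
    (f' == (f.1.1, g, f.2)) && (c == idle o)).
Definition rtimes k (p : prg) : prg := iter k (Seq p) (rtest predT).
Definition ralts (T : Type) (p : T -> prg) (s : seq T) : prg :=
  foldr (fun a => Alt (p a)) (rtest pred0) s.

Definition pour j : prg := Seq (Star (Seq (rdec tmp) (rinc j))) (rzero tmp).

Definition push j : prg :=
  Seq (Star (Seq (rdec j) (rtimes base (rinc tmp))))
  (Seq (rzero j)
  (Seq (ralts (fun g => Seq (rtest (fun f => f.1.2 == g)) (rtimes (code g) (rinc tmp)))
          (enum Wk))
       (pour j))).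

(** Division by [base] with guessed quotient and digit: a wrong guess blocks a decrement or leaves
    [j] positive at the test [rzero]. The quotient is collected in [tmp] and poured back. *)
Definition pop j : prg :=
  Seq (Star (Seq (rtimes base (rdec j)) (rinc tmp)))
  (Seq (ralts (fun g => Seq (rtimes (code g) (rdec j)) (rset g)) (enum Wk))
  (Seq (rzero j) (pour j))).

Variables (w : seq Sigma) (B : nat).
Notation rel p := (prel (@rover_obs Sigma m w) (@rover_app m B) (p : prg)).

Lemma shift_one d j x :
  [ffun k => shift ([ffun k => if k == j then d else Stay] k) (x k)] = upd x j (shift d (x j)).
Proof. by apply/ffunP => k; rewrite !ffunE; case: eqP => // ->. Qed.

Lemma rel_rinc j f x s' :
  rel (rinc j) (f, x) s' <-> s' = (f, upd x j (x j).+1) /\ (x j).+1 < B.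
Proof.
case: s' => f' x'; split=> [[c /andP[/eqP/= -> /eqP ->] [-> H]]|[[-> ->] H]].
  by rewrite shift_one; split=> //; apply: H; rewrite ffunE eqxx.
exists [ffun k => if k == j then Plus else Stay]; first by rewrite /= !eqxx.
by split=> [|k]; [rewrite shift_one | rewrite ffunE; case: eqP => // ->].
Qed.

Lemma rel_rdec j f x s' :
  rel (rdec j) (f, x) s' <-> s' = (f, upd x j (x j).-1) /\ 0 < x j.
Proof.
case: s' => f' x'; split=> [[c /and3P[/eqP/= -> + /eqP ->] [-> _]]|[[-> ->] H]].
  by rewrite shift_one ffunE input_sym_eq_lmark -lt0n.
exists [ffun k => if k == j then Minus else Stay].
  by rewrite /= !eqxx ffunE input_sym_eq_lmark -lt0n H.
by split=> [|k]; [rewrite shift_one | rewrite ffunE; case: eqP].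
Qed.

Lemma rel_idle x x' : rover_app B (idle (rover_obs w x)) x x' <-> x' = x.
Proof. exact: rover_app_idle. Qed.

Lemma rel_rzero j f x s' : rel (rzero j) (f, x) s' <-> s' = (f, x) /\ x j = 0.
Proof.
case: s' => f' x'; split=> [[c /and3P[/eqP/= -> + /eqP ->] /rel_idle ->]|[[-> ->] H]].
  by rewrite ffunE input_sym_eq_lmark => /eqP.
exists (idle (rover_obs w x)); last exact/rel_idle.
by rewrite /= !eqxx ffunE H.
Qed.

Lemma rel_rtest P f x s' : rel (rtest P) (f, x) s' <-> s' = (f, x) /\ P f.
Proof.
case: s' => f' x'; split=> [[c /and3P[Pf /eqP/= -> /eqP ->] /rel_idle ->]|[[-> ->] H]] //.
exists (idle (rover_obs w x)); last exact/rel_idle.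
by rewrite /= !eqxx H.
Qed.

Lemma rel_rset g f x s' : rel (rset g) (f, x) s' <-> s' = ((f.1.1, g, f.2), x).
Proof.
case: s' => f' x'; split=> [[c /andP[/eqP/= -> /eqP ->] /rel_idle ->]|[-> ->]] //.
exists (idle (rover_obs w x)); last exact/rel_idle.
by rewrite /= !eqxx.
Qed.

Lemma rel_incs k j f x s' : rel (rtimes k (rinc j)) (f, x) s' <->
  s' = (f, upd x j (x j + k)) /\ (0 < k -> x j + k < B).
Proof.
elim: k x s' => [|k IH] x s'.
  split=> [/rel_rtest[-> _]|[-> _]]; first by rewrite addn0 upd_id.
  by apply/rel_rtest; rewrite addn0 upd_id.
split=> [/prel_seq[s1 /rel_rinc[-> H] /IH[-> H']]|[-> H]].
  rewrite upd_at upd_upd addSnnS in H' *; split=> // _.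
  by case: (k) H' => [|k'] H'; [rewrite addn1 | exact: H'].
apply/prel_seq; exists (f, upd x j (x j).+1).
  by apply/rel_rinc; split=> //; have := H erefl; lia.
by apply/IH; rewrite upd_at upd_upd addSnnS; split=> // _; exact: H.
Qed.

Lemma rel_decs k j f x s' : rel (rtimes k (rdec j)) (f, x) s' <->
  s' = (f, upd x j (x j - k)) /\ k <= x j.
Proof.
elim: k x s' => [|k IH] x s'.
  split=> [/rel_rtest[-> _]|[-> _]]; first by rewrite subn0 upd_id.
  by apply/rel_rtest; rewrite subn0 upd_id.
have E : 0 < x j -> (x j).-1 - k = x j - k.+1 by lia.
split=> [/prel_seq[s1 /rel_rdec[-> H] /IH[-> H']]|[-> H]].
  by rewrite upd_at upd_upd E // in H' *; split=> //; lia.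
apply/prel_seq; exists (f, upd x j (x j).-1).
  by apply/rel_rdec; split=> //; lia.
by apply/IH; rewrite upd_at upd_upd E; [split=> //|]; lia.
Qed.

Lemma rel_ralts (T : eqType) (p : T -> prg) (s : seq T) u v :
  rel (ralts p s) u v <-> exists2 a, a \in s & rel (p a) u v.
Proof.
elim: s => [|a s IH]; first by case: u => f x; split=> [/rel_rtest[]|[]].
split=> [/prel_alt[H|/IH[a' sa' H]]|[a']].
- by exists a; rewrite ?mem_head.
- by exists a'; rewrite // in_cons sa' orbT.
rewrite in_cons => /predU1P[-> H|sa' H]; apply/prel_alt; [by left | right].
by apply/IH; exists a'.
Qed.

Section TwoRegisters.
Variables (j : 'I_m) (x : regs).
Hypothesis jt : j != tmp.
Hypothesis xt : x tmp = 0.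
Notation moving := (upd2 j tmp x).
Notation X := (x j).

Lemma upd2_self : moving X 0 = x.
Proof. by rewrite upd2_zero // upd_id. Qed.

Lemma rel_pour_sound f v s' : rel (pour j) (f, moving 0 v) s' -> s' = (f, upd x j v).
Proof.
move=> /prel_seq[s1 /prel_star S].
have [k lek ->] : exists2 k, k <= v & s1 = (f, moving k (v - k)).
  apply: (star_inv (I := fun s => exists2 k, k <= v & s = (f, moving k (v - k)))) S;
    last by exists 0; rewrite ?subn0.
  move=> u u' [k lek ->] /prel_seq[u1 /rel_rdec[-> pos] /rel_rinc[-> _]].
  rewrite upd_upd2_snd upd2_snd in pos *; rewrite upd2_fst // upd_upd2_fst //.
  by exists k.+1; [lia | rewrite -subnS].
move=> /rel_rzero[->]; rewrite upd2_snd => E.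
by rewrite (_ : k = v) ?subnn ?upd2_zero //; lia.
Qed.

Lemma rel_pour_complete f v : v < B -> rel (pour j) (f, moving 0 v) (f, upd x j v).
Proof.
move=> ltv; rewrite -(upd2_zero _ _ xt) //; apply/prel_seq.
exists (f, moving v 0); last by apply/rel_rzero; rewrite upd2_snd.
apply/prel_star; suff H k : k <= v ->
    star (rel (Seq (rdec tmp) (rinc j))) (f, moving 0 v) (f, moving k (v - k)).
  by have := H v (leqnn _); rewrite subnn.
elim: k => [|k IH] lek; first by rewrite subn0; exact: rtn1_refl.
apply: rtn1_trans (IH (ltnW lek)); apply/prel_seq; exists (f, moving k (v - k.+1)).
  by apply/rel_rdec; rewrite upd2_snd upd_upd2_snd -subnS; split=> //; lia.
by apply/rel_rinc; rewrite upd2_fst // upd_upd2_fst //; split=> //; lia.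
Qed.

Lemma rel_push_sound f s' : rel (push j) (f, x) s' ->
  s' = (f, upd x j (X * base + code f.1.2)).
Proof.
move=> /prel_seq[s1 /prel_star S].
have [k lek ->] : exists2 k, k <= X & s1 = (f, moving (X - k) (k * base)).
  apply: (star_inv (I := fun s => exists2 k, k <= X &
    s = (f, moving (X - k) (k * base)))) S; last first.
    by exists 0; rewrite // subn0 upd2_self.
  move=> u u' [k lek ->] /prel_seq[u1 /rel_rdec[-> pos] /rel_incs[-> _]].
  rewrite upd_upd2_fst // upd2_fst // in pos *; rewrite upd2_snd upd_upd2_snd.
  by exists k.+1; [lia | rewrite -subnS mulSn addnC].
move=> /prel_seq[s2 /rel_rzero[-> E]]; rewrite upd2_fst // in E.
rewrite (_ : k = X) ?subnn; last by lia.
move=> /prel_seq[s3 /rel_ralts[g _ /prel_seq[s4 /rel_rtest[-> /eqP gE] /rel_incs[-> _]]]].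
by rewrite upd2_snd upd_upd2_snd gE => /rel_pour_sound ->.
Qed.

Lemma rel_push_complete f : X * base + code f.1.2 < B ->
  rel (push j) (f, x) (f, upd x j (X * base + code f.1.2)).
Proof.
move=> ltB; apply/prel_seq; exists (f, moving 0 (X * base)).
  apply/prel_star; suff H k : k <= X ->
      star (rel (Seq (rdec j) (rtimes base (rinc tmp)))) (f, x) (f, moving (X - k) (k * base)).
    by have := H X (leqnn _); rewrite subnn.
  elim: k => [|k IH] lek; first by rewrite subn0 upd2_self; exact: rtn1_refl.
  apply: rtn1_trans (IH (ltnW lek)); apply/prel_seq.
  exists (f, moving (X - k.+1) (k * base)).
    by apply/rel_rdec; rewrite upd2_fst // upd_upd2_fst // -subnS; split=> //; lia.
  apply/rel_incs; rewrite upd2_snd upd_upd2_snd mulSn addnC; split=> // _.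
  apply: leq_ltn_trans ltB; have : k.+1 * base <= X * base by rewrite leq_mul2r lek orbT.
  by rewrite mulSn; lia.
apply/prel_seq; exists (f, moving 0 (X * base)).
  by apply/rel_rzero; rewrite upd2_fst.
apply/prel_seq; exists (f, moving 0 (X * base + code f.1.2)); last exact: rel_pour_complete.
apply/rel_ralts; exists f.1.2; first by rewrite mem_enum.
apply/prel_seq; exists (f, moving 0 (X * base)); first exact/rel_rtest.
by apply/rel_incs; rewrite upd2_snd upd_upd2_snd.
Qed.

Lemma rel_pop_sound f s' : rel (pop j) (f, x) s' ->
  exists k g, X = k * base + code g /\ s' = ((f.1.1, g, f.2), upd x j k).
Proof.
move=> /prel_seq[s1 /prel_star S].
have [k lek ->] : exists2 k, k * base <= X & s1 = (f, moving (X - k * base) k).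
  apply: (star_inv (I := fun s => exists2 k, k * base <= X &
    s = (f, moving (X - k * base) k))) S; last first.
    by exists 0; rewrite // subn0 upd2_self.
  move=> u u' [k lek ->] /prel_seq[u1 /rel_decs[-> le] /rel_rinc[-> _]].
  rewrite upd2_fst // upd_upd2_fst // in le *; rewrite upd2_snd upd_upd2_snd.
  by exists k.+1; rewrite mulSn; [lia | rewrite -subnDA addnC].
move=> /prel_seq[s2 /rel_ralts[g _ /prel_seq[s3 /rel_decs[-> le] /rel_rset ->]]].
rewrite upd2_fst // upd_upd2_fst // in le *.
move=> /prel_seq[s4 /rel_rzero[-> E]]; rewrite upd2_fst // in E.
rewrite E => /rel_pour_sound ->.
by exists k, g; split=> //; lia.
Qed.

Lemma rel_pop_complete f k g : X = k * base + code g -> X < B ->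
  rel (pop j) (f, x) ((f.1.1, g, f.2), upd x j k).
Proof.
move=> XE ltB; apply/prel_seq; exists (f, moving (code g) k).
  apply/prel_star; suff H i : i <= k ->
      star (rel (Seq (rtimes base (rdec j)) (rinc tmp))) (f, x) (f, moving (X - i * base) i).
    by have := H k (leqnn _); rewrite (_ : X - k * base = code g) // XE addKn.
  elim: i => [|i IH] lei; first by rewrite subn0 upd2_self; exact: rtn1_refl.
  have lek : i.+1 * base <= k * base by rewrite leq_mul2r lei orbT.
  apply: rtn1_trans (IH (ltnW lei)); apply/prel_seq.
  exists (f, moving (X - i.+1 * base) i).
    apply/rel_decs; rewrite upd2_fst // upd_upd2_fst // -subnDA [_ * _ + _]addnC -mulSn.
    by split=> //; rewrite mulSn in lek; lia.
  apply/rel_rinc; rewrite upd2_snd upd_upd2_snd; split=> //.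
  rewrite XE in ltB; have : i.+1 <= i.+1 * base by exact: leq_pmulr.
  by lia.
apply/prel_seq; exists ((f.1.1, g, f.2), moving 0 k).
  apply/rel_ralts; exists g; first by rewrite mem_enum.
  apply/prel_seq; exists (f, moving 0 k); last exact/rel_rset.
  by apply/rel_decs; rewrite upd2_fst // upd_upd2_fst // subnn.
apply/prel_seq; exists ((f.1.1, g, f.2), moving 0 k).
  by apply/rel_rzero; rewrite upd2_fst.
apply: rel_pour_complete; rewrite XE in ltB.
by have : k <= k * base by [exact: leq_pmulr]; lia.
Qed.

End TwoRegisters.
End StackRegisters.

Section Pack6.
Variable T : Type.

Definition pack6 (a0 a1 a2 a3 a4 a5 : T) : {ffun 'I_6 -> T} :=
  [ffun j : 'I_6 => nth a0 [:: a0; a1; a2; a3; a4; a5] j].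

Lemma eq_ffun6 (f g : {ffun 'I_6 -> T}) :
  f (@Ordinal 6 0 isT) = g (@Ordinal 6 0 isT) -> f (@Ordinal 6 1 isT) = g (@Ordinal 6 1 isT) ->
  f (@Ordinal 6 2 isT) = g (@Ordinal 6 2 isT) -> f (@Ordinal 6 3 isT) = g (@Ordinal 6 3 isT) ->
  f (@Ordinal 6 4 isT) = g (@Ordinal 6 4 isT) -> f (@Ordinal 6 5 isT) = g (@Ordinal 6 5 isT) ->
  f = g.
Proof.
move=> *; apply/ffunP => -[[|[|[|[|[|[|//]]]]]] lt];
  by rewrite (bool_irrelevance lt isT).
Qed.

End Pack6.

Definition r_in : 'I_6 := @Ordinal 6 0 isT.
Definition r_ctr : 'I_6 := @Ordinal 6 1 isT.
Definition r_pos : 'I_6 := @Ordinal 6 2 isT.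
Definition r_left : 'I_6 := @Ordinal 6 3 isT.
Definition r_right : 'I_6 := @Ordinal 6 4 isT.
Definition r_tmp : 'I_6 := @Ordinal 6 5 isT.

Lemma shift_pack6 d0 d1 d2 d3 d4 d5 x0 x1 x2 x3 x4 x5 :
  [ffun j => shift (pack6 d0 d1 d2 d3 d4 d5 j) (pack6 x0 x1 x2 x3 x4 x5 j)] =
  pack6 (shift d0 x0) (shift d1 x1) (shift d2 x2) (shift d3 x3) (shift d4 x4) (shift d5 x5).
Proof. by apply: eq_ffun6; rewrite !ffunE. Qed.

Lemma upd_pack6_left x0 x1 x2 x3 x4 x5 v :
  upd (pack6 x0 x1 x2 x3 x4 x5) r_left v = pack6 x0 x1 x2 v x4 x5.
Proof. by apply: eq_ffun6; rewrite !ffunE. Qed.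

Lemma upd_pack6_right x0 x1 x2 x3 x4 x5 v :
  upd (pack6 x0 x1 x2 x3 x4 x5) r_right v = pack6 x0 x1 x2 x3 v x5.
Proof. by apply: eq_ffun6; rewrite !ffunE. Qed.

(** * The rover that follows a counter automaton *)

Section CounterToRover.
Variables (Sigma : finType) (N : counter_automaton Sigma).
Notation Wk := (nc_work N).
Notation F := (nc_state N * Wk * dir)%type.
Notation obs := {ffun 'I_6 -> marked Sigma}.
Notation cmd := {ffun 'I_6 -> dir}.
Notation prg := (prog obs cmd F).
Notation move := (nc_state N * Wk * dir * dir * dir)%type.
Notation base := (base Wk).
Notation code := (code (nc_blank N)).
Notation push := (push Sigma (nc_state N) (nc_blank N) r_tmp).
Notation pop := (pop Sigma (nc_state N) (nc_blank N) r_tmp).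
Notation rtest := (rtest Sigma 6).

(* The work tape is kept as two stacks of digits, read away from the head. *)
Fixpoint lval (T : nat -> Wk) (p : nat) : nat :=
  if p is p'.+1 then lval T p' * base + code (T p') else 0.

Fixpoint rval (T : nat -> Wk) (k p : nat) : nat :=
  if k is k'.+1 then rval T k' p.+1 * base + code (T p) else 0.

Lemma eq_lval T T' p : (forall j, j < p -> T j = T' j) -> lval T p = lval T' p.
Proof.
elim: p => //= p IH H; rewrite H // IH // => j lt; apply: H; exact: ltnW.
Qed.

Lemma eq_rval T T' k p : (forall j, p <= j -> T j = T' j) -> rval T k p = rval T' k p.
Proof.
elim: k p => //= k IH p H; rewrite H // (IH p.+1) // => j lt; apply: H; exact: ltnW.
Qed.

(** A blank as the most significant digit does not count; this lets the number of cells in [rval]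
    stay [L] while the head moves. *)
Lemma rval_blank T k p : T (p + k) = nc_blank N -> rval T k.+1 p = rval T k p.
Proof.
elim: k p => [|k IH] p Tb; first by rewrite addn0 in Tb; rewrite /= Tb code_blank.
by rewrite -[LHS]/(rval T k.+1 p.+1 * base + code (T p)) IH // addSnnS.
Qed.

Lemma push_lt k g e : k < base ^ e -> k * base + code g < base ^ e.+1.
Proof.
move=> lt; have := code_lt (nc_blank N) g; rewrite expnSr.
have : k.+1 * base <= base ^ e * base by rewrite leq_mul2r lt orbT.
by rewrite mulSn; lia.
Qed.

Lemma lval_lt T p : lval T p < base ^ p.
Proof. by elim: p => //= p IH; exact: push_lt. Qed.

Lemma rval_lt T k p : rval T k p < base ^ k.
Proof. by elim: k p => //= k IH p; exact: push_lt. Qed.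

(** The finite control holds the symbol under the work head, here the one just written, and the
    pending move of that head, already corrected at cell 0; [shift_tape] then carries the move out
    on the stacks. *)
Definition choose_move : prg :=
  Atom (fun f (o : obs) f' (c : cmd) => [exists t : move, [&&
    t \in nc_trans f.1.1 (o r_in) f.1.2 (o r_ctr == lmark),
    (t.2 == Minus) ==> (o r_ctr != lmark),
    f' == (t.1.1.1.1, t.1.1.1.2,
           if (t.1.2 == Minus) && (o r_pos == lmark) then Stay else t.1.2) &
    c == pack6 (if (t.1.1.2 == Plus) && (o r_in == rmark) then Stay else t.1.1.2)
               t.2 t.1.2 Stay Stay Stay]]).

Definition shift_tape : prg :=
  Alt (rtest (fun f : F => f.2 == Stay))
  (Alt (Seq (rtest (fun f : F => f.2 == Plus)) (Seq (push r_left) (pop r_right)))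
       (Seq (rtest (fun f : F => f.2 == Minus)) (Seq (push r_right) (pop r_left)))).

Definition sim_move : prg := Seq choose_move shift_tape.

Definition counter_rover : rover Sigma 6 :=
  compile (@rover_idle Sigma 6) (nc_init N, nc_blank N, Stay)
    (fun f : F => nc_acc f.1.1) (Star sim_move).

Section Word.
Variables (w : seq Sigma) (L B : nat).
Notation n := (size w).
Notation rel p := (prel (@rover_obs Sigma 6 w) (@rover_app 6 B) (p : prg)).

Section Shift.
Variables (T : nat -> Wk) (g : Wk) (p : nat) (d : dir) (q : nc_state N) (i c : nat).
Notation T' := (fun j => if j == p then g else T j).
Notation p' := (shift d p).
Hypothesis blankT : forall j, L <= j -> T j = nc_blank N.
Hypothesis p_lt : p < L.
Hypothesis d_pos : d = Minus -> 0 < p.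

Lemma push_left_val : lval T p * base + code g = lval T' p.+1.
Proof. by rewrite /= eqxx (@eq_lval T' T) // => j lt; rewrite ltn_eqF. Qed.

Lemma push_right_val : rval T L p.+1 * base + code g = rval T' L p.
Proof.
rewrite -[RHS]rval_blank /=; last by rewrite /= gtn_eqF ?blankT //; lia.
by rewrite eqxx (@eq_rval T' T) // => j lt; rewrite gtn_eqF.
Qed.

Lemma pop_right_val : rval T L p.+1 = rval T' L p.+2 * base + code (T' p.+1).
Proof.
rewrite -[RHS]/(rval T' L.+1 p.+1) -rval_blank; last by rewrite blankT //; lia.
by apply: eq_rval => j lt; rewrite gtn_eqF.
Qed.

Lemma pop_left_val : 0 < p -> lval T p = lval T' p.-1 * base + code (T' p.-1).
Proof.
case: (p) => //= k _; rewrite ltn_eqF //.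
rewrite (@eq_lval (fun j => if j == k.+1 then g else T j) T) //.
by move=> j lt; rewrite ltn_eqF //; lia.
Qed.

Notation before := ((q, g, d), pack6 i c p' (lval T p) (rval T L p.+1) 0).
Notation after := ((q, T' p', d), pack6 i c p' (lval T' p') (rval T' L p'.+1) 0).

(** What [pop] has guessed agrees with the actual stack by [push_inj], the true quotient and digit
    being those of [pop_right_val] and [pop_left_val]. *)
Lemma shift_tape_sound s' : rel shift_tape before s' -> s' = after.
Proof.
have tmp0 x0 x1 x2 x3 x4 : pack6 x0 x1 x2 x3 x4 0 r_tmp = 0 by rewrite ffunE.
move=> /prel_alt[/rel_rtest[-> /eqP/= ->]|/prel_alt[]].
- rewrite /= eqxx; congr (_, pack6 _ _ _ _ _ _).
    by apply: eq_lval => j lt; rewrite ltn_eqF.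
  by apply: eq_rval => j lt; rewrite gtn_eqF.
- move=> /prel_seq[s1 /rel_rtest[-> /eqP/= dE] /prel_seq[s2 /rel_push_sound-> //]].
  rewrite upd_pack6_left => /rel_pop_sound[//|//|k [g' [E ->]]].
  rewrite upd_pack6_right !ffunE /= in E *.
  have [kE gE] := push_inj (etrans (esym pop_right_val) E).
  by rewrite push_left_val dE /= -kE -gE.
- move=> /prel_seq[s1 /rel_rtest[-> /eqP/= dE] /prel_seq[s2 /rel_push_sound-> //]].
  rewrite upd_pack6_right => /rel_pop_sound[//|//|k [g' [E ->]]].
  rewrite upd_pack6_left !ffunE /= in E *.
  have p0 := d_pos dE.
  have [kE gE] := push_inj (etrans (esym (pop_left_val p0)) E).
  by rewrite push_right_val dE /= -kE -gE prednK.
Qed.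

(** The exponent is [L.+1] because the right stack is counted with [L] digits and a push adds
    one. *)
Lemma shift_tape_complete : base ^ L.+1 <= B -> rel shift_tape before after.
Proof.
move=> leB; have tmp0 x0 x1 x2 x3 x4 : pack6 x0 x1 x2 x3 x4 0 r_tmp = 0 by rewrite ffunE.
have leL k : k <= L -> base ^ k <= B.
  by move=> lek; apply: leq_trans leB; apply: leq_pexp2l => //; lia.
have rlt k : rval T L k < B by exact: leq_trans (rval_lt _ _ _) (leL _ (leqnn _)).
have llt : lval T p < B by apply: leq_trans (lval_lt _ _) (leL _ _); exact: ltnW.
apply/prel_alt; case dE: d.
- right; apply/prel_alt; right; apply/prel_seq; exists ((q, g, Minus),
      pack6 i c p.-1 (lval T p) (rval T L p.+1) 0); first exact/rel_rtest.
  have p0 := d_pos dE.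
  apply/prel_seq; eexists.
    apply: rel_push_complete; rewrite // !ffunE /=.
    by apply: leq_trans leB; apply: push_lt; exact: rval_lt.
  rewrite upd_pack6_right !ffunE /= push_right_val.
  have := @rel_pop_complete _ _ _ (nc_blank N) _ r_tmp w B r_left
    (pack6 i c p.-1 (lval T p) (rval T' L p) 0) isT (tmp0 _ _ _ _ _) (q, g, Minus)
    (lval T' p.-1) (T' p.-1).
  by rewrite upd_pack6_left !ffunE /= prednK //; apply=> //; exact: pop_left_val.
- left; apply/rel_rtest; split=> //; rewrite /= eqxx; congr (_, pack6 _ _ _ _ _ _).
    by apply: eq_lval => j lt; rewrite ltn_eqF.
  by apply: eq_rval => j lt; rewrite gtn_eqF.
- right; apply/prel_alt; left; apply/prel_seq; exists ((q, g, Plus),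
      pack6 i c p.+1 (lval T p) (rval T L p.+1) 0); first exact/rel_rtest.
  apply/prel_seq; eexists.
    apply: rel_push_complete; rewrite // !ffunE /=.
    apply: leq_trans (push_lt _ (lval_lt _ _)) _.
    by apply: leL.
  rewrite upd_pack6_left !ffunE /= push_left_val.
  have := @rel_pop_complete _ _ _ (nc_blank N) _ r_tmp w B r_right
    (pack6 i c p.+1 (lval T' p.+1) (rval T L p.+1) 0) isT (tmp0 _ _ _ _ _) (q, g, Plus)
    (rval T' L p.+2) (T' p.+1).
  by rewrite upd_pack6_right !ffunE /=; apply=> //; exact: pop_right_val.
Qed.

End Shift.

Hypothesis pos_lt : forall c : nc_conf N, nc_reach w c -> nc_pos c < L.

Implicit Type c : nc_conf N.

Lemma reach_head c : nc_reach w c -> nc_head c <= n.+1.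
Proof. by elim=> //= {}c c' _ _ [q g di dw dc _ _] /=; rewrite /move_head; lia. Qed.

Lemma reach_blank c : nc_reach w c -> forall j, L <= j -> nc_tape c j = nc_blank N.
Proof.
elim=> //= {}c c' Rc IH [q g di dw dc _ _] j lej /=.
by rewrite gtn_eqF ?IH //; exact: leq_trans (pos_lt Rc) lej.
Qed.

Definition simulates (c : nc_conf N) (fx : F * {ffun 'I_6 -> nat}) : Prop :=
  exists d, fx = ((nc_q c, nc_tape c (nc_pos c), d),
    pack6 (nc_head c) (nc_ctr c) (nc_pos c) (lval (nc_tape c) (nc_pos c))
          (rval (nc_tape c) L (nc_pos c).+1) 0).

Lemma effective_pos dw p :
  shift (if (dw == Minus) && (p == 0) then Stay else dw) p = shift dw p.
Proof. by case: dw => //=; case: p. Qed.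

Lemma effective_head di i : i <= n.+1 ->
  shift (if (di == Plus) && (n < i) then Stay else di) i = move_head w di i.
Proof. by rewrite /move_head; case: di => //=; case: ltnP => /=; lia. Qed.

Lemma sim_move_sound c fx fx' : nc_reach w c -> simulates c fx ->
  rel sim_move fx fx' -> exists2 c', nc_step w c c' & simulates c' fx'.
Proof.
move=> Rc [d0 ->] /prel_seq[[f1 x1] [cm /existsP[[[[[q g] di] dw] dc]]]].
rewrite /= !ffunE /= input_sym_eq_lmark => /and4P[tr /implyP Hdc /eqP -> /eqP ->] [-> _].
rewrite shift_pack6 !input_sym_eq_lmark input_sym_eq_rmark.
rewrite effective_head ?(reach_head Rc) //=.
rewrite -[shift dw (nc_pos c)]effective_pos => /shift_tape_sound ->.
- exists (NcConf q (move_head w di (nc_head c))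
    (fun j => if j == nc_pos c then g else nc_tape c j)
    (shift dw (nc_pos c)) (shift dc (nc_ctr c))).
    by apply: NcStep tr _ => E; rewrite lt0n; apply: Hdc; rewrite E.
  by rewrite effective_pos; eexists.
- exact: reach_blank.
- exact: pos_lt.
- by case: eqP => [->|//] /=; case: (nc_pos c).
Qed.

Lemma sim_move_complete c c' fx : nc_reach w c -> simulates c fx -> nc_step w c c' ->
  n.+2 <= B -> L <= B -> base ^ L.+1 <= B -> nc_ctr c' < B ->
  exists2 fx', rel sim_move fx fx' & simulates c' fx'.
Proof.
move=> Rc [d0 ->] st nB LB bB; have pos' := pos_lt (NcReachS Rc st).
case: st pos' => q g di dw dc tr dpos /= pos' ctrB.
set dw' := if (dw == Minus) && (nc_pos c == 0) then Stay else dw.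
have pE : shift dw' (nc_pos c) = shift dw (nc_pos c) by exact: effective_pos.
eexists.
  apply/prel_seq; exists ((q, g, dw'), pack6 (move_head w di (nc_head c))
    (shift dc (nc_ctr c)) (shift dw' (nc_pos c)) (lval (nc_tape c) (nc_pos c))
    (rval (nc_tape c) L (nc_pos c).+1) 0).
    exists (pack6 (if (di == Plus) && (n < nc_head c) then Stay else di)
                  dc dw Stay Stay Stay).
      apply/existsP; exists (q, g, di, dw, dc).
      rewrite /= !ffunE /= !input_sym_eq_lmark input_sym_eq_rmark tr !eqxx !andbT.
      by apply/implyP => /eqP/dpos; rewrite lt0n.
    split; first by rewrite shift_pack6 effective_head ?(reach_head Rc) // pE.
    case=> [[|[|[|[|[|[|//]]]]]] lt]; rewrite !ffunE //=.
    - case: ifP => //= + diE; rewrite diE /= => /negbT; rewrite -leqNgt => le.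
      by apply: leq_trans nB; rewrite !ltnS.
    - by move=> dcE; move: ctrB; rewrite dcE.
    - by move=> dwE; move: pos'; rewrite dwE => lt'; exact: leq_trans lt' LB.
  apply: shift_tape_complete => //.
  - exact: reach_blank.
  - exact: pos_lt.
  - by rewrite /dw'; case: eqP => [->|//] /=; case: (nc_pos c).
by rewrite pE; eexists.
Qed.


Notation surface := (nc_state N * 'I_n.+2 * {ffun 'I_L -> Wk} * 'I_L)%type.

Lemma simulates_start :
  simulates (nc_start N) ((nc_init N, nc_blank N, Stay), [ffun=> 0]).
Proof.
exists Stay; congr (_, _) => /=.
have -> : rval (fun=> nc_blank N) L 1 = 0.
  by elim: L 1 => //= k IH p; rewrite IH code_blank.
by apply: eq_ffun6; rewrite !ffunE.
Qed.

Lemma counter_rover_sound : rover_accepts counter_rover B w -> nc_accepts N w.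
Proof.
move=> /(compile_accepts (@rover_app_idle _ _ w B))[fx /prel_star S acc].
have [c Rc [d fxE]] : exists2 c, nc_reach w c & simulates c fx.
  apply: (star_inv (I := fun fx => exists2 c, nc_reach w c & simulates c fx)) S.
    move=> u v [c Rc su] /(sim_move_sound Rc su)[c' st sv].
    by exists c' => //; exact: NcReachS Rc st.
  by exists (nc_start N); [exact: NcReach0 | exact: simulates_start].
by exists c => //; move: acc; rewrite fxE.
Qed.

Lemma counter_rover_complete : n.+2 <= B -> L <= B -> base ^ L.+1 <= B ->
  #|{: surface * surface}|.+1 < B -> nc_accepts N w -> rover_accepts counter_rover B w.
Proof.
move=> nB LB bB HB acc; have L0 : 0 < L.
  exact: leq_ltn_trans (leq0n _) (pos_lt (NcReach0 N w)).
have [c S cacc] := nc_accepts_le pos_lt L0 acc.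
have [Rc [fx Sf [d fxE]]] : nc_reach w c /\
    exists2 fx, star (rel sim_move) ((nc_init N, nc_blank N, Stay), [ffun=> 0]) fx
    & simulates c fx.
  elim: S => [|u v [st le] _ [Ru [fx Sf sf]]].
    split; first exact: NcReach0.
    by exists ((nc_init N, nc_blank N, Stay), [ffun=> 0]);
      [exact: rtn1_refl | exact: simulates_start].
  split; first exact: NcReachS Ru st.
  have [fx' st' sf'] := sim_move_complete Ru sf st nB LB bB (leq_ltn_trans le HB).
  by exists fx' => //; exact: rtn1_trans Sf.
apply/(compile_accepts (@rover_app_idle _ _ w B)); exists fx; first exact/prel_star.
by rewrite fxE.
Qed.

End Word.

(** Exponentials of the logarithm are polynomial: [base <= 2 ^ base] and
    [2 ^ (trunc_log 2 n).+1 <= n.+2 ^ 2]. *)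
Lemma log_power_bound k n : base ^ (k * (trunc_log 2 n).+1) <= n.+2 ^ (2 * base * k).
Proof.
have le2 : 2 ^ (trunc_log 2 n).+1 <= n.+2 ^ 2.
  have [->|n0] := posnP n; first by rewrite trunc_log0.
  by rewrite expnS; have := trunc_logP (isT : 1 < 2) n0; nia.
have -> : 2 * base * k = 2 * (base * k) by rewrite mulnA.
rewrite [n.+2 ^ _]expnM; apply: (@leq_trans ((2 ^ (trunc_log 2 n).+1) ^ (base * k))).
  rewrite -expnM [X in _ <= 2 ^ X](_ : _ = base * (k * (trunc_log 2 n).+1)); last by lia.
  rewrite [2 ^ _]expnM; case: (k * _) => // e.
  by rewrite leq_exp2r //; exact: ltnW (ltn_expl _ _).
by case: (base * k) => // e; rewrite leq_exp2r.
Qed.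

(** The height bound counts pairs of surfaces, whence the leading 2. In a surface, states and input
    positions contribute [#|nc_state N|] and 1, tape contents and work positions [2 * base * k]
    each. The summand [base] pays for the extra digit in [base ^ L.+1], and 3 for additive
    constants. *)
Definition counter_exponent (k : nat) : nat :=
  2 * (#|nc_state N| + 1 + 2 * (2 * base * k)) + base + 3.

Lemma counter_bounds k n (L := k * (trunc_log 2 n).+1) (B := n.+2 ^ counter_exponent k) :
  [/\ n.+2 <= B, L <= B, base ^ L.+1 <= B &
      #|{: (nc_state N * 'I_n.+2 * {ffun 'I_L -> Wk} * 'I_L) *
           (nc_state N * 'I_n.+2 * {ffun 'I_L -> Wk} * 'I_L)}|.+1 < B].
Proof.
have base2 : 1 < base by rewrite ltnS; apply/card_gt0P; exists (nc_blank N).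
set a := 2 * base * k; have Pa : base ^ L <= n.+2 ^ a by exact: log_power_bound.
have La : L <= n.+2 ^ a by apply: leq_trans Pa; exact: ltnW (ltn_expl _ _).
have mono e : e <= counter_exponent k -> n.+2 ^ e <= B by move=> le; rewrite leq_exp2l.
split.
- by rewrite -{1}[n.+2]expn1; apply: mono; rewrite /counter_exponent; lia.
- by apply: leq_trans La (mono _ _); rewrite /counter_exponent -/a; lia.
- apply: (@leq_trans (n.+2 ^ (base + a))); last first.
    by apply: mono; rewrite /counter_exponent -/a; lia.
  rewrite expnS expnD; apply: leq_mul => //.
  by apply: ltnW; exact: ltn_expl.
set s := #|nc_state N| + 1 + 2 * a.
have cardS : #|{: nc_state N * 'I_n.+2 * {ffun 'I_L -> Wk} * 'I_L}| <= n.+2 ^ s.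
  rewrite !card_prod card_ffun !card_ord /s expnD mul2n -addnn [n.+2 ^ (a + a)]expnD mulnA.
  apply: leq_mul => //; apply: leq_mul; last first.
    by apply: leq_trans Pa; case: (L) => // e; rewrite leq_exp2r.
  rewrite expnD expn1; apply: leq_mul => //.
  by apply: ltnW; exact: ltn_expl.
rewrite card_prod; apply: (@leq_ltn_trans (n.+2 ^ (2 * s) + 1)).
  by rewrite addn1 ltnS mul2n -addnn expnD; exact: leq_mul.
apply: (@leq_trans (n.+2 ^ (2 * s + 3))); last first.
  by apply: mono; rewrite /counter_exponent -/a -/s; lia.
rewrite expnD; have : 0 < n.+2 ^ (2 * s) by rewrite expn_gt0.
have : 2 ^ 3 <= n.+2 ^ 3 by rewrite leq_exp2r.
by nia.
Qed.

End CounterToRover.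

Theorem Aux2NC_rover (Sigma : finType) (L : language Sigma) :
  Aux2NC L -> rover_class L.
Proof.
move=> [N [[k Hk] HN]]; exists 6, (counter_rover N), (counter_exponent N k) => w.
have pos_lt : forall c : nc_conf N, nc_reach w c -> nc_pos c < k * (trunc_log 2 (size w)).+1.
  by move=> c; exact: Hk.
split=> [B /(counter_rover_sound pos_lt) acc|/HN acc]; first exact/HN.
have [H1 H2 H3 H4] := counter_bounds N k (size w).
exact: counter_rover_complete pos_lt H1 H2 H3 H4 acc.
Qed.

Theorem theorem5 (Sigma : finType) :
  (forall L : language Sigma, R_U1_W2 L -> Aux2NC L) /\
  (forall L : language Sigma, Aux2NC L -> PTIME L).
Proof.
split=> L; first by move=> /R_U1_W2_rover/rover_Aux2NC.
by move=> /Aux2NC_rover/rover_PTIME.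
Qed.
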